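(* Let $\mathbb{F}$ be an algebraically closed field of characteristic different from $2$, let $\mathcal{C}$ be the Cayley algebra over $\mathbb{F}$, and let $\mathcal{K}$ and $\mathcal{Q}$ be the Hurwitz algebras over $\mathbb{F}$ of dimension $2$ and $4$ respectively. Tensor products carry the tensor product of the standard involutions. (A) Up to equivalence, the fine gradings on $\mathcal{C}\otimes\mathcal{K}$ are exactly the following two, each with homogeneous components $(\mathcal{C}\otimes\mathcal{K})_{(g,h)}=\mathcal{C}_g\otimes\mathcal{K}_h$: 1. the $(\mathbb{Z}/2)^3\times\mathbb{Z}/2=(\mathbb{Z}/2)^4$-grading formed by the grading $\Gamma^2_{\mathcal{C}}$ on $\mathcal{C}$ and the nontrivial $\mathbb{Z}/2$-grading on $\mathcal{K}$; 2. the $\mathbb{Z}^2\times\mathbb{Z}/2$-grading formed by the Cartan grading $\Gamma^1_{\mathcal{C}}$ on $\mathcal{C}$ and the nontrivial $\mathbb{Z}/2$-grading on $\mathcal{K}$. (B) Up to equivalence, the fine gradings on $\mathcal{C}\otimes\mathcal{Q}$ are exactly the following four, each with homogeneous components $(\mathcal{C}\otimes\mathcal{Q})_{(g,h)}=\mathcal{C}_g\otimes\mathcal{Q}_h$: 1. the $(\mathbb{Z}/2)^3\times(\mathbb{Z}/2)^2=(\mathbb{Z}/2)^5$-grading formed by $\Gamma^2_{\mathcal{C}}$ and the $(\mathbb{Z}/2)^2$-grading on $\mathcal{Q}$; 2. the $(\mathbb{Z}/2)^3\times\mathbb{Z}$-grading formed by $\Gamma^2_{\mathcal{C}}$ and the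 Cartan $\mathbb{Z}$-grading on $\mathcal{Q}$; 3. the $\mathbb{Z}^2\times(\mathbb{Z}/2)^2$-grading formed by $\Gamma^1_{\mathcal{C}}$ and the $(\mathbb{Z}/2)^2$-grading on $\mathcal{Q}$; 4. the $\mathbb{Z}^2\times\mathbb{Z}=\mathbb{Z}^3$-grading formed by $\Gamma^1_{\mathcal{C}}$ and the Cartan $\mathbb{Z}$-grading on $\mathcal{Q}$.
   Context: A Hurwitz algebra is a unital algebra with a nondegenerate multiplicative quadratic form $n$; its standard involution is $\bar x=n(x,1)1-x$, where $n(x,y)=n(x+y)-n(x)-n(y)$. Over an algebraically closed field there is, up to isomorphism, exactly one Hurwitz algebra in each dimension $1,2,4,8$; the $8$-dimensional one is the Cayley algebra $\mathcal{C}$. $\mathcal{C}$ has a canonical basis $\{e_1,e_2,u_1,u_2,u_3,v_1,v_2,v_3\}$ with (indices mod $3$) $e_1,e_2$ orthogonal idempotents, $e_1+e_2=1$, $e_1u_i=u_i=u_ie_2$, $e_2v_i=v_i=v_ie_1$, $u_iv_i=-e_1$, $v_iu_i=-e_2$, $u_iu_{i+1}=-u_{i+1}u_i=v_{i+2}$, $v_iv_{i+1}=-v_{i+1}v_i=u_{i+2}$, all other products of basis elements being $0$. Cartan grading $\Gamma^1_{\mathcal{C}}$ by $\mathbb{Z}^2$: $\mathcal{C}_{(0,0)}=\mathbb{F}e_1\oplus\mathbb{F}e_2$, $\mathcal{C}_{(1,0)}=\mathbb{F}u_1$, $\mathcal{C}_{(-1,0)}=\mathbb{F}v_1$, $\mathcal{C}_{(0,1)}=\mathbb{F}u_2$,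 $\mathcal{C}_{(0,-1)}=\mathbb{F}v_2$, $\mathcal{C}_{(1,1)}=\mathbb{F}v_3$, $\mathcal{C}_{(-1,-1)}=\mathbb{F}u_3$. Grading $\Gamma^2_{\mathcal{C}}$ by $(\mathbb{Z}/2)^3$: with $u=e_1-e_2$, $v=u_1+v_1$, $w=u_2+v_2$, the basis elements $1,u,v,w,uv,uw,vw,(uv)w$ are homogeneous, with $\deg u=(\bar1,\bar0,\bar0)$, $\deg v=(\bar0,\bar1,\bar0)$, $\deg w=(\bar0,\bar0,\bar1)$ (each component one-dimensional). $\mathcal{Q}$ is the subalgebra spanned by $e_1,e_2,u_1,v_1$. Its Cartan $\mathbb{Z}$-grading is $\mathcal{Q}_0=\mathbb{F}e_1\oplus\mathbb{F}e_2$, $\mathcal{Q}_1=\mathbb{F}u_1$, $\mathcal{Q}_{-1}=\mathbb{F}v_1$. Its $(\mathbb{Z}/2)^2$-grading is $\mathcal{Q}_{(\bar0,\bar0)}=\mathbb{F}1$, $\mathcal{Q}_{(\bar1,\bar0)}=\mathbb{F}u$, $\mathcal{Q}_{(\bar0,\bar1)}=\mathbb{F}v$, $\mathcal{Q}_{(\bar1,\bar1)}=\mathbb{F}uv$ with $u=e_1-e_2$, $v=u_1+v_1$. $\mathcal{K}=\mathbb{F}e_1\oplus\mathbb{F}e_2$, with $\mathbb{Z}/2$-grading $\mathcal{K}_{\bar0}=\mathbb{F}1$, $\mathcal{K}_{\bar1}=\mathbb{F}u$, $u=e_1-e_2$. Gradings are by abelian groups: a $G$-grading on $(\mathcal{A},-)$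 is a decomposition $\mathcal{A}=\bigoplus_{g\in G}\mathcal{A}_g$ with $\mathcal{A}_g\mathcal{A}_h\subseteq\mathcal{A}_{gh}$ and $\overline{\mathcal{A}_g}\subseteq\mathcal{A}_g$. A $G$-grading and an $H$-grading on $(\mathcal{A},-)$ are equivalent if there is an automorphism of $\mathcal{A}$ commuting with the involution and mapping each nonzero homogeneous component of the first onto a nonzero homogeneous component of the second (inducing a bijection of supports). A grading is a refinement of another if each of its components is contained in a component of the other, proper if some inclusion is strict; a grading is fine if it has no proper refinement (among such gradings). *)

(* Defs.v *)
From HB Require Import structures.
From mathcomp Require Import all_boot all_order all_algebra.
From mathcomp Require Import ring.

Set Implicit Arguments.
Unset Strict Implicit.
Unset Printing Implicit Defensive.

Import GRing.Theory.
Local Open Scope ring_scope.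

(** * Hurwitz algebras *)

Definition polar (F : fieldType) (V : lmodType F) (n : V -> F) (x y : V) : F :=
  n (x + y) - n x - n y.

Record hurwitz (F : fieldType) := Hurwitz {
  hsort :> vectType F;
  hmul : hsort -> hsort -> hsort;
  hone : hsort;
  hnorm : hsort -> F;
  hmul_linearl : forall a x y z,
    hmul (a *: x + y) z = a *: hmul x z + hmul y z;
  hmul_linearr : forall a x y z,
    hmul z (a *: x + y) = a *: hmul z x + hmul z y;
  hmul1x : forall x, hmul hone x = x;
  hmulx1 : forall x, hmul x hone = x;
  hnormZ : forall a x, hnorm (a *: x) = a ^+ 2 * hnorm x;
  hpolar_linear : forall a x y z,
    polar hnorm (a *: x + y) z = a * polar hnorm x z + polar hnorm y z;
  hnorm_nondegenerate : forall x, (forall y, polar hnorm x y = 0) -> x = 0;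
  hnormM : forall x y, hnorm (hmul x y) = hnorm x * hnorm y }.

Arguments hone {F} _.

Definition hconj (F : fieldType) (A : hurwitz F) (x : A) : A :=
  polar (@hnorm F A) x (hone A) *: hone A - x.

Section HurwitzSpan.
Variables (F : fieldType) (A : hurwitz F).

Let mull (z x : A) := hmul z x.
Let mulr (z x : A) := hmul x z.

Let mull_linear z : linear (mull z). Proof. by move=> a x y; apply: hmul_linearr. Qed.
Let mulr_linear z : linear (mulr z). Proof. by move=> a x y; apply: hmul_linearl. Qed.

HB.instance Definition _ z := GRing.isSemilinear.Build F A A _ (mull z)
  (GRing.semilinear_linear (mull_linear z)).
HB.instance Definition _ z := GRing.isSemilinear.Build F A A _ (mulr z)
  (GRing.semilinear_linear (mulr_linear z)).

Lemma hmul_span (s t : seq A) (W : {vspace A}) :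
  (forall x y, x \in s -> y \in t -> hmul x y \in W) ->
  forall x y, x \in <<s>>%VS -> y \in <<t>>%VS -> hmul x y \in W.
Proof.
move=> stW x y xs; suff: (<<t>> <= linfun (mull x) @^-1: W)%VS.
  by move=> /subvP tW /tW; rewrite -memv_preim lfunE.
apply/span_subvP => z zt; rewrite -memv_preim lfunE.
suff: (<<s>> <= linfun (mulr z) @^-1: W)%VS.
  by move=> /subvP sW; move: (sW x xs); rewrite -memv_preim lfunE.
by apply/span_subvP => w ws; rewrite -memv_preim lfunE; apply: stW.
Qed.

Lemma hmulDl (x y z : A) : hmul (x + y) z = hmul x z + hmul y z.
Proof. exact: (linearD (mulr z)). Qed.

Lemma hmulDr (x y z : A) : hmul z (x + y) = hmul z x + hmul z y.
Proof. exact: (linearD (mull z)). Qed.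

Lemma hmul_suml I (r : seq I) (P : pred I) (f : I -> A) z :
  hmul (\sum_(i <- r | P i) f i) z = \sum_(i <- r | P i) hmul (f i) z.
Proof. exact: (linear_sum (mulr z)). Qed.

Lemma hmul_sumr I (r : seq I) (P : pred I) (f : I -> A) z :
  hmul z (\sum_(i <- r | P i) f i) = \sum_(i <- r | P i) hmul z (f i).
Proof. exact: (linear_sum (mull z)). Qed.

Lemma hmulZl a (x z : A) : hmul (a *: x) z = a *: hmul x z.
Proof. exact: (linearZ_LR (mulr z)). Qed.

Lemma hmulZr a (x z : A) : hmul z (a *: x) = a *: hmul z x.
Proof. exact: (linearZ_LR (mull z)). Qed.

End HurwitzSpan.

(** * Unital subalgebras of a Hurwitz algebra with nondegenerate norm *)

Section SubHurwitz.
Variables (F : fieldType) (A : hurwitz F) (U : {vspace A}).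
Hypothesis U_mul : forall x y, x \in U -> y \in U -> hmul x y \in U.
Hypothesis U_one : hone A \in U.
Hypothesis U_nondeg : forall x, x \in U ->
  (forall y, y \in U -> polar (@hnorm F A) x y = 0) -> x = 0.

Definition sub_mul (x y : subvs_of U) : subvs_of U :=
  vsproj U (hmul (vsval x) (vsval y)).

Definition sub_one : subvs_of U := vsproj U (hone A).

Definition sub_norm (x : subvs_of U) : F := hnorm (vsval x).

Lemma val_sub_mul x y : vsval (sub_mul x y) = hmul (vsval x) (vsval y).
Proof. by rewrite vsprojK // U_mul // subvsP. Qed.

Lemma val_sub_one : vsval sub_one = hone A.
Proof. by rewrite vsprojK. Qed.

Lemma polar_sub_norm x y :
  polar sub_norm x y = polar (@hnorm F A) (vsval x) (vsval y).
Proof. by rewrite /polar /sub_norm linearD. Qed.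

Lemma sub_mul_linearl a x y z :
  sub_mul (a *: x + y) z = a *: sub_mul x z + sub_mul y z.
Proof. by rewrite /sub_mul linearP hmul_linearl linearP. Qed.

Lemma sub_mul_linearr a x y z :
  sub_mul z (a *: x + y) = a *: sub_mul z x + sub_mul z y.
Proof. by rewrite /sub_mul linearP hmul_linearr linearP. Qed.

Lemma sub_mul1x x : sub_mul sub_one x = x.
Proof. by apply: subvs_inj; rewrite val_sub_mul val_sub_one hmul1x. Qed.

Lemma sub_mulx1 x : sub_mul x sub_one = x.
Proof. by apply: subvs_inj; rewrite val_sub_mul val_sub_one hmulx1. Qed.

Lemma sub_normZ a x : sub_norm (a *: x) = a ^+ 2 * sub_norm x.
Proof. by rewrite /sub_norm linearZ hnormZ. Qed.

Lemma sub_polar_linear a x y z :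
  polar sub_norm (a *: x + y) z = a * polar sub_norm x z + polar sub_norm y z.
Proof. by rewrite !polar_sub_norm linearP hpolar_linear. Qed.

Lemma sub_norm_nondegenerate x : (forall y, polar sub_norm x y = 0) -> x = 0.
Proof.
move=> x0; apply: subvs_inj; rewrite linear0.
apply: U_nondeg => [|y yU]; first exact: subvsP.
by rewrite -(vsprojK yU) -polar_sub_norm.
Qed.

Lemma sub_normM x y : sub_norm (sub_mul x y) = sub_norm x * sub_norm y.
Proof. by rewrite /sub_norm val_sub_mul hnormM. Qed.

Definition sub_hurwitz : hurwitz F :=
  Hurwitz sub_mul_linearl sub_mul_linearr sub_mul1x sub_mulx1 sub_normZ
    sub_polar_linear sub_norm_nondegenerate sub_normM.

End SubHurwitz.

(** * The Cayley algebra *)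

(* Labels of the canonical basis; the indices 1, 2, 3 are read in 'Z_3, so
   that u_3 is [iU 3] with [3 = 0 :> 'Z_3]. *)
Inductive cidx := iE1 | iE2 | iU of 'Z_3 | iV of 'Z_3.

Definition cidx_enc (a : cidx) : bool + ('Z_3 + 'Z_3) :=
  match a with
  | iE1 => inl true | iE2 => inl false
  | iU i => inr (inl i) | iV i => inr (inr i)
  end.

Definition cidx_dec (s : bool + ('Z_3 + 'Z_3)) : cidx :=
  match s with
  | inl b => if b then iE1 else iE2
  | inr (inl i) => iU i | inr (inr i) => iV i
  end.

Lemma cidx_encK : cancel cidx_enc cidx_dec. Proof. by case. Qed.
Lemma cidx_decK : cancel cidx_dec cidx_enc. Proof. by case=> [[]|[]]. Qed.

HB.instance Definition _ := Countable.copy cidx (can_type cidx_encK).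
HB.instance Definition _ : isFinite cidx := CanIsFinite cidx_encK.

Lemma big_Z3 (V0 : nmodType) (f : 'Z_3 -> V0) :
  \sum_i f i = f 1 + f 2 + f 3.
Proof.
rewrite !big_ord_recl big_ord0 addr0 addrC.
by congr (f _ + f _ + f _); apply: val_inj.
Qed.

Lemma big_cidx (V0 : nmodType) (f : cidx -> V0) :
  \sum_a f a = f iE1 + f iE2 + (f (iU 1) + f (iU 2) + f (iU 3))
               + (f (iV 1) + f (iV 2) + f (iV 3)).
Proof.
rewrite (reindex cidx_dec) /=; last first.
  by exists cidx_enc => a _; rewrite ?cidx_encK ?cidx_decK.
by rewrite big_sumType /= big_bool big_sumType /= !big_Z3 !addrA.
Qed.

Section Cayley.
Variable F : fieldType.

Definition cayley_sort : vectType F := {ffun cidx -> F^o}.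
Implicit Types x y z : cayley_sort.

Definition cb (a : cidx) : cayley_sort := [ffun b => (b == a)%:R].

Definition cb_mul (a b : cidx) : cayley_sort :=
  match a, b with
  | iE1, iE1 => cb iE1
  | iE2, iE2 => cb iE2
  | iE1, iU i => cb (iU i)
  | iU i, iE2 => cb (iU i)
  | iE2, iV i => cb (iV i)
  | iV i, iE1 => cb (iV i)
  | iU i, iV j => if j == i then - cb iE1 else 0
  | iV i, iU j => if j == i then - cb iE2 else 0
  | iU i, iU j => if j == i + 1 then cb (iV (i + 2))
                else if i == j + 1 then - cb (iV (j + 2)) else 0
  | iV i, iV j => if j == i + 1 then cb (iU (i + 2))
                else if i == j + 1 then - cb (iU (j + 2)) else 0
  | _, _ => 0
  end.

Definition cayley_mul x y : cayley_sort :=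
  \sum_a \sum_b (x a * y b : F) *: cb_mul a b.

Definition cayley_one : cayley_sort := cb iE1 + cb iE2.

(* The only norm compatible with the table above: x (hconj x) = n(x) 1 forces
   n(e_1, e_2) = n(u_i, v_i) = 1, all other polar values and norms of basis
   elements being 0. *)
Definition cayley_norm x : F :=
  (x iE1 : F) * (x iE2 : F) + \sum_(i : 'Z_3) (x (iU i) : F) * (x (iV i) : F).

Lemma cb_sum x : x = \sum_a x a *: cb a.
Proof.
apply/ffunP => b; rewrite sum_ffunE (bigD1 b) //= !ffunE eqxx.
rewrite big1 ?addr0 => [|a]; first by rewrite /GRing.scale /= mulr1.
by rewrite !ffunE eq_sym => /negPf->; rewrite scaler0.
Qed.

Lemma cayley_mul_linearl a x y z :
  cayley_mul (a *: x + y) z = a *: cayley_mul x z + cayley_mul y z.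
Proof.
rewrite /cayley_mul scaler_sumr -big_split; apply: eq_bigr => i _ /=.
rewrite scaler_sumr -big_split; apply: eq_bigr => j _ /=.
by rewrite !ffunE mulrDl scalerDl scalerA mulrA.
Qed.

Lemma cayley_mul_linearr a x y z :
  cayley_mul z (a *: x + y) = a *: cayley_mul z x + cayley_mul z y.
Proof.
rewrite /cayley_mul scaler_sumr -big_split; apply: eq_bigr => i _ /=.
rewrite scaler_sumr -big_split; apply: eq_bigr => j _ /=.
by rewrite !ffunE mulrDr scalerDl scalerA mulrCA.
Qed.

Lemma cayley_mul_cb a b : cayley_mul (cb a) (cb b) = cb_mul a b.
Proof.
rewrite /cayley_mul (bigD1 a) //= [X in _ + X]big1 => [|i /negPf ia].
  rewrite addr0 (bigD1 b) //= [X in _ + X]big1 => [|j /negPf jb].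
    by rewrite !ffunE !eqxx mulr1 scale1r addr0.
  by rewrite !ffunE jb mulr0 scale0r.
by apply: big1 => j _; rewrite !ffunE ia mul0r scale0r.
Qed.

Lemma cayley_normE x : cayley_norm x =
  (x iE1 : F) * x iE2 + ((x (iU 1) : F) * x (iV 1) + (x (iU 2) : F) * x (iV 2)
    + (x (iU 3) : F) * x (iV 3)).
Proof. by rewrite /cayley_norm big_Z3. Qed.

Let cidx_sign (a b c : cidx) : option bool :=
  match a, b with
  | iE1, iE1 => if c == iE1 then Some false else None
  | iE2, iE2 => if c == iE2 then Some false else None
  | iE1, iU i => if c == iU i then Some false else None
  | iU i, iE2 => if c == iU i then Some false else None
  | iE2, iV i => if c == iV i then Some false else None
  | iV i, iE1 => if c == iV i then Some false else None
  | iU i, iV j => if j == i then if c == iE1 then Some true else None else None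
  | iV i, iU j => if j == i then if c == iE2 then Some true else None else None
  | iU i, iU j =>
      if j == i + 1 then if c == iV (i + 2) then Some false else None
      else if i == j + 1 then if c == iV (j + 2) then Some true else None
      else None
  | iV i, iV j =>
      if j == i + 1 then if c == iU (i + 2) then Some false else None
      else if i == j + 1 then if c == iU (j + 2) then Some true else None
      else None
  | _, _ => None
  end.

Let signed (s : option bool) (t : F) : F :=
  match s with None => 0 | Some s => if s then - t else t end.

Let cayley_mulE x y c :
  cayley_mul x y c =
  \sum_a \sum_b signed (cidx_sign a b c) ((x a : F) * (y b : F)).
Proof.
rewrite sum_ffunE; apply: eq_bigr => a _.
rewrite sum_ffunE; apply: eq_bigr => b _; rewrite ffunE.
have cbE (d : cidx) (s : bool) (t : F) :
    signed (if c == d then Some s else None) t =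
    t * (if s then - cb d else cb d) c.
  by rewrite /signed; case: s; rewrite !ffunE; case: (c == d);
    rewrite ?mulrN ?mulr1 ?mulr0 ?oppr0.
have c0 (t : F) : signed None t = t * (0 : cayley_sort) c by rewrite ffunE mulr0.
rewrite {1}/GRing.scale /=.
symmetry; case: a b => [||i|i] [||j|j]; cbn [cb_mul cidx_sign];
  try (destruct (j == i + 1)); try (destruct (i == j + 1));
  try (destruct (j == i));
  first [exact: c0 | exact: (cbE _ false) | exact: (cbE _ true)].
Qed.

Ltac cidx_compute :=
  repeat match goal with |- context [cidx_sign ?a ?b ?c] =>
    let t := eval vm_compute in (cidx_sign a b c) in
    change (cidx_sign a b c) with t
  end; cbn [signed].

Lemma cayley_normM x y :
  cayley_norm (cayley_mul x y) = cayley_norm x * cayley_norm y.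
Proof.
by rewrite !cayley_normE !cayley_mulE !big_cidx; cidx_compute; ring.
Qed.

Lemma cayley_mul1x x : cayley_mul cayley_one x = x.
Proof.
have cbx c : cayley_mul (cb c) x = \sum_b x b *: cb_mul c b.
  rewrite /cayley_mul (bigD1 c) //= [X in _ + X]big1 => [|i /negPf ic].
    by rewrite addr0; apply: eq_bigr => b _; rewrite !ffunE eqxx mul1r.
  by apply: big1 => b _; rewrite !ffunE ic mul0r scale0r.
have := cayley_mul_linearl 1 (cb iE1) (cb iE2) x; rewrite !scale1r => ->.
rewrite !cbx -big_split [RHS]cb_sum; apply: eq_bigr => b _ /=.
by rewrite -scalerDr; case: b => [||i|i]; rewrite ?addr0 ?add0r.
Qed.

Lemma cayley_mulx1 x : cayley_mul x cayley_one = x.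
Proof.
have cbx c : cayley_mul x (cb c) = \sum_a x a *: cb_mul a c.
  rewrite /cayley_mul; apply: eq_bigr => a _.
  rewrite (bigD1 c) //= [X in _ + X]big1 => [|i /negPf ic].
    by rewrite addr0 !ffunE eqxx mulr1.
  by rewrite !ffunE ic mulr0 scale0r.
have := cayley_mul_linearr 1 (cb iE1) (cb iE2) x; rewrite !scale1r => ->.
rewrite !cbx -big_split [RHS]cb_sum; apply: eq_bigr => b _ /=.
by rewrite -scalerDr; case: b => [||i|i]; rewrite ?addr0 ?add0r.
Qed.

Lemma cayley_normZ a x : cayley_norm (a *: x) = a ^+ 2 * cayley_norm x.
Proof. by rewrite !cayley_normE !ffunE /GRing.scale /=; ring. Qed.

Lemma cayley_polarE x y : polar cayley_norm x y =
  (x iE1 : F) * y iE2 + (x iE2 : F) * y iE1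
  + \sum_i ((x (iU i) : F) * y (iV i) + (x (iV i) : F) * y (iU i)).
Proof. by rewrite /polar !cayley_normE big_Z3 !ffunE; ring. Qed.

Lemma cayley_polar_linear a x y z :
  polar cayley_norm (a *: x + y) z
    = a * polar cayley_norm x z + polar cayley_norm y z.
Proof.
by rewrite !cayley_polarE !big_Z3 !ffunE /GRing.scale /=; ring.
Qed.

Definition cidx_dual (c : cidx) : cidx :=
  match c with iE1 => iE2 | iE2 => iE1 | iU i => iV i | iV i => iU i end.

Lemma cayley_polar_cb x c : polar cayley_norm x (cb (cidx_dual c)) = x c.
Proof.
have z a b : a != b -> cb b a = 0 by move=> /negPf ab; rewrite ffunE ab.
have o a : cb a a = 1 by rewrite ffunE eqxx.
rewrite cayley_polarE; case: c => [||i|i] /=.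
- by rewrite big1 => [|j _]; rewrite ?o !z // ?mulr1 !mulr0 !addr0.
- by rewrite big1 => [|j _]; rewrite ?o !z // ?mulr1 !mulr0 ?add0r ?addr0.
- rewrite (bigD1 i) //= big1 => [|j ji]; rewrite ?o !z //.
    by rewrite mulr1 !mulr0 !addr0 add0r.
  by rewrite !mulr0 addr0.
- rewrite (bigD1 i) //= big1 => [|j ji]; rewrite ?o !z //.
    by rewrite mulr1 !mulr0 !addr0 !add0r.
  by rewrite !mulr0 addr0.
Qed.

Lemma cayley_nondegenerate x :
  (forall y, polar cayley_norm x y = 0) -> x = 0.
Proof.
by move=> x0; apply/ffunP => c; rewrite ffunE -cayley_polar_cb x0.
Qed.

Definition cayley : hurwitz F :=
  Hurwitz cayley_mul_linearl cayley_mul_linearr cayley_mul1x cayley_mulx1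
    cayley_normZ cayley_polar_linear cayley_nondegenerate cayley_normM.

Lemma dim_cayley : \dim {:cayley} = 8%N.
Proof. by rewrite dimvf /dim /= muln1 -sum1_card [LHS]big_cidx. Qed.

Definition e1 : cayley := cb iE1.
Definition e2 : cayley := cb iE2.
Definition u_ (i : 'Z_3) : cayley := cb (iU i).
Definition v_ (i : 'Z_3) : cayley := cb (iV i).

End Cayley.

Section SubCayley.
Variable F : fieldType.

Definition K_space : {vspace cayley F} := <<[:: e1 F; e2 F]>>%VS.
Definition Q_space : {vspace cayley F} := <<[:: e1 F; e2 F; u_ F 1; v_ F 1]>>%VS.

Let cb_span_coord (t : seq cidx) (x : cayley F) c :
  x \in <<[seq cb F a | a <- t] : seq (cayley F)>>%VS -> c \notin t -> x c = 0.
Proof.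
move=> + ct; elim: t ct x => [_|a t IHt] /= .
  by move=> x; rewrite span_nil memv0 => /eqP->; rewrite ffunE.
rewrite inE negb_or => /andP[ca ct] x; rewrite span_cons.
case/memv_addP => _ /vlineP[k ->] [y /(IHt ct) yc ->].
by rewrite !ffunE yc (negPf ca) scaler0 addr0.
Qed.

Let cb_span_nondegenerate (t : seq cidx) (x : cayley F) :
  {in t, forall c, cidx_dual c \in t} ->
  x \in <<[seq cb F a | a <- t] : seq (cayley F)>>%VS ->
  (forall y, y \in <<[seq cb F a | a <- t] : seq (cayley F)>>%VS ->
     polar (@hnorm F (cayley F)) x y = 0) -> x = 0.
Proof.
move=> t_dual xt x0; apply/ffunP => c; rewrite [RHS]ffunE.
have [ct|] := boolP (c \in t); last exact: cb_span_coord.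
rewrite -cayley_polar_cb; apply: x0; apply/memv_span/map_f.
exact: t_dual.
Qed.

Lemma one_K : hone (cayley F) \in K_space.
Proof. by rewrite rpredD // memv_span // !inE eqxx ?orbT. Qed.

Lemma one_Q : hone (cayley F) \in Q_space.
Proof. by rewrite rpredD // memv_span // !inE eqxx ?orbT. Qed.

Let hmul_cb (a b : cidx) :
  hmul (cb F a : cayley F) (cb F b : cayley F) = cb_mul F a b.
Proof. exact: cayley_mul_cb. Qed.

Lemma K_mul x y : x \in K_space -> y \in K_space -> hmul x y \in K_space.
Proof.
apply: hmul_span => {}x {}y; rewrite !inE.
by do 2![case/orP=> /eqP->]; rewrite hmul_cb /= ?rpred0 ?rpredN //;
  rewrite memv_span // !inE eqxx ?orbT.
Qed.

Lemma Q_mul x y : x \in Q_space -> y \in Q_space -> hmul x y \in Q_space.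
Proof.
apply: hmul_span => {}x {}y; rewrite !inE.
by do 2![case/or4P=> /eqP->]; rewrite hmul_cb /= ?rpred0 ?rpredN //;
  rewrite memv_span // !inE eqxx ?orbT.
Qed.

Lemma K_nondegenerate x : x \in K_space ->
  (forall y, y \in K_space -> polar (@hnorm F (cayley F)) x y = 0) -> x = 0.
Proof.
apply: (@cb_span_nondegenerate [:: iE1; iE2]) => c.
by rewrite !inE => /orP[] /eqP->.
Qed.

Lemma Q_nondegenerate x : x \in Q_space ->
  (forall y, y \in Q_space -> polar (@hnorm F (cayley F)) x y = 0) -> x = 0.
Proof.
apply: (@cb_span_nondegenerate [:: iE1; iE2; iU 1; iV 1]) => c.
by rewrite !inE => /or4P[] /eqP->.
Qed.

Definition K_alg : hurwitz F := sub_hurwitz K_mul one_K K_nondegenerate.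
Definition Q_alg : hurwitz F := sub_hurwitz Q_mul one_Q Q_nondegenerate.

Let cb_span_dim (t : seq cidx) : uniq t ->
  \dim <<[seq cb F a | a <- t] : seq (cayley F)>>%VS = size t.
Proof.
move=> t_uniq; rewrite -(size_map (cb F)); apply/eqP.
elim: t t_uniq => [|a t IHt] /=; first by rewrite -/(free _) nil_free.
case/andP=> ca /IHt; rewrite -!/(free _) free_cons => ->; rewrite andbT.
apply/negP => /cb_span_coord/(_ ca)/eqP.
by rewrite ffunE eqxx oner_eq0.
Qed.

Lemma dim_K_alg : \dim {:K_alg} = 2%N.
Proof.
rewrite dimvf /dim /=; exact: (@cb_span_dim [:: iE1; iE2]).
Qed.

Lemma dim_Q_alg : \dim {:Q_alg} = 4%N.
Proof. rewrite dimvf /dim /=; exact: (@cb_span_dim [:: iE1; iE2; iU 1; iV 1]). Qed.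

End SubCayley.

(** * Algebras with involution and gradings *)

Record invalg (F : fieldType) := InvAlg {
  iasort :> vectType F;
  iamul : iasort -> iasort -> iasort;
  iaconj : iasort -> iasort }.

Section Gradings.
Variables (F : fieldType) (A : invalg F).

(* A family of subspaces indexed by an abelian group (written additively);
   [is_grading] says that it is a grading. *)
Record gfamily := GFamily {
  ggroup : zmodType;
  gcomp :> ggroup -> {vspace A} }.

(* The first two conditions say that A is the internal direct sum of the
   components: any finitely many of them are independent, and every element
   is a finite sum of homogeneous elements. *)
Definition is_grading (Γ : gfamily) : Prop :=
  [/\ forall s : seq (ggroup Γ), uniq s -> directv (\sum_(g <- s) Γ g)%VS,
      forall x : A, exists s : seq (ggroup Γ), x \in (\sum_(g <- s) Γ g)%VS,
      forall g h x y, x \in Γ g -> y \in Γ h -> iamul x y \in Γ (g + h)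
    & forall g x, x \in Γ g -> iaconj x \in Γ g].

Definition gsupport (Γ : gfamily) : pred (ggroup Γ) :=
  [pred g | Γ g != 0%VS].
Arguments gsupport : clear implicits.

Definition is_automorphism (φ : 'End(A)) : Prop :=
  [/\ bijective φ,
      forall x y, φ (iamul x y) = iamul (φ x) (φ y)
    & forall x, φ (iaconj x) = iaconj (φ x)].

Definition equivalent (Γ Δ : gfamily) : Prop :=
  exists (φ : 'End(A)) (α : ggroup Γ -> ggroup Δ),
    [/\ is_automorphism φ,
        {in gsupport Γ, forall g, α g \in gsupport Δ},
        {in gsupport Γ &, injective α},
        {in gsupport Δ, forall h, exists2 g, g \in gsupport Γ & α g = h}
      & {in gsupport Γ, forall g, (φ @: Γ g)%VS = Δ (α g)}].

(* Zero components are disregarded: otherwise the inclusion of a zero component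
   would always be strict. *)
Definition refines (Δ Γ : gfamily) : Prop :=
  {in gsupport Δ, forall h, exists2 g, g \in gsupport Γ & (Δ h <= Γ g)%VS}.

Definition properly_refines (Δ Γ : gfamily) : Prop :=
  refines Δ Γ /\
  exists h g, [/\ h \in gsupport Δ, (Δ h <= Γ g)%VS & Δ h != Γ g].

Definition fine (Γ : gfamily) : Prop :=
  is_grading Γ /\
  forall Δ : gfamily, is_grading Δ -> ~ properly_refines Δ Γ.

Definition fine_gradings_are (n : nat) (L : 'I_n -> gfamily) : Prop :=
  [/\ forall i, fine (L i),
      forall Γ, fine Γ -> exists i, equivalent Γ (L i)
    & forall i j, equivalent (L i) (L j) -> i = j].

End Gradings.

(** * Tensor products of Hurwitz algebras *)

(* A ⊗ B is modelled by the matrices of coordinates in the bases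
   [vbasis {:A}] and [vbasis {:B}]. *)
Section Tensor.
Variables (F : fieldType) (A B : hurwitz F).

Definition tensor_sort : vectType F := 'M[F]_(\dim {:A}, \dim {:B}).
Implicit Types M N : tensor_sort.

Definition tens (x : A) (y : B) : tensor_sort :=
  \matrix_(i, j) (coord (vbasis {:A}) i x * coord (vbasis {:B}) j y).

Let a_ (i : 'I_(\dim {:A})) : A := (vbasis {:A})`_i.
Let b_ (j : 'I_(\dim {:B})) : B := (vbasis {:B})`_j.

Definition tensor_mul M N : tensor_sort :=
  \sum_i \sum_j \sum_k \sum_l
    (M i j * N k l) *: tens (hmul (a_ i) (a_ k)) (hmul (b_ j) (b_ l)).

Definition tensor_conj M : tensor_sort :=
  \sum_i \sum_j M i j *: tens (hconj (a_ i)) (hconj (b_ j)).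

Definition tensor : invalg F := InvAlg tensor_mul tensor_conj.

Definition tensor_space (U : {vspace A}) (V : {vspace B}) : {vspace tensor} :=
  <<[seq tens x y | x <- vbasis U, y <- vbasis V]>>%VS.

Definition tensor_gfamily (G H : zmodType) (Γ : G -> {vspace A})
    (Δ : H -> {vspace B}) : gfamily tensor :=
  @GFamily F tensor (G * H)%type (fun gh => tensor_space (Γ gh.1) (Δ gh.2)).

Let tens_suml I (r : seq I) (P : pred I) (c : I -> F) (x : I -> A) y :
  tens (\sum_(i <- r | P i) c i *: x i) y
    = \sum_(i <- r | P i) c i *: tens (x i) y.
Proof.
apply/matrixP => i j; rewrite mxE linear_sum summxE mulr_suml.
by apply: eq_bigr => k _; rewrite linearZ /= !mxE mulrA.
Qed.

Let tens_sumr I (r : seq I) (P : pred I) (c : I -> F) x (y : I -> B) :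
  tens x (\sum_(i <- r | P i) c i *: y i)
    = \sum_(i <- r | P i) c i *: tens x (y i).
Proof.
apply/matrixP => i j; rewrite mxE linear_sum summxE mulr_sumr.
by apply: eq_bigr => k _; rewrite linearZ /= !mxE mulrCA.
Qed.

Let coordA (x : A) : x = \sum_i coord (vbasis {:A}) i x *: a_ i.
Proof. exact/coord_vbasis/memvf. Qed.

Let coordB (y : B) : y = \sum_j coord (vbasis {:B}) j y *: b_ j.
Proof. exact/coord_vbasis/memvf. Qed.

Lemma tensor_mul_tens (x x' : A) (y y' : B) :
  tensor_mul (tens x y) (tens x' y') = tens (hmul x x') (hmul y y').
Proof.
have Ax (z : B) : tens (hmul x x') z
    = \sum_i coord (vbasis {:A}) i x *: tens (hmul (a_ i) x') z.
  rewrite {1}(coordA x) hmul_suml -tens_suml; congr (tens _ _).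
  by apply: eq_bigr => i _; rewrite hmulZl.
have Ax' (w : A) (z : B) : tens (hmul w x') z
    = \sum_k coord (vbasis {:A}) k x' *: tens (hmul w (a_ k)) z.
  rewrite {1}(coordA x') hmul_sumr -tens_suml; congr (tens _ _).
  by apply: eq_bigr => i _; rewrite hmulZr.
have By (z : A) : tens z (hmul y y')
    = \sum_j coord (vbasis {:B}) j y *: tens z (hmul (b_ j) y').
  rewrite {1}(coordB y) hmul_suml -tens_sumr; congr (tens _ _).
  by apply: eq_bigr => i _; rewrite hmulZl.
have By' (w : B) (z : A) : tens z (hmul w y')
    = \sum_l coord (vbasis {:B}) l y' *: tens z (hmul w (b_ l)).
  rewrite {1}(coordB y') hmul_sumr -tens_sumr; congr (tens _ _).
  by apply: eq_bigr => i _; rewrite hmulZr.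
rewrite Ax; apply: eq_bigr => i _; rewrite By scaler_sumr; apply: eq_bigr => j _.
rewrite Ax' !scaler_sumr; apply: eq_bigr => k _.
rewrite By' !scaler_sumr; apply: eq_bigr => l _.
by rewrite !mxE !scalerA !mulrA.
Qed.

Lemma tensor_conj_tens (x : A) (y : B) :
  tensor_conj (tens x y) = tens (hconj x) (hconj y).
Proof.
have conjZ (C : hurwitz F) n (c : 'I_n -> F) (z : 'I_n -> C) :
    hconj (\sum_i c i *: z i) = \sum_i c i *: hconj (z i).
  have p0 w : polar (@hnorm F C) 0 w = 0.
    have := hpolar_linear (-1) (0 : C) 0 w.
    by rewrite scaler0 addr0 mulN1r addNr.
  elim/big_rec2: _ => [|i s t _ <-].
    by rewrite /hconj p0 scale0r subrr.
  rewrite /hconj hpolar_linear scalerDl scalerBr scalerA opprD.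
  by rewrite addrACA.
rewrite [in RHS](coordA x) conjZ tens_suml; apply: eq_bigr => i _.
rewrite [in RHS](coordB y) conjZ tens_sumr scaler_sumr; apply: eq_bigr => j _.
by rewrite mxE scalerA.
Qed.

Lemma tens_mem (U : {vspace A}) (V : {vspace B}) x y :
  x \in U -> y \in V -> tens x y \in tensor_space U V.
Proof.
move=> xU yV; rewrite (coord_vbasis xU) tens_suml rpred_sum // => i _.
rewrite rpredZ // (coord_vbasis yV) tens_sumr rpred_sum // => j _.
rewrite rpredZ // memv_span //; apply/allpairsP.
by exists ((vbasis U)`_i, (vbasis V)`_j); split=> //; apply: mem_nth;
  rewrite size_tuple.
Qed.

End Tensor.

(** * The Cartan gradings and the elementary 2-group gradings *)

Section HurwitzGradings.
Variable F : fieldType.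

Definition cartan_C (g : int * int) : {vspace cayley F} :=
  if g == (0, 0) then (<[e1 F]> + <[e2 F]>)%VS
  else if g == (1, 0) then <[u_ F 1]>%VS
  else if g == (-1, 0) then <[v_ F 1]>%VS
  else if g == (0, 1) then <[u_ F 2]>%VS
  else if g == (0, -1) then <[v_ F 2]>%VS
  else if g == (1, 1) then <[v_ F 3]>%VS
  else if g == (-1, -1) then <[u_ F 3]>%VS
  else 0%VS.

(* [zpow x t] is x^t for t in {0, 1}. *)
Definition zpow (A : hurwitz F) (x : A) (t : 'Z_2) : A :=
  if t == 0 then hone A else x.

Definition cd_C (g : 'Z_2 * 'Z_2 * 'Z_2) : {vspace cayley F} :=
  let u : cayley F := e1 F - e2 F in
  let v : cayley F := u_ F 1 + v_ F 1 in
  let w : cayley F := u_ F 2 + v_ F 2 in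
  let: (a, b, c) := g in
  <[hmul (hmul (zpow u a) (zpow v b)) (zpow w c)]>%VS.

Definition to_Q (x : cayley F) : Q_alg F := vsproj (Q_space F) x.
Definition to_K (x : cayley F) : K_alg F := vsproj (K_space F) x.

Definition cartan_Q (g : int) : {vspace Q_alg F} :=
  if g == 0 then (<[to_Q (e1 F)]> + <[to_Q (e2 F)]>)%VS
  else if g == 1 then <[to_Q (u_ F 1)]>%VS
  else if g == -1 then <[to_Q (v_ F 1)]>%VS
  else 0%VS.

Definition pauli_Q (g : 'Z_2 * 'Z_2) : {vspace Q_alg F} :=
  let u : Q_alg F := to_Q (e1 F - e2 F) in
  let v : Q_alg F := to_Q (u_ F 1 + v_ F 1) in
  let: (a, b) := g in
  <[hmul (zpow u a) (zpow v b)]>%VS.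

Definition grading_K (g : 'Z_2) : {vspace K_alg F} :=
  let u : K_alg F := to_K (e1 F - e2 F) in
  <[zpow u g]>%VS.

Definition CK_gradings (i : 'I_2) : gfamily (tensor (cayley F) (K_alg F)) :=
  match nat_of_ord i with
  | 0 => tensor_gfamily cd_C grading_K
  | _ => tensor_gfamily cartan_C grading_K
  end.

Definition CQ_gradings (i : 'I_4) : gfamily (tensor (cayley F) (Q_alg F)) :=
  match nat_of_ord i with
  | 0 => tensor_gfamily cd_C pauli_Q
  | 1 => tensor_gfamily cd_C cartan_Q
  | 2 => tensor_gfamily cartan_C pauli_Q
  | _ => tensor_gfamily cartan_C cartan_Q
  end.

End HurwitzGradings.

(* Main.v *)
From HB Require Import structures.
From Stdlib Require Import Classical_Prop.
Require Import Defs.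
From mathcomp Require Import all_boot all_order all_algebra.
From mathcomp Require Import ring.

(* Let A be the Cayley algebra C tensored with B = K or Q.  In any grading of A
   both factors are graded subspaces: 1 ⊗ B is the left nucleus of A, and the
   trace zero part C_0 ⊗ 1 consists of the skew elements of C_0 ⊗ B, which is
   spanned by the associators.  So every grading of A is a coarsening of a
   product of gradings of C and B.

   Let a Hurwitz algebra be graded, with neutral component E.  If E is not the
   line of 1, it contains an idempotent e of norm 0 and trace 1; homogeneous
   vectors in the Peirce components of e complete e to a canonical basis, and
   the grading is a coarsening of the Cartan one.  If E is the line of 1, all
   nonzero homogeneous elements are invertible, the degrees are 2-torsion and
   the components are lines; suitable homogeneous u, v (and w) of norms
   -1, 1 (and 1) are then carried by an automorphism to the generators of the
   (Z/2)^r-grading.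

   Hence a fine grading is equivalent to one of the products.  Conversely a
   refinement of a product restricts to refinements of the factors, which are
   trivial: lines do not split, and in a Cartan grading e1 = - u v and
   e2 = - v u have the same degree.  The products are told apart by the number
   of their nonzero components. *)

(** The tensor product carries no multiplicative norm, so its factors have to be recovered from the
    product and the involution. Associators do this: [B] is associative, so associators of pure
    tensors come from associators of C, and these are orthogonal to the left nucleus F1 of C and add
    up to all of C_0. The involution then separates C_0 ⊗ 1 from the rest of C_0 ⊗ B, because in
    characteristic not 2 the elements of [B] fixed by the involution are the scalars. Both factors
    are graded by the group of A itself, and x ⊗ y = (x ⊗ 1)(1 ⊗ y) puts a product of two components
    into one component of A; this makes every grading a coarsening of a product.

    The norms -1 and 1 are those of e1 - e2 and u_i + v_i; square roots in F allow this
    normalization. A trace zero q of norm -1 satisfies q^2 = 1, so (1 + q)/2 is an idempotent: this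
    is how a neutral component larger than F1 yields e. The numbers of nonzero components are 16 and
    14 for C ⊗ K, and 32, 24, 28 and 21 for C ⊗ Q. *)

Set Implicit Arguments.
Unset Strict Implicit.
Unset Printing Implicit Defensive.

Import GRing.Theory.
Local Open Scope ring_scope.

(** * Identities in Hurwitz algebras *)

Section VectorCoordinates.
Variables (F : fieldType) (V : vectType F).

Import VectorInternalTheory.

(** Coordinates reduce an identity between linear combinations to identities in [F], which [ring] or
    [field] decides; the tactics [lmod] and [lmod_field] rest on this. *)
Definition vcoord i (x : V) : F := v2r x 0 i.

Lemma vcoordP (x y : V) : (forall i, vcoord i x = vcoord i y) -> x = y.
Proof. by move=> xy; apply: (can_inj v2rK); apply/rowP => i; apply: xy. Qed.

Lemma vcoordD i x y : vcoord i (x + y) = vcoord i x + vcoord i y.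
Proof. by rewrite /vcoord linearD mxE. Qed.
Lemma vcoordN i x : vcoord i (- x) = - vcoord i x.
Proof. by rewrite /vcoord linearN mxE. Qed.
Lemma vcoordZ i a x : vcoord i (a *: x) = a * vcoord i x.
Proof. by rewrite /vcoord linearZ mxE. Qed.
Lemma vcoord0 i : vcoord i 0 = 0.
Proof. by rewrite /vcoord linear0 mxE. Qed.

End VectorCoordinates.

Ltac lmod_push := apply: vcoordP => ?; rewrite ?(vcoordD, vcoordN, vcoordZ, vcoord0).
Ltac lmod := lmod_push; ring.
Ltac lmod_field := lmod_push; field.

Declare Scope hurwitz_scope.
Delimit Scope hurwitz_scope with H.
Local Open Scope hurwitz_scope.
Notation "x ** y" := (hmul x y) (at level 40, left associativity) : hurwitz_scope.
(* [hconj], locked so that rewriting with [hmulDl] does not see the sum in it. *)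
Fact hbar_key : unit. Proof. by []. Qed.
Definition hbar (F : fieldType) (A : hurwitz F) (x : A) : A :=
  locked_with hbar_key (@hconj F A) x.
Lemma hbarE (F : fieldType) (A : hurwitz F) (x : A) : hbar x = hconj x.
Proof. by rewrite /hbar locked_withE. Qed.
Notation "x ^!" := (hbar x) (at level 1, format "x ^!") : hurwitz_scope.

Section Hurwitz.
Variables (F : fieldType) (A : hurwitz F).
Implicit Types (x y z w : A) (a : F).

Definition hpolar x y : F := polar (@hnorm F A) x y.
Definition htrace x : F := hpolar x (hone A).
Local Notation n := (@hnorm F A).
Local Notation B := hpolar.
Local Notation t := htrace.
Local Notation one := (hone A).

Lemma hpolarC x y : B x y = B y x.
Proof. by rewrite /hpolar /polar [y + x]addrC; ring. Qed.

Lemma hpolarDl x y z : B (x + y) z = B x z + B y z.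
Proof. by have := hpolar_linear 1 x y z; rewrite scale1r mul1r. Qed.
Lemma hpolar0l z : B 0 z = 0.
Proof. by apply: (addrI (B 0 z)); rewrite -hpolarDl !addr0. Qed.
Lemma hpolarZl a x z : B (a *: x) z = a * B x z.
Proof.
have := hpolar_linear a x 0 z.
by rewrite addr0 -!/(hpolar _ _) hpolar0l addr0.
Qed.
Lemma hpolarNl x z : B (- x) z = - B x z.
Proof. by rewrite -scaleN1r hpolarZl mulN1r. Qed.
Lemma hpolarDr x y z : B z (x + y) = B z x + B z y.
Proof. by rewrite hpolarC hpolarDl ![B _ z]hpolarC. Qed.
Lemma hpolarZr a x z : B z (a *: x) = a * B z x.
Proof. by rewrite hpolarC hpolarZl hpolarC. Qed.
Lemma hpolarNr x z : B z (- x) = - B z x.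
Proof. by rewrite hpolarC hpolarNl hpolarC. Qed.
Lemma hpolar0r z : B z 0 = 0.
Proof. by rewrite hpolarC hpolar0l. Qed.

Definition hpolarE := (hpolarDl, hpolarDr, hpolarZl, hpolarZr, hpolarNl, hpolarNr,
  hpolar0l, hpolar0r).

Lemma hpolar_sumr I (r : seq I) (P : pred I) (f : I -> A) x :
  B x (\sum_(i <- r | P i) f i) = \sum_(i <- r | P i) B x (f i).
Proof. exact: (big_morph (B x) (fun y z => hpolarDr y z x) (hpolar0r x)). Qed.

Lemma hpolar_suml I (r : seq I) (P : pred I) (f : I -> A) x :
  B (\sum_(i <- r | P i) f i) x = \sum_(i <- r | P i) B (f i) x.
Proof. by rewrite hpolarC hpolar_sumr; apply: eq_bigr => i _; rewrite hpolarC. Qed.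

Lemma hpolarP x y : (forall z, B x z = B y z) -> x = y.
Proof.
move=> xy; apply/eqP; rewrite -subr_eq0; apply/eqP.
by apply: hnorm_nondegenerate => z; rewrite -/(hpolar _ _) !hpolarE xy subrr.
Qed.

Lemma hnormD x y : n (x + y) = n x + n y + B x y.
Proof. by rewrite /hpolar /polar; ring. Qed.

Lemma hpolarxx x : B x x = 2 * n x.
Proof.
rewrite /hpolar /polar -[x in n (x + _)]scale1r -{2}[x]scale1r -scalerDl hnormZ.
by ring.
Qed.

Lemma hmul0l x : 0 ** x = 0.
Proof. by have := hmulZl 0%R (0 : A) x; rewrite !scale0r. Qed.
Lemma hmul0r x : x ** 0 = 0.
Proof. by have := hmulZr 0%R (0 : A) x; rewrite !scale0r. Qed.
Lemma hmulNl x y : (- x) ** y = - (x ** y).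
Proof. by rewrite -scaleN1r hmulZl scaleN1r. Qed.
Lemma hmulNr x y : x ** (- y) = - (x ** y).
Proof. by rewrite -scaleN1r hmulZr scaleN1r. Qed.

Definition hmulE := (hmulDl, hmulDr, hmulZl, hmulZr, hmulNl, hmulNr, hmul0l, hmul0r,
  hmul1x, hmulx1).

Lemma hone_neq0 x : x != 0 -> one != 0.
Proof. by apply: contra_neq => e10; rewrite -[x]hmul1x e10 hmul0l. Qed.

(** Multiplicativity gives [n one ^+ 2 = n one], and [n one = 0] would make [n] vanish identically,
    against nondegeneracy. The hypothesis excludes the zero algebra, which the record [hurwitz]
    admits. *)
Lemma hnorm1 : one != 0 -> n one = 1.
Proof.
move=> one0; have := hnormM one one; rewrite hmul1x => n11.
have: n one != 0.
  apply: contraNneq one0 => n10; apply/eqP; apply: hnorm_nondegenerate => y.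
  have n0 z : n z = 0 by rewrite -[z]hmul1x hnormM n10 mul0r.
  by rewrite /polar !n0 !subr0.
by move=> n10; apply: (mulfI n10); rewrite -n11 mulr1.
Qed.

Lemma htrace1 : one != 0 -> t one = 2.
Proof. by move=> o; rewrite /htrace hpolarxx hnorm1 // mulr1. Qed.

Lemma hpolar_mull x y z : B (x ** y) (x ** z) = n x * B y z.
Proof. by rewrite {1}/hpolar /polar -hmulDr !hnormM /hpolar /polar; ring. Qed.

Lemma hpolar_mulr x y z : B (y ** x) (z ** x) = B y z * n x.
Proof. by rewrite {1}/hpolar /polar -hmulDl !hnormM /hpolar /polar; ring. Qed.

(** Full linearization of [hnormM]. Putting 1 for one of the arguments yields the adjoints of left
    and right multiplication in [hpolar_mulll] and [hpolar_mulrr]. *)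
Lemma hpolar_mul2 x y z w : B (x ** y) (z ** w) + B (z ** y) (x ** w) = B x z * B y w.
Proof.
have := hpolar_mull (x + z) y w.
rewrite !hmulDl !hpolarE !hpolar_mull hnormD => E.
apply: (addrI (n x * B y w + n z * B y w));
transitivity ((n x + n z + B x z) * B y w); last by ring.
by rewrite -E; ring.
Qed.

Lemma hconjE x : x^! = t x *: one - x. Proof. by rewrite hbarE. Qed.

Lemma hconjD x y : (x + y)^! = x^! + y^!.
Proof. by rewrite !hconjE /t !hpolarE; lmod. Qed.
Lemma hconjZ a x : (a *: x)^! = a *: x^!.
Proof. by rewrite !hconjE /t !hpolarE; lmod. Qed.
Lemma hconj0 : 0^! = 0 :> A.
Proof. by rewrite !hconjE /t !hpolarE; lmod. Qed.
Lemma hconj_linear : linear (@hbar F A).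
Proof. by move=> a x y; rewrite hconjD hconjZ. Qed.

Lemma htrace_scale1 x : t x *: one = x + x^!.
Proof. by rewrite hconjE; lmod. Qed.

Lemma hpolar_mulll x y z : B (x ** y) z = B y (x^! ** z).
Proof.
have := hpolar_mul2 x y one z; rewrite !hmul1x hconjE !hmulE !hpolarE -/(t x) => <-.
by ring.
Qed.

Lemma hpolar_mulrr x y z : B (x ** y) z = B x (z ** y^!).
Proof.
have := hpolar_mul2 x y z one; rewrite !hmulx1 hconjE !hmulE !hpolarE -/(t y).
by rewrite (hpolarC (z ** y) x) => E; rewrite mulrC -E; ring.
Qed.

Lemma hconj1 : one^! = one.
Proof.
rewrite hconjE; have [->|o] := eqVneq one 0; first by lmod.
by rewrite htrace1 //; lmod.
Qed.

Lemma hconjK x : x^!^! = x.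
Proof.
rewrite {1}hconjE; suff -> : t x^! = t x by rewrite hconjE; lmod.
rewrite hconjE /t !hpolarE; have [o|o] := eqVneq one 0.
  by rewrite o !hpolarE; ring.
by rewrite -/(t one) htrace1 //; ring.
Qed.

Lemma htrace_conj x : t x^! = t x.
Proof.
rewrite hconjE /t !hpolarE; have [o|o] := eqVneq one 0.
  by rewrite o !hpolarE; ring.
by rewrite -/(t one) htrace1 //; ring.
Qed.

Lemma hpolar_conj x y : B x^! y = B x y^!.
Proof. by rewrite !hconjE !hpolarE /t (hpolarC one y); ring. Qed.

(** Left multiplication by [x^!] is adjoint to that by [x], which multiplies the form by [n x];
    nondegeneracy turns this into an identity. It is a form of the left alternative law, and its
    linearizations drive the Peirce calculus. *)
Lemma hconj_mull x y : x^! ** (x ** y) = n x *: y.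
Proof. by apply: hpolarP => z; rewrite hpolar_mulll hconjK hpolar_mull hpolarE. Qed.

Lemma hmul_conjr x y : (y ** x) ** x^! = n x *: y.
Proof.
by apply: hpolarP => z; rewrite hpolar_mulrr hconjK hpolar_mulr hpolarE mulrC.
Qed.

Lemma hmulxconj x : x ** x^! = n x *: one.
Proof. by rewrite -[x in x ** _]hmul1x hmul_conjr. Qed.

Lemma hmulconjx x : x^! ** x = n x *: one.
Proof. by rewrite -[x in _ ** x]hmulx1 hconj_mull. Qed.

Lemma hnorm_conj x : n x^! = n x.
Proof.
have [o|o] := eqVneq one 0.
  have z w : w = 0 :> A by rewrite -[w]hmul1x o hmul0l.
  by rewrite [x^!]z [x]z.
have := hmulxconj x^!; rewrite hconjK hmulconjx => /eqP.
by rewrite -subr_eq0 -scalerBl scaler_eq0 (negPf o) orbF subr_eq0 => /eqP.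
Qed.

Lemma hmul_conjl x y : x ** (x^! ** y) = n x *: y.
Proof. by have := hconj_mull x^! y; rewrite hconjK hnorm_conj. Qed.

Lemma hconj_mulr x y : (y ** x^!) ** x = n x *: y.
Proof. by have := hmul_conjr x^! y; rewrite hconjK hnorm_conj. Qed.

Lemma hconj_mull2 x y z : x^! ** (y ** z) + y^! ** (x ** z) = B x y *: z.
Proof.
have := hconj_mull (x + y) z; rewrite hconjD !hmulE !hconj_mull hnormD !scalerDl => E.
apply: (addrI (n x *: z + n y *: z)); rewrite -E; lmod.
Qed.

Lemma hmul_conjr2 x y z : (z ** x) ** y^! + (z ** y) ** x^! = B x y *: z.
Proof.
have := hmul_conjr (x + y) z; rewrite hconjD !hmulE !hmul_conjr hnormD !scalerDl => E.
apply: (addrI (n x *: z + n y *: z)); rewrite -E; lmod.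
Qed.

Lemma hmulxconj2 x y : x ** y^! + y ** x^! = B x y *: one.
Proof. by rewrite -(hmul_conjr2 x y one) !hmul1x. Qed.

Lemma hconjM x y : (x ** y)^! = y^! ** x^!.
Proof.
apply: hpolarP => z; rewrite hpolar_conj hpolar_mulll hpolarC hpolar_mulrr hconjK.
by rewrite [RHS]hpolar_mulll hconjK.
Qed.

End Hurwitz.

(** * Peirce decomposition *)

Section Peirce.
Variables (F : fieldType) (A : hurwitz F).
Local Notation n := (@hnorm F A).
Local Notation B := (@hpolar F A).
Local Notation t := (@htrace F A).
Local Notation one := (hone A).
Implicit Types (e x y z u v w : A).

(** By the identity x^2 - t(x) x + n(x) 1 = 0 these are the idempotents other than 0 and 1. *)
Definition hidempotent e := n e = 0 /\ t e = 1.

(** The off-diagonal Peirce component e A (1 - e), as [e^!] is 1 - e for an idempotent; the opposite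
    component is [hpeirce e^!]. For e = e1 in C they are spanned by the u_i and by the v_i. *)
Definition hpeirce e x := e ** x = x /\ x ** e^! = x.

Lemma hconj_trace0 x : t x = 0 -> x^! = - x.
Proof. by rewrite hconjE => ->; lmod. Qed.

Lemma hidempotent_conj e : hidempotent e -> hidempotent e^!.
Proof. by case=> ne te; split; rewrite ?hnorm_conj ?htrace_conj. Qed.

Lemma hidempotentE e : hidempotent e -> e^! = one - e.
Proof. by case=> _ te; rewrite hconjE te scale1r. Qed.

Lemma hidempotent_mul e : hidempotent e -> e ** e = e.
Proof.
move=> He; have := hmulxconj e; rewrite hidempotentE // !hmulE (proj1 He) scale0r.
by move/eqP; rewrite subr_eq0 => /eqP.
Qed.

Lemma hpolar_idempotent e : hidempotent e -> B e e^! = 1.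
Proof.
by case=> ne te; rewrite hconjE te !hpolarE hpolarxx -/(t e) te ne; ring.
Qed.

Lemma hpolar_idempotentxx e : hidempotent e -> B e e = 0.
Proof. by case=> ne _; rewrite hpolarxx ne mulr0. Qed.

Section Fixed.
Variable e : A.
Hypothesis He : hidempotent e.
Local Notation f := (e^!).
Local Notation U := (hpeirce e).
Local Notation V := (hpeirce f).

Let fE : f = one - e. Proof. exact: hidempotentE. Qed.
Let ne : n e = 0. Proof. by case: He. Qed.
Let nf : n f = 0. Proof. by rewrite hnorm_conj. Qed.

Lemma hpeirce_polar x : U x -> B e x = 0.
Proof. by case=> ex _; have := hpolar_mull e one x; rewrite hmulx1 ex ne mul0r. Qed.

Lemma hpeirce_polarC x : U x -> B f x = 0.
Proof. by case=> _ xf; have := hpolar_mulr f one x; rewrite hmul1x xf nf mulr0. Qed.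

Lemma hpeirce_trace x : U x -> t x = 0.
Proof.
move=> Ux; have := hpeirce_polarC Ux; rewrite fE !hpolarE hpeirce_polar // => E.
by rewrite /t hpolarC -E; ring.
Qed.

Lemma hpeirce_conj x : U x -> x^! = - x.
Proof. by move=> /hpeirce_trace/hconj_trace0. Qed.

Lemma hpeirce_mulCl x : U x -> f ** x = 0.
Proof. by case=> ex _; rewrite fE !hmulE ex subrr. Qed.

Lemma hpeirce_mulCr x : U x -> x ** e = 0.
Proof.
case=> _ xf; have -> : e = one - f by rewrite fE; lmod.
by rewrite !hmulE xf subrr.
Qed.

Lemma hpeirceD x y : U x -> U y -> U (x + y).
Proof. by move=> [ex xf] [ey yf]; split; rewrite !hmulE ?ex ?ey ?xf ?yf. Qed.

Lemma hpeirceZ a x : U x -> U (a *: x).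
Proof. by move=> [ex xf]; split; rewrite !hmulE ?ex ?xf. Qed.

Lemma hpeirce_norm x : U x -> n x = 0.
Proof. by case=> ex _; rewrite -ex hnormM ne mul0r. Qed.

Lemma hpeirce_polar0 x y : U x -> U y -> B x y = 0.
Proof.
move=> Ux Uy; have := hnormD x y.
by rewrite !hpeirce_norm ?add0r //; apply: hpeirceD.
Qed.

Lemma hpeirce_sqr x : U x -> x ** x = 0.
Proof.
move=> Ux; have := hmulxconj x; rewrite hpeirce_conj // hpeirce_norm // !hmulE.
by rewrite scale0r => /eqP; rewrite oppr_eq0 => /eqP.
Qed.

Lemma hpeirce_anticomm x y : U x -> U y -> x ** y = - (y ** x).
Proof.
move=> Ux Uy; have := hmulxconj2 x y; rewrite !hpeirce_conj // hpeirce_polar0 //.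
rewrite scale0r !hmulE -opprD => /eqP; rewrite oppr_eq0 addr_eq0.
by move/eqP.
Qed.

(** Linearizing [hconj_mull] at the orthogonal pair [e], [x] gives
    [e^! ** (x ** y) = x ** (e ** y)], since [x^! = - x]; the right-hand condition is symmetric.
    This is the pattern u_i u_{i+1} = v_{i+2}. *)
Lemma hpeirce_mulS x y : U x -> U y -> V (x ** y).
Proof.
move=> Ux Uy; split.
  have := hconj_mull2 e x y; rewrite (hpeirce_polar Ux) scale0r (proj1 Uy).
  by rewrite (hpeirce_conj Ux) hmulNl => /eqP; rewrite subr_eq0 => /eqP.
have := hmul_conjr2 y f x; rewrite hpolarC (hpeirce_polarC Uy) scale0r.
by rewrite (proj2 Ux) (hpeirce_conj Uy) hmulNr => /eqP; rewrite subr_eq0 => /eqP.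
Qed.

End Fixed.

(** The linearized norm equation reads [- x ** y - y ** x = B x y *: one]; multiplication by [e] on
    the left fixes [x ** y] and kills [y ** x]. This is the pattern u_i v_i = - e1. *)
Lemma hpeirce_mulUV e x y : hidempotent e -> hpeirce e x -> hpeirce e^! y ->
  x ** y = - (B x y *: e).
Proof.
move=> He Ux Vy; have Hf := hidempotent_conj He.
have Cx := hpeirce_conj He Ux; have Cy := hpeirce_conj Hf Vy.
have E0 : e^! ** (x ** y) = 0.
  have := hconj_mull2 e x y; rewrite (hpeirce_polar He Ux) scale0r.
  have := hpeirce_mulCl Hf Vy; rewrite hconjK => ->.
  by rewrite hmul0r addr0.
have E1 : e ** (x ** y) = x ** y.
  by move: E0; rewrite hidempotentE // !hmulE => /eqP; rewrite subr_eq0 => /eqP.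
have E2 : e ** (y ** x) = 0.
  have := hconj_mull2 e^! y x; rewrite (hpeirce_polar Hf Vy) scale0r hconjK.
  by rewrite (hpeirce_mulCl He Ux) hmul0r addr0.
have := congr1 (hmul e) (hmulxconj2 x y).
rewrite Cx Cy !hmulE E1 E2 oppr0 addr0 => <-; lmod.
Qed.

Lemma hpeirce_mulVU e x y : hidempotent e -> hpeirce e x -> hpeirce e^! y ->
  y ** x = - (B x y *: e^!).
Proof.
move=> He Ux Vy; rewrite hpolarC.
by apply: hpeirce_mulUV; rewrite ?hconjK //; apply: hidempotent_conj.
Qed.

Lemma hpeirce_decomp e w : hidempotent e -> exists x y,
  [/\ hpeirce e x, hpeirce e^! y & w = B w e^! *: e + B w e *: e^! + x + y].
Proof.
move=> He; have Hf := hidempotent_conj He.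
(* [e] and [e^!] form a hyperbolic pair, so [w'] is the part of [w] orthogonal to both, hence of
   trace 0; it splits as [e ** w' + e^! ** w']. *)
pose w' := w - B w e^! *: e - B w e *: e^!.
have we : B e w' = 0.
  by rewrite /w' !hpolarE hpolar_idempotent // hpolar_idempotentxx // hpolarC; ring.
have wf : B e^! w' = 0.
  rewrite /w' !hpolarE (hpolarC _ e) hpolar_idempotent // hpolar_idempotentxx //.
  by rewrite hpolarC; ring.
have tw : t w' = 0.
  have -> : t w' = B e w' + B e^! w' by rewrite -hpolarDl -htrace_scale1 (proj2 He) scale1r hpolarC.
  by rewrite we wf addr0.
suff P g : hidempotent g -> B g w' = 0 -> hpeirce g (g ** w').
  exists (e ** w'), (e^! ** w'); split; [exact: P|exact: P|].
  by rewrite [e^! in X in _ + X ** _]hidempotentE // hmulDl hmulNl hmul1x /w'; lmod.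
(* Orthogonality to [g] and [w'^! = - w'] let [g] pass through [w'] at the cost of a conjugation. *)
move=> {we wf} {Hf} Hg gw; have E : g ** w' = w' ** g^!.
  have := hmulxconj2 g w'; rewrite gw scale0r (hconj_trace0 tw) hmulNr => /eqP.
  by rewrite addrC subr_eq0 => /eqP.
split.
  have := hconj_mull g w'; rewrite (proj1 Hg) scale0r {1}hidempotentE // !hmulE => /eqP.
  by rewrite subr_eq0 eq_sym => /eqP.
have G : w' ** g^! ** g = 0.
  by have := hmul_conjr g^! w'; rewrite hnorm_conj (proj1 Hg) scale0r hconjK.
by rewrite E [X in _ ** X](hidempotentE Hg) hmulDr hmulNr hmulx1 G subr0.
Qed.

(** If the trilinear form [B x (y ** z)] vanishes on U then U U = 0, and both Peirce components
    collapse to lines. In dimension above 4 the form is therefore nonzero, which is how a canonical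
    triple is found in C. *)
Lemma hpeirce_span e u v : hidempotent e -> hpeirce e u -> hpeirce e^! v ->
  B u v = 1 ->
  (forall x y z, hpeirce e x -> hpeirce e y -> hpeirce e z -> B x (y ** z) = 0) ->
  forall w, w \in <<[:: e; e^!; u; v]>>%VS.
Proof.
move=> He Uu Vv uv tri w; have Hf := hidempotent_conj He.
have UU x y : hpeirce e x -> hpeirce e y -> x ** y = 0.
  move=> Ux Uy; have Vxy := hpeirce_mulS He Ux Uy.
  apply: hpolarP => z; rewrite hpolar0l hpolarC.
  have [z1 [z2 [Uz Vz ->]]] := hpeirce_decomp z He; rewrite !hpolarE.
  rewrite (hpeirce_polar Hf Vxy) (tri z1) // (hpeirce_polar0 Hf Vz) //.
  by have := hpeirce_polarC Hf Vxy; rewrite hconjK => ->; ring.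
have Uline x : hpeirce e x -> x = B x v *: u.
  move=> Ux; have := hconj_mull2 u v x; rewrite uv scale1r (UU u x) // hmul0r addr0.
  rewrite (hpeirce_conj He Uu) (hpeirce_mulVU He Ux Vv) !hmulE opprK => E.
  by rewrite -[LHS]E (proj2 Uu).
have Vline y : hpeirce e^! y -> y = B u y *: v.
  move=> Vy; apply: hpolarP => z; rewrite ![B _ z]hpolarC.
  have [z1 [z2 [Uz Vz ->]]] := hpeirce_decomp z He.
  have perp y' : hpeirce e^! y' -> [/\ B e y' = 0, B e^! y' = 0 & B z2 y' = 0].
    move=> Vy'; split; [|exact: hpeirce_polar|exact: (hpeirce_polar0 Hf Vz Vy')].
    by have := hpeirce_polarC Hf Vy'; rewrite hconjK.
  have [ey fy zy] := perp y Vy; have [ev fv zv] := perp v Vv.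
  by rewrite (Uline z1 Uz) !hpolarE ey fy zy ev fv zv uv; ring.
have [x [y [Ux Vy ->]]] := hpeirce_decomp w He.
rewrite (Uline _ Ux) (Vline _ Vy).
by rewrite !rpredD // rpredZ // memv_span // !inE eqxx ?orbT.
Qed.

End Peirce.

(** * Automorphisms from canonical bases *)

(** The existence is informative, so that whole families of linear maps can be chosen, as in
    [basis_hgrading]. *)
Lemma linfun_exists (F : fieldType) (V W : vectType F) (f : V -> W) :
  linear f -> {g : 'Hom(V, W) | g =1 f}.
Proof.
move=> fL.
pose g : {linear V -> W} :=
  HB.pack f (GRing.isSemilinear.Build F V W _ f (GRing.semilinear_linear fL)).
by exists (linfun g) => x; rewrite lfunE.
Qed.

Definition hurwitz_invalg (F : fieldType) (A : hurwitz F) : invalg F :=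
  InvAlg (@hmul F A) (@hconj F A).

Lemma Z3_ind (P : 'Z_3 -> Prop) : P 1 -> P 2 -> P 3 -> forall i, P i.
Proof.
move=> P1 P2 P3 [[|[|[|//]]] i3].
- by rewrite (_ : Ordinal i3 = 3) //; apply: val_inj.
- by rewrite (_ : Ordinal i3 = 1) //; apply: val_inj.
- by rewrite (_ : Ordinal i3 = 2) //; apply: val_inj.
Qed.

Section Automorphism.
Variables (F : fieldType) (A : hurwitz F) (I : finType) (b β : I -> A) (σ : I -> I).
Local Notation B := (@hpolar F A).

(** The basis [b] is dual to its permutation by [σ], so equal polar values make the linear extension
    an isometry, and a nondegenerate form makes an isometry injective. The involution is respected
    because it is expressed by the form and the unit. *)
Lemma hurwitz_automorphism :
  (forall x, x = \sum_i B x (b (σ i)) *: b i) ->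
  (forall i j, B (b i) (b (σ j)) = (i == j)%:R) ->
  (forall i j, B (β i) (β j) = B (b i) (b j)) ->
  (forall i j, exists k a, b i ** b j = a *: b k /\ β i ** β j = a *: β k) ->
  exists2 φ : 'End(A), @is_automorphism F (hurwitz_invalg A) φ & forall i, φ (b i) = β i.
Proof.
move=> bE dual polE mulE.
pose f x := \sum_i B x (b (σ i)) *: β i.
have [φ φE] : {φ : 'End(A) | φ =1 f}.
  apply: linfun_exists => a x y; rewrite /f scaler_sumr -big_split /=.
  by apply: eq_bigr => i _; rewrite hpolarDl hpolarZl scalerDl scalerA.
have φb i : φ (b i) = β i.
  rewrite φE /f (bigD1 i) //= dual eqxx scale1r big1 ?addr0 // => j ji.
  by rewrite dual eq_sym (negPf ji) scale0r.
have φsum (c : I -> F) : φ (\sum_i c i *: b i) = \sum_i c i *: β i.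
  by rewrite linear_sum; apply: eq_bigr => i _; rewrite linearZ /= φb.
have φB x y : B (φ x) (φ y) = B x y.
  rewrite (bE x) (bE y) !φsum !hpolar_suml; apply: eq_bigr => i _.
  by rewrite !hpolar_sumr; apply: eq_bigr => j _; rewrite !hpolarE polE.
have φM x y : φ (x ** y) = φ x ** φ y.
  rewrite (bE x) (bE y) !φsum !hmul_suml linear_sum; apply: eq_bigr => i _.
  rewrite !hmul_sumr linear_sum; apply: eq_bigr => j _.
  have [k [a [E1 E2]]] := mulE i j.
  by rewrite !hmulE E1 E2 !(linearZZ φ) /= φb.
have φinj : injective φ.
  by move=> x y xy; apply: hpolarP => z; rewrite -φB xy φB.
have φker : lker φ == 0%VS by apply/lker0P.
have φbij : bijective φ.
  by exists (φ^-1)%VF => x; [exact: lker0_lfunK|exact: lker0_lfunVK].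
have φ1 : φ (hone A) = hone A.
  have [ψ _ ψK] := φbij.
  by rewrite -[LHS]hmulx1 -{2}(ψK (hone A)) -φM hmul1x ψK.
exists φ => //; split=> // x /=.
rewrite -!hbarE !hconjE linearB linearZ /= φ1.
by congr (_ *: _ - _); rewrite /htrace -{2}φ1 φB.
Qed.

End Automorphism.

(** The multiplication table of C with labels in place of vectors, to be evaluated in any family
    indexed by [cidx]; [true] stands for a minus sign, [None] for 0. *)
Definition cidx_mul (a b : cidx) : option (bool * cidx) :=
  match a, b with
  | iE1, iE1 => Some (false, iE1)
  | iE2, iE2 => Some (false, iE2)
  | iE1, iU i => Some (false, iU i)
  | iU i, iE2 => Some (false, iU i)
  | iE2, iV i => Some (false, iV i)
  | iV i, iE1 => Some (false, iV i)
  | iU i, iV j => if j == i then Some (true, iE1) else None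
  | iV i, iU j => if j == i then Some (true, iE2) else None
  | iU i, iU j => if j == i + 1 then Some (false, iV (i + 2))
                else if i == j + 1 then Some (true, iV (j + 2)) else None
  | iV i, iV j => if j == i + 1 then Some (false, iU (i + 2))
                else if i == j + 1 then Some (true, iU (j + 2)) else None
  | _, _ => None
  end.

Definition signed_term (I : Type) (V : zmodType) (b : I -> V) (s : option (bool * I)) : V :=
  match s with
  | Some (true, c) => - b c
  | Some (false, c) => b c
  | None => 0
  end.

Lemma cidx_dualK : involutive cidx_dual. Proof. by case. Qed.

Lemma cb_mulE (F : fieldType) a b : cb_mul F a b = signed_term (cb F) (cidx_mul a b).
Proof.
case: a b => [||i|i] [||j|j] //=.
- by case: eqP => //; case: eqP.
- by case: eqP.
- by case: eqP.
- by case: eqP => //; case: eqP.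
Qed.

(** * Families satisfying the multiplication table of the Cayley algebra *)

Section CanonicalFamily.
Variables (F : fieldType) (A : hurwitz F) (e : A) (u v : 'Z_3 -> A).
Local Notation B := (@hpolar F A).

Definition canonical_family (c : cidx) : A :=
  match c with iE1 => e | iE2 => e^! | iU i => u i | iV i => v i end.

Hypothesis He : hidempotent e.
Hypothesis Uu : forall i, hpeirce e (u i).
Hypothesis Vv : forall i, hpeirce e^! (v i).
Hypothesis uv : forall i j, B (u i) (v j) = (i == j)%:R.
Hypothesis uu : forall i, u i ** u (i + 1) = v (i + 2).
Hypothesis vv : forall i, v i ** v (i + 1) = u (i + 2).

Let Hf : hidempotent e^!. Proof. exact: hidempotent_conj. Qed.

Lemma hpolar_canonical c d :
  B (canonical_family c) (canonical_family d) = (c == cidx_dual d)%:R.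
Proof.
have vu i j : B (v i) (u j) = (i == j)%:R by rewrite hpolarC uv eq_sym.
have eu i : B e (u i) = 0 by exact: hpeirce_polar.
have fu i : B e^! (u i) = 0 by exact: hpeirce_polarC.
have fv i : B e^! (v i) = 0 by exact: hpeirce_polar.
have ev i : B e (v i) = 0 by have := hpeirce_polarC Hf (Vv i); rewrite hconjK.
have ef : B e e^! = 1 by exact: hpolar_idempotent.
have ee : B e e = 0 by exact: hpolar_idempotentxx.
have ff : B e^! e^! = 0 by exact: hpolar_idempotentxx.
have uu0 i j : B (u i) (u j) = 0 by exact: (hpeirce_polar0 He).
have vv0 i j : B (v i) (v j) = 0 by exact: (hpeirce_polar0 Hf).
by case: c d => [||i|i] [||j|j] //=; first [done | by rewrite hpolarC].
Qed.

Lemma hmul_canonical c d :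
  canonical_family c ** canonical_family d = signed_term canonical_family (cidx_mul c d).
Proof.
have uv0 i j : i != j -> u i ** v j = 0.
  by move=> /negPf ij; rewrite (hpeirce_mulUV He) // uv ij scale0r oppr0.
have vu0 i j : i != j -> v i ** u j = 0.
  by move=> /negPf ij; rewrite (hpeirce_mulVU He) // uv eq_sym ij scale0r oppr0.
have uv1 i : u i ** v i = - e by rewrite (hpeirce_mulUV He) // uv eqxx scale1r.
have vu1 i : v i ** u i = - e^! by rewrite (hpeirce_mulVU He) // uv eqxx scale1r.
(* Indices mod 3 are equal or consecutive, so the last case of the table is the square of a Peirce
   element, which is 0. *)
have three (i j : 'Z_3) : [|| j == i + 1, i == j + 1 | i == j].
  by move: i j; do 2!apply: Z3_ind.
have ef0 : e ** e^! = 0 by rewrite hmulxconj (proj1 He) scale0r.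
have fe0 : e^! ** e = 0 by rewrite hmulconjx (proj1 He) scale0r.
have ee : e ** e = e by exact: hidempotent_mul.
have ff : e^! ** e^! = e^! by exact: hidempotent_mul.
have ve i : v i ** e = v i by case: (Vv i); rewrite hconjK.
have ev i : e ** v i = 0 by have := hpeirce_mulCl Hf (Vv i); rewrite hconjK.
have vf i : v i ** e^! = 0 by exact: (hpeirce_mulCr Hf).
have fu i : e^! ** u i = 0 by exact: hpeirce_mulCl.
have ue i : u i ** e = 0 by exact: hpeirce_mulCr.
have [eu uf] : (forall i, e ** u i = u i) /\ (forall i, u i ** e^! = u i).
  by split=> i; case: (Uu i).
have fv i : e^! ** v i = v i by case: (Vv i).
case: c d => [||i|i] [||j|j] //=.
- have [->|ji] := eqVneq j (i + 1); first exact: uu.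
  have [->|ij] := eqVneq i (j + 1); first by rewrite (hpeirce_anticomm He) // uu.
  have := three i j; rewrite (negPf ji) (negPf ij) => /eqP->.
  exact: (hpeirce_sqr He).
- have [->|ji] := eqVneq j i; first exact: uv1.
  by apply: uv0; rewrite eq_sym.
- have [->|ji] := eqVneq j i; first exact: vu1.
  by apply: vu0; rewrite eq_sym.
- have [->|ji] := eqVneq j (i + 1); first exact: vv.
  have [->|ij] := eqVneq i (j + 1); first by rewrite (hpeirce_anticomm Hf) // vv.
  have := three i j; rewrite (negPf ji) (negPf ij) => /eqP->.
  exact: (hpeirce_sqr Hf).
Qed.

End CanonicalFamily.

Section CayleyAutomorphism.
Variable F : fieldType.
Local Notation C := (cayley F).
Local Notation B := (@hpolar F C).

Lemma hpolar_cb (c d : cidx) :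
  B (cb F c : C) (cb F d : C) = (c == cidx_dual d)%:R.
Proof.
have := cayley_polar_cb (cb F c) (cidx_dual d).
by rewrite cidx_dualK /cb ffunE [_ == c]eq_sym.
Qed.

Lemma cayley_automorphism (e : C) (u v : 'Z_3 -> C) :
  hidempotent e -> (forall i, hpeirce e (u i)) -> (forall i, hpeirce e^! (v i)) ->
  (forall i j, B (u i) (v j) = (i == j)%:R) ->
  (forall i, u i ** u (i + 1) = v (i + 2)) ->
  (forall i, v i ** v (i + 1) = u (i + 2)) ->
  exists2 φ : 'End(C), @is_automorphism F (hurwitz_invalg C) φ &
    forall c, φ (cb F c) = canonical_family e u v c.
Proof.
move=> He Uu Vv uv uu vv.
apply: (@hurwitz_automorphism F C cidx (fun c => cb F c : C) _ cidx_dual).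
- move=> x; rewrite {1}(cb_sum x); apply: eq_bigr => c _.
  by congr (_ *: _); symmetry; apply: (cayley_polar_cb x c).
- by move=> c d; rewrite hpolar_cb cidx_dualK.
- by move=> c d; rewrite hpolar_cb hpolar_canonical.
- move=> c d; rewrite (hmul_canonical He Uu Vv uv uu vv).
  rewrite (_ : (cb F c : C) ** (cb F d : C) = signed_term (cb F) (cidx_mul c d)).
    case: (cidx_mul c d) => [[[] k]|] /=.
    + by exists k, (-1); rewrite !scaleN1r.
    + by exists k, 1; rewrite !scale1r.
    + by exists c, 0; rewrite !scale0r.
  by rewrite -cb_mulE; exact: cayley_mul_cb.
Qed.

End CayleyAutomorphism.

(** Left multiplication by [z] is skew for the form since [z^! = - z], and elements of one Peirce
    component anticommute. *)
Lemma hpeirce_cycle (F : fieldType) (A : hurwitz F) (e x y z : A) : hidempotent e ->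
  hpeirce e x -> hpeirce e y -> hpeirce e z ->
  hpolar x (y ** z) = hpolar y (z ** x).
Proof.
move=> He Ux Uy Uz; rewrite [RHS]hpolarC hpolar_mulll (hpeirce_conj He Uz).
by rewrite hmulNl -(hpeirce_anticomm He).
Qed.

Lemma span4P (F : fieldType) (V : vectType F) (a b c d x : V) :
  x \in <<[:: a; b; c; d]>>%VS ->
  exists k : F * F * F * F, x = k.1.1.1 *: a + k.1.1.2 *: b + k.1.2 *: c + k.2 *: d.
Proof.
rewrite !span_cons span_nil addv0.
case/memv_addP=> z1 /vlineP[k1 ->] [y1 + ->]; case/memv_addP=> z2 /vlineP[k2 ->] [y2 + ->].
case/memv_addP=> z3 /vlineP[k3 ->] [z4 /vlineP[k4 ->] ->].
by exists (k1, k2, k3, k4); rewrite !addrA.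
Qed.

Section CanonicalTriple.
Variables (F : fieldType) (A : hurwitz F) (e : A).
Local Notation B := (@hpolar F A).
Hypothesis He : hidempotent e.
Local Notation U := (hpeirce e).

Let Hf : hidempotent e^!. Proof. exact: hidempotent_conj. Qed.

Lemma hpeirce_polar_mulxr x y : U x -> U y -> B x (y ** x) = 0.
Proof.
by move=> Ux Uy; rewrite (hpeirce_cycle He Ux Uy Ux) (hpeirce_sqr He Ux) hpolar0r.
Qed.

Lemma hpeirce_polar_mulxl x y : U x -> U y -> B x (x ** y) = 0.
Proof.
by move=> Ux Uy; rewrite (hpeirce_anticomm He) // !hpolarE hpeirce_polar_mulxr // oppr0.
Qed.

(** With u = (x, y, z) and v_1 = y z, v_2 = z x this is the relation v_1 v_2 = u_3. The relations
    u_i u_{i+1} = v_{i+2} hold by the choice of the v_i. *)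
Lemma hpeirce_mul_mul x y z : U x -> U y -> U z -> B x (y ** z) = 1 ->
  (y ** z) ** (z ** x) = z.
Proof.
move=> Ux Uy Uz xyz; have Vyz := hpeirce_mulS He Uy Uz.
have := hconj_mull2 (y ** z) z x.
rewrite hpolarC hpeirce_polar_mulxr // scale0r (hpeirce_conj Hf Vyz) (hpeirce_conj He Uz).
rewrite (hpeirce_mulVU He Ux Vyz) xyz scale1r !hmulE opprK (proj2 Uz) => /eqP.
by rewrite addrC subr_eq0 => /eqP.
Qed.

(** The v_i are forced to be u_{i+1} u_{i+2}. The normalization is B(u_1, v_1) = 1, and cyclicity
    spreads it to the other indices. *)
Lemma canonical_of_triple x y z : U x -> U y -> U z -> B x (y ** z) = 1 ->
  exists u v : 'Z_3 -> A, [/\ [/\ u 1 = x, u 2 = y & u 3 = z],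
    [/\ v 1 = y ** z, v 2 = z ** x & v 3 = x ** y],
    (forall i, U (u i)) /\ (forall i, hpeirce e^! (v i)),
    (forall i j, B (u i) (v j) = (i == j)%:R)
  & (forall i, u i ** u (i + 1) = v (i + 2)) /\
    (forall i, v i ** v (i + 1) = u (i + 2))].
Proof.
move=> Ux Uy Uz xyz.
have yzx : B y (z ** x) = 1 by rewrite -(hpeirce_cycle He).
have zxy : B z (x ** y) = 1 by rewrite -(hpeirce_cycle He).
pose sel (a b c : A) (i : 'Z_3) := if i == 1 then a else if i == 2 then b else c.
have [s12 s23 s31] : [/\ 1 + 1 = 2 :> 'Z_3, 2 + 1 = 3 :> 'Z_3 & 3 + 1 = 1 :> 'Z_3].
  by split; apply: val_inj.
have [t13 t21 t32] : [/\ 1 + 2 = 3 :> 'Z_3, 2 + 2 = 1 :> 'Z_3 & 3 + 2 = 2 :> 'Z_3].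
  by split; apply: val_inj.
exists (sel x y z), (sel (y ** z) (z ** x) (x ** y)); split=> //.
- by split; apply: Z3_ind => //; apply: hpeirce_mulS.
- by apply: Z3_ind; apply: Z3_ind => //=; rewrite /sel /= ?hpeirce_polar_mulxl
    ?hpeirce_polar_mulxr.
- split; apply: Z3_ind; rewrite ?(s12, s23, s31, t13, t21, t32) //.
  + exact: hpeirce_mul_mul.
  + exact: hpeirce_mul_mul.
  + exact: hpeirce_mul_mul.
Qed.

End CanonicalTriple.

Lemma cayley_automorphism_triple (F : fieldType) (e x y z : cayley F) :
  hidempotent e -> hpeirce e x -> hpeirce e y -> hpeirce e z -> hpolar x (y ** z) = 1 ->
  exists2 φ : 'End(cayley F), @is_automorphism F (hurwitz_invalg (cayley F)) φ &
    [/\ φ (e1 F) = e, φ (e2 F) = e^!,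
       [/\ φ (u_ F 1) = x, φ (u_ F 2) = y & φ (u_ F 3) = z]
     & [/\ φ (v_ F 1) = y ** z, φ (v_ F 2) = z ** x & φ (v_ F 3) = x ** y]].
Proof.
move=> He Ux Uy Uz xyz.
have [u [v [[u1 u2 u3] [v1 v2 v3] [Uu Vv] uv [uu vv]]]] :=
  canonical_of_triple He Ux Uy Uz xyz.
have [φ Hφ φE] := cayley_automorphism He Uu Vv uv uu vv.
exists φ => //; split; [exact: (φE iE1)|exact: (φE iE2)|split|split].
- by rewrite -u1; exact: (φE (iU 1)).
- by rewrite -u2; exact: (φE (iU 2)).
- by rewrite -u3; exact: (φE (iU 3)).
- by rewrite -v1; exact: (φE (iV 1)).
- by rewrite -v2; exact: (φE (iV 2)).
- by rewrite -v3; exact: (φE (iV 3)).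
Qed.

Lemma big_bool2 (V : nmodType) (f : bool * bool -> V) :
  \sum_i f i = f (true, true) + f (true, false) + f (false, true) + f (false, false).
Proof.
rewrite (eq_bigr (fun i => f (i.1, i.2))) => [|[]//].
by rewrite -(pair_bigA _ (fun a b => f (a, b))) /= !big_bool /= addrA.
Qed.

(** * The same for split quaternion algebras *)

Section Quaternion.
Variables (F : fieldType) (A : hurwitz F).
Local Notation B := (@hpolar F A).

Definition quaternion_triple (e u v : A) :=
  [/\ hidempotent e, hpeirce e u, hpeirce e^! v & B u v = 1].

(** The first bit separates the idempotents from the off-diagonal vectors, the second chooses within
    a hyperbolic pair, so that duality flips it. Up to signs [quaternion_table] multiplies 2 by 2
    matrix units. *)
Definition quaternion_family (e u v : A) (i : bool * bool) : A :=
  match i with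
  | (true, true) => e | (true, false) => e^!
  | (false, true) => u | (false, false) => v
  end.

Definition quaternion_dual (i : bool * bool) := (i.1, ~~ i.2).

Definition quaternion_table (i j : bool * bool) : option (bool * (bool * bool)) :=
  match i, j with
  | (true, a), (true, b) => if a == b then Some (false, i) else None
  | (true, a), (false, b) => if a == b then Some (false, j) else None
  | (false, a), (true, b) => if a != b then Some (false, i) else None
  | (false, a), (false, b) => if a != b then Some (true, (true, a)) else None
  end.

Lemma hpolar_quaternion e u v i j : quaternion_triple e u v ->
  B (quaternion_family e u v i) (quaternion_family e u v j) = (i == quaternion_dual j)%:R.
Proof.
move=> [He Uu Vv uv]; have Hf := hidempotent_conj He.
have eu : B e u = 0 by exact: hpeirce_polar.
have fu : B e^! u = 0 by exact: hpeirce_polarC.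
have fv : B e^! v = 0 by exact: hpeirce_polar.
have ev : B e v = 0 by have := hpeirce_polarC Hf Vv; rewrite hconjK.
have ef : B e e^! = 1 by exact: hpolar_idempotent.
have ee : B e e = 0 by exact: hpolar_idempotentxx.
have ff : B e^! e^! = 0 by exact: hpolar_idempotentxx.
have uu0 : B u u = 0 by exact: (hpeirce_polar0 He).
have vv0 : B v v = 0 by exact: (hpeirce_polar0 Hf).
by case: i j => [[] []] [[] []] //=; first [done | by rewrite hpolarC].
Qed.

Lemma hmul_quaternion e u v i j : quaternion_triple e u v ->
  quaternion_family e u v i ** quaternion_family e u v j =
  signed_term (quaternion_family e u v) (quaternion_table i j).
Proof.
move=> [He Uu Vv uv]; have Hf := hidempotent_conj He.
have uvE : u ** v = - e by rewrite (hpeirce_mulUV He) // uv scale1r.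
have vuE : v ** u = - e^! by rewrite (hpeirce_mulVU He) // uv scale1r.
have ef0 : e ** e^! = 0 by rewrite hmulxconj (proj1 He) scale0r.
have fe0 : e^! ** e = 0 by rewrite hmulconjx (proj1 He) scale0r.
have ee : e ** e = e by exact: hidempotent_mul.
have ff : e^! ** e^! = e^! by exact: hidempotent_mul.
have ve : v ** e = v by case: Vv; rewrite hconjK.
have ev : e ** v = 0 by have := hpeirce_mulCl Hf Vv; rewrite hconjK.
have vf : v ** e^! = 0 by exact: (hpeirce_mulCr Hf).
have fu : e^! ** u = 0 by exact: hpeirce_mulCl.
have ue : u ** e = 0 by exact: hpeirce_mulCr.
have [eu uf] : e ** u = u /\ u ** e^! = u by case: Uu.
have fv : e^! ** v = v by case: Vv.
have uu : u ** u = 0 by exact: (hpeirce_sqr He).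
have vv : v ** v = 0 by exact: (hpeirce_sqr Hf).
by case: i j => [[] []] [[] []].
Qed.

(** Neither the table nor the polar values depend on the triple, so a spanning triple can be carried
    to any other one. *)
Lemma quaternion_automorphism (e0 u0 v0 e u v : A) :
  quaternion_triple e0 u0 v0 -> (forall w, w \in <<[:: e0; e0^!; u0; v0]>>%VS) ->
  quaternion_triple e u v ->
  exists2 φ : 'End(A), @is_automorphism F (hurwitz_invalg A) φ &
    [/\ φ e0 = e, φ e0^! = e^!, φ u0 = u & φ v0 = v].
Proof.
move=> H0 span H; pose q := quaternion_family.
suff [φ Hφ φE] : exists2 φ : 'End(A), @is_automorphism F (hurwitz_invalg A) φ &
    forall i, φ (q e0 u0 v0 i) = q e u v i.
  exists φ => //; split; [exact: (φE (true, true))|exact: (φE (true, false))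
    |exact: (φE (false, true))|exact: (φE (false, false))].
have dualK : involutive quaternion_dual by case=> a b; rewrite /quaternion_dual /= negbK.
apply: (@hurwitz_automorphism F A _ _ _ quaternion_dual).
- move=> x; have [c ->] : exists c : bool * bool -> F, x = \sum_i c i *: q e0 u0 v0 i.
    have [[[[a b] c] d] ->] := span4P (span x).
    exists (fun i => if i.1 then if i.2 then a else b else if i.2 then c else d).
    by rewrite big_bool2 /=; lmod.
  apply: eq_bigr => i _; congr (_ *: _).
  rewrite /q hpolar_suml (bigD1 i) // hpolarZl hpolar_quaternion // dualK eqxx mulr1.
  rewrite big1 => [|j ji]; first by rewrite /= addr0.
  by rewrite hpolarZl hpolar_quaternion // dualK (negPf ji) mulr0.
- by move=> i j; rewrite /q hpolar_quaternion // dualK.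
- by move=> i j; rewrite /q !hpolar_quaternion.
- move=> i j; rewrite /q !hmul_quaternion //.
  case: (quaternion_table i j) => [[[] k]|] /=.
  + by exists k, (-1); rewrite !scaleN1r.
  + by exists k, 1; rewrite !scale1r.
  + by exists i, 0; rewrite !scale0r.
Qed.

End Quaternion.

(** * The model [Q_alg] and its standard quaternion triple *)

Section QAlgebra.
Variable F : fieldType.
Local Notation Q := (Q_alg F).

Lemma val_to_Q x : x \in Q_space F -> vsval (to_Q x) = x.
Proof. exact: vsprojK. Qed.

Lemma Q_space_cb c : c \in [:: iE1; iE2; iU 1; iV 1] -> (cb F c : cayley F) \in Q_space F.
Proof.
by rewrite !inE => /or4P[] /eqP->; rewrite memv_span // !inE eqxx ?orbT.
Qed.

Lemma Q_alg_span (w : Q) :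
  w \in <<[:: to_Q (e1 F); to_Q (e2 F); to_Q (u_ F 1); to_Q (v_ F 1)]>>%VS.
Proof.
have [k E] := span4P (subvsP w).
rewrite -(vsvalK w) E !linearD !linearZ /=.
by rewrite !rpredD // rpredZ // memv_span // !inE eqxx ?orbT.
Qed.

Lemma hpolarQ (x y : Q) : hpolar x y = hpolar (vsval x) (vsval y).
Proof. exact: polar_sub_norm. Qed.

Lemma hmulQ (x y : Q) : vsval (x ** y) = vsval x ** vsval y.
Proof. exact: val_sub_mul (@Q_mul F) x y. Qed.

Lemma honeQ : vsval (hone Q) = hone (cayley F).
Proof. exact: val_sub_one (one_Q F). Qed.

Lemma hbarQ (x : Q) : vsval x^! = (vsval x)^!.
Proof. by rewrite !hconjE linearB linearZ /= honeQ /htrace hpolarQ honeQ. Qed.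

Lemma cayley_conj_e1 : (e1 F)^! = e2 F.
Proof.
have one12 : hone (cayley F) = e1 F + e2 F by [].
rewrite hconjE /htrace one12 hpolarDr !hpolar_cb /= add0r scale1r.
by rewrite addrC addrA addNr add0r.
Qed.

Lemma cayley_idempotent_e1 : hidempotent (e1 F).
Proof.
have one12 : hone (cayley F) = e1 F + e2 F by [].
split; last by rewrite /htrace one12 hpolarDr !hpolar_cb /= add0r.
by rewrite [LHS]cayley_normE !ffunE /= !(mul0r, mulr0, addr0).
Qed.

Lemma cayley_peirce_u i : hpeirce (e1 F) (u_ F i).
Proof. by split; rewrite ?cayley_conj_e1; apply: cayley_mul_cb. Qed.

Lemma cayley_peirce_v i : hpeirce (e1 F)^! (v_ F i).
Proof.
rewrite cayley_conj_e1; split; rewrite -?[(e2 F)^!]/(hbar _) -?cayley_conj_e1 ?hconjK.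
  by rewrite cayley_conj_e1; apply: cayley_mul_cb.
exact: cayley_mul_cb.
Qed.

Lemma Q_alg_conj_e1 : (to_Q (e1 F))^! = to_Q (e2 F).
Proof.
by apply: subvs_inj; rewrite hbarQ !val_to_Q ?cayley_conj_e1 //;
  apply: Q_space_cb; rewrite !inE eqxx ?orbT.
Qed.

Lemma Q_alg_standard : quaternion_triple (to_Q (e1 F)) (to_Q (u_ F 1)) (to_Q (v_ F 1)).
Proof.
have ve1 : vsval (to_Q (e1 F)) = e1 F by apply: val_to_Q; apply: (Q_space_cb (c := iE1)).
have vu : vsval (to_Q (u_ F 1)) = u_ F 1.
  by apply: val_to_Q; apply: (Q_space_cb (c := iU 1)).
have vv : vsval (to_Q (v_ F 1)) = v_ F 1.
  by apply: val_to_Q; apply: (Q_space_cb (c := iV 1)); rewrite !inE eqxx ?orbT.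
split.
- split; first by have := proj1 cayley_idempotent_e1; rewrite -{1}ve1.
  by rewrite /htrace hpolarQ honeQ ve1; exact: (proj2 cayley_idempotent_e1).
- by split; apply: subvs_inj; rewrite hmulQ ?hbarQ ve1 vu; case: (cayley_peirce_u 1).
- by split; apply: subvs_inj; rewrite hmulQ ?hbarQ ?ve1 vv; case: (cayley_peirce_v 1).
- by rewrite hpolarQ vu vv hpolar_cb.
Qed.

End QAlgebra.

(** * Homogeneous projections *)

Section Projections.
Variables (F : fieldType) (V : vectType F) (G : zmodType) (Γ : G -> {vspace V}).

(** A direct decomposition presented by linear maps. The group may be infinite, so a finite list [s]
    covering the support is part of the data. *)
Definition homogeneous_projections (s : seq G) (p : G -> 'End(V)) : Prop :=
  [/\ uniq s, forall g x, p g x \in Γ g,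
      forall g h x, x \in Γ h -> p g x = if g == h then x else 0
    & forall x, x = \sum_(g <- s) p g x].

Lemma directv_seq (s : seq G) :
  directv (\sum_(g <- s) Γ g)%VS =
  directv (\sum_(i < size s) Γ (tnth (in_tuple s) i))%VS.
Proof.
rewrite !directvE /=; congr (\dim _ == _); exact: big_tnth.
Qed.

Lemma subv_sum_seq (s : seq G) (W : {vspace V}) :
  (forall g, g \in s -> (Γ g <= W)%VS) -> (\sum_(g <- s) Γ g <= W)%VS.
Proof.
move=> sW; rewrite big_seq; elim/big_ind: _ => [|U1 U2 U1W U2W|]; first exact: sub0v.
  by rewrite subv_add U1W.
exact: sW.
Qed.

Lemma subv_sum_mem (s : seq G) g : g \in s -> (Γ g <= \sum_(h <- s) Γ h)%VS.
Proof.
elim: s => [//|h s IHs]; rewrite inE big_cons => /predU1P[->|/IHs]; first exact: addvSl.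
by move/subv_trans; apply; apply: addvSr.
Qed.

Lemma directv_seq_independent (s : seq G) (y : G -> V) : uniq s ->
  directv (\sum_(g <- s) Γ g)%VS -> (forall g, y g \in Γ g) ->
  \sum_(g <- s) y g = 0 -> forall g, g \in s -> y g = 0.
Proof.
move=> s_uniq; rewrite directv_seq => /directv_sum_independent dx yΓ.
rewrite big_tnth => y0 g gs.
have := dx (fun i => y (tnth (in_tuple s) i)) (fun i _ => yΓ _) y0.
by move=> E; have /tnthP[i ->] : g \in in_tuple s by []; apply: E.
Qed.

Lemma projections_exist :
  (forall s : seq G, uniq s -> directv (\sum_(g <- s) Γ g)%VS) ->
  (forall x, exists s : seq G, x \in (\sum_(g <- s) Γ g)%VS) ->
  exists s p, homogeneous_projections s p.
Proof.
move=> dx tot.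
(* Finitely many degrees suffice: those occurring in chosen decompositions of the vectors of a
   basis. *)
have [s s_uniq sV] : exists2 s : seq G, uniq s & forall x, x \in (\sum_(g <- s) Γ g)%VS.
  suff [s s_uniq sV] : exists2 s : seq G, uniq s &
      {subset (vbasis {:V} : seq V) <= (\sum_(g <- s) Γ g)%VS}.
    exists s => // x; rewrite (coord_vbasis (memvf x)) rpred_sum // => i _.
    by rewrite rpredZ // sV // mem_nth // size_tuple.
  elim: (vbasis {:V} : seq V) => [|x t [s s_uniq IHs]]; first by exists [::].
  have [s' xs'] := tot x; exists (undup (s' ++ s)); first exact: undup_uniq.
  have sub r : {subset r <= s' ++ s} ->
      (\sum_(g <- r) Γ g <= \sum_(g <- undup (s' ++ s)) Γ g)%VS.
    by move=> rs; apply: subv_sum_seq => g /rs gr; apply: subv_sum_mem; rewrite mem_undup.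
  move=> y; rewrite inE => /predU1P[->|/IHs].
    by apply: (subvP (sub s' _)) => // g; rewrite mem_cat => ->.
  by apply: (subvP (sub s _)) => g; rewrite mem_cat orbC => ->.
pose p g : 'End(V) := if g \in s then sumv_pi (\sum_(h <- s) Γ h)%VS g else 0.
have pΓ g x : p g x \in Γ g.
  by rewrite /p; case: ifP => _; rewrite ?memv_sum_pi // lfunE /= mem0v.
have psum x : x = \sum_(g <- s) p g x.
  rewrite -[LHS](@sumv_pi_uniq_sum _ _ _ s xpredT Γ _ erefl x) ?filter_predT ?sV //.
  by apply: eq_big_seq => g gs; rewrite /p gs.
exists s, p; split=> // g h x xh.
(* [g] and [h] may lie outside [s], so the two decompositions of [x] are compared over an enlarged
   list, where independence still applies. *)
pose s' := undup (g :: h :: s).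
have s'_uniq : uniq s' by apply: undup_uniq.
have := directv_seq_independent (y := fun k => p k x - (if k == h then x else 0)) s'_uniq
  (dx _ s'_uniq).
have y_mem k : p k x - (if k == h then x else 0) \in Γ k.
  by rewrite rpredB //; case: eqP => [->//|]; rewrite mem0v.
move=> /(_ y_mem) E.
suff s0 : \sum_(k <- s') (p k x - (if k == h then x else 0)) = 0.
  have gs' : g \in s' by rewrite mem_undup inE eqxx.
  by have /eqP := E s0 g gs'; rewrite subr_eq0 => /eqP.
rewrite sumrB -big_mkcond /= -[X in _ - X]big_filter.
have -> : [seq k <- s' | k == h] = [:: h].
  by rewrite filter_pred1_uniq // mem_undup !inE eqxx orbT.
rewrite big_seq1; apply/eqP; rewrite subr_eq0; apply/eqP.
rewrite [RHS]psum (bigID (mem s)) /= addrC big1 ?add0r => [|k /negPf ks]; last first.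
  by rewrite /p ks lfunE.
rewrite -big_filter; apply: perm_big.
apply: uniq_perm => // [|k]; first exact: filter_uniq.
by rewrite mem_filter mem_undup !inE; case: (k \in s); rewrite ?orbT.
Qed.

Lemma projections_direct s p : homogeneous_projections s p ->
  forall s : seq G, uniq s -> directv (\sum_(g <- s) Γ g)%VS.
Proof.
move=> [_ _ pid _] r r_uniq; rewrite directv_seq; apply/directv_sum_independent.
move=> us usΓ us0 i _.
have := congr1 (p (tnth (in_tuple r) i)) us0.
rewrite linear_sum linear0 (bigD1 i) //= (pid _ _ _ (usΓ i isT)) eqxx big1 ?addr0 //.
move=> j ji; rewrite (pid _ _ _ (usΓ j isT)); case: eqP => // /eqP.
have /tuple_uniqP inj : uniq (in_tuple r) by [].
by rewrite (inj_eq inj) eq_sym (negPf ji).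
Qed.

Lemma projections_total s p : homogeneous_projections s p ->
  forall x, exists s : seq G, x \in (\sum_(g <- s) Γ g)%VS.
Proof.
move=> [_ pΓ _ psum] x; exists s; rewrite (psum x) big_seq rpred_sum // => g gs.
by apply: (subvP (subv_sum_mem gs)).
Qed.

Lemma projections_support s p g : homogeneous_projections s p -> g \notin s -> Γ g = 0%VS.
Proof.
move=> [_ _ pid psum] gs; apply/eqP; rewrite -subv0; apply/subvP => x xg.
rewrite memv0 (psum x) big_seq big1 // => h hs; rewrite (pid _ _ _ xg).
by case: eqP => // hg; rewrite -hg hs in gs.
Qed.

Lemma projections_disjoint s p g h x : homogeneous_projections s p ->
  x \in Γ g -> x \in Γ h -> x != 0 -> g = h.
Proof.
move=> [_ _ pid _] xg xh x0; have := pid g h x xh; rewrite (pid g g x xg) eqxx.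
by case: eqP => // _ E; rewrite E eqxx in x0.
Qed.

End Projections.

Section GradedAlgebra.
Variables (F : fieldType) (A : invalg F).

Definition bilinear_mul : Prop :=
  (forall y, linear (fun x : A => iamul x y)) /\ (forall x, linear (iamul x : A -> A)).

Lemma grading_projections (Γ : gfamily A) : is_grading Γ ->
  exists s p, homogeneous_projections (V := A) Γ s p.
Proof. by case=> dx tot _ _; apply: projections_exist. Qed.

Lemma projections_grading (Γ : gfamily A) s p :
  homogeneous_projections (V := A) Γ s p ->
  (forall g h x y, x \in Γ g -> y \in Γ h -> iamul x y \in Γ (g + h)) ->
  (forall g x, x \in Γ g -> iaconj x \in Γ g) -> is_grading Γ.
Proof.
move=> H mulΓ conjΓ; split=> //; first exact: projections_direct H.
exact: projections_total H.
Qed.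

Hypothesis A_bilinear : bilinear_mul.
Variables (Γ : gfamily A) (s : seq (ggroup Γ)) (p : ggroup Γ -> 'End(A)).
Hypothesis Γp : homogeneous_projections (V := A) Γ s p.
Hypothesis Γgrading : is_grading Γ.

Lemma iamul_sumr (x : A) (f : ggroup Γ -> A) :
  iamul x (\sum_(g <- s) f g) = \sum_(g <- s) iamul x (f g).
Proof.
have [_ /(_ x) L] := A_bilinear.
have [φ φE] := linfun_exists L.
by rewrite -φE linear_sum; apply: eq_bigr => g _; rewrite /= φE.
Qed.

Lemma iamul_suml (x : A) (f : ggroup Γ -> A) :
  iamul (\sum_(g <- s) f g) x = \sum_(g <- s) iamul (f g) x.
Proof.
have [/(_ x) L _] := A_bilinear.
have [φ φE] := linfun_exists L.
by rewrite -φE linear_sum; apply: eq_bigr => g _; rewrite /= φE.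
Qed.

Lemma projection_sum (f : ggroup Γ -> A) (α : ggroup Γ -> ggroup Γ) g :
  (forall h, f h \in Γ (α h)) ->
  p g (\sum_(h <- s) f h) = \sum_(h <- s | α h == g) f h.
Proof.
move=> fΓ; have [_ _ pid _] := Γp; rewrite linear_sum [RHS]big_mkcond /=.
by apply: eq_bigr => h _; rewrite (pid _ _ _ (fΓ h)) eq_sym.
Qed.

(** Translation by [h] is injective on degrees, so multiplication by a homogeneous element permutes
    the components without merging them. All arguments about graded subspaces use this shift. *)
Lemma projection_mull g h x y : x \in Γ h -> p (h + g) (iamul x y) = iamul x (p g y).
Proof.
move=> xh; have [s_uniq pΓ pid psum] := Γp; have [_ _ mulΓ _] := Γgrading.
rewrite {1}[y]psum iamul_sumr (projection_sum (α := fun k => h + k)); last first.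
  by move=> k; apply: mulΓ.
under eq_bigl do rewrite (inj_eq (addrI h)).
have [gs|gs] := boolP (g \in s).
  by rewrite -big_filter filter_pred1_uniq // big_seq1.
rewrite big_seq_cond big1 => [|k /andP[ks /eqP kg]]; last by rewrite -kg ks in gs.
have -> : p g y = 0.
  by apply/eqP; rewrite -memv0 -(projections_support Γp gs).
have [_ /(_ x) L] := A_bilinear; have [φ φE] := linfun_exists L.
by rewrite -φE linear0.
Qed.

Lemma projection_mulr g h x y : x \in Γ h -> p (g + h) (iamul y x) = iamul (p g y) x.
Proof.
move=> xh; have [s_uniq pΓ pid psum] := Γp; have [_ _ mulΓ _] := Γgrading.
rewrite {1}[y]psum iamul_suml (projection_sum (α := fun k => k + h)); last first.
  by move=> k; apply: mulΓ.
under eq_bigl do rewrite (inj_eq (addIr h)).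
have [gs|gs] := boolP (g \in s).
  by rewrite -big_filter filter_pred1_uniq // big_seq1.
rewrite big_seq_cond big1 => [|k /andP[ks /eqP kg]]; last by rewrite -kg ks in gs.
have -> : p g y = 0.
  by apply/eqP; rewrite -memv0 -(projections_support Γp gs).
have [/(_ x) L _] := A_bilinear; have [φ φE] := linfun_exists L.
by rewrite -φE linear0.
Qed.

(** The component [p 0 u] is a right unit on homogeneous elements by the shift rule, hence on [u],
    so it equals [u]. *)
Lemma unit_neutral (u : A) : left_id u (@iamul F A) -> right_id u (@iamul F A) -> u \in Γ 0.
Proof.
move=> ul ur; have [_ pΓ pid psum] := Γp.
have H x g : x \in Γ g -> x = iamul x (p 0 u).
  by move=> xg; rewrite -(projection_mull _ _ xg) ur addr0 (pid _ _ _ xg) eqxx.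
suff -> : u = p 0 u by apply: pΓ.
rewrite -[RHS]ul {1 2}[u]psum iamul_suml.
by apply: eq_bigr => g _; apply: H.
Qed.

Lemma projection_conj g x : linear (@iaconj F A) -> p g (iaconj x) = iaconj (p g x).
Proof.
move=> L; have [φ φE] := linfun_exists L; have [_ pΓ pid psum] := Γp.
have [_ _ _ conjΓ] := Γgrading.
rewrite {1}[x]psum -φE linear_sum /= (projection_sum (α := id)); last first.
  by move=> k; rewrite φE; apply: conjΓ.
have [s_uniq _ _ _] := Γp.
have [gs|gs] := boolP (g \in s).
  by rewrite -big_filter filter_pred1_uniq // big_seq1 φE.
rewrite big_seq_cond big1 => [|k /andP[ks /eqP kg]]; last by rewrite -kg ks in gs.
have -> : p g x = 0.
  by apply/eqP; rewrite -memv0 -(projections_support Γp gs).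
by rewrite -φE linear0.
Qed.

End GradedAlgebra.

(** * Gradings of Hurwitz algebras *)

Lemma sqrt_exists (F : closedFieldType) (a : F) : exists x, x ^+ 2 = a.
Proof.
have [x] := solve_monicpoly (fun i => if i == 0 then a else 0) (isT : (0 < 2)%N).
rewrite !big_ord_recl big_ord0 /= expr0 mulr1 mul0r !addr0 => E.
by exists x.
Qed.

Lemma dim_leq_span (F : fieldType) (V : vectType F) (s : seq V) :
  (forall x : V, x \in <<s>>%VS) -> (\dim {:V} <= size s)%N.
Proof.
move=> sV; apply: leq_trans (dim_span s); apply: dimvS; apply/subvP => x _; exact: sV.
Qed.

Section GradedHurwitz.
Variables (F : fieldType) (A : hurwitz F).
Hypothesis char_neq2 : (2 : F) != 0.
Local Notation B := (@hpolar F A).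
Local Notation n := (@hnorm F A).
Local Notation t := (@htrace F A).
Local Notation one := (hone A).
Variable Γ : gfamily (hurwitz_invalg A).
Hypothesis Γgrading : is_grading Γ.
Variables (s : seq (ggroup Γ)) (p : ggroup Γ -> 'End(A)).
Hypothesis Γp : homogeneous_projections (V := A) Γ s p.

Lemma hurwitz_bilinear : bilinear_mul (hurwitz_invalg A).
Proof.
by split=> [y a x z|x a y z] /=; rewrite ?hmulDl ?hmulZl ?hmulDr ?hmulZr.
Qed.

Lemma graded_mul g h x y : x \in Γ g -> y \in Γ h -> x ** y \in Γ (g + h).
Proof. by case: Γgrading => _ _ H _; apply: H. Qed.

Lemma graded_conj g x : x \in Γ g -> x^! \in Γ g.
Proof. by rewrite hbarE; case: Γgrading => _ _ _ H; apply: H. Qed.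

Lemma graded_disjoint g h x : x \in Γ g -> x \in Γ h -> x != 0 -> g = h.
Proof. exact: projections_disjoint Γp. Qed.

Lemma projection_mem g x : p g x \in Γ g.
Proof. by case: Γp. Qed.

Lemma projection_decomp x : x = \sum_(g <- s) p g x.
Proof. by case: Γp. Qed.

Lemma graded_one : one \in Γ 0.
Proof.
exact: (unit_neutral hurwitz_bilinear Γp Γgrading (@hmul1x F A) (@hmulx1 F A)).
Qed.

(** [B x y *: one] equals [x ** y^! + y ** x^!], which has degree [g + h], whereas the unit has
    degree 0. *)
Lemma graded_polar g h x y : x \in Γ g -> y \in Γ h -> g + h != 0 -> B x y = 0.
Proof.
move=> xg yh; apply: contraNeq => B0; apply/eqP.
have one0 : one != 0.
  by apply: contraNneq B0 => o; rewrite -[x]hmul1x o hmul0l hpolar0l.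
apply: (graded_disjoint (x := one)) graded_one _ => //.
rewrite -[one](scalerK B0) rpredZ // -hmulxconj2 rpredD //.
  by apply: graded_mul => //; apply: graded_conj.
by rewrite addrC; apply: graded_mul => //; apply: graded_conj.
Qed.

Lemma sum_neq0_exists (V : nmodType) (f : ggroup Γ -> V) :
  \sum_(g <- s) f g != 0 -> exists g, f g != 0.
Proof.
have [/hasP[g _ fg]|/hasPn H] := boolP (has (fun g => f g != 0) s); first by exists g.
by rewrite big_seq big1 ?eqxx // => g /H; rewrite negbK => /eqP.
Qed.

Lemma graded_nondegenerate g x : x \in Γ g -> x != 0 ->
  exists2 y, y \in Γ (- g) & B x y != 0.
Proof.
move=> xg x0; have [[y Bxy]|H] := classic (exists y, B x y != 0); last first.
  case/eqP: x0; apply: hpolarP => z; rewrite hpolar0l; apply/eqP.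
  by apply: contraT => Bz; case: H; exists z.
have [|h Bh] := sum_neq0_exists (f := fun h => B x (p h y)).
  by rewrite -hpolar_sumr -projection_decomp.
exists (p h y) => //; have <- : h = - g; last exact: projection_mem.
apply/eqP; rewrite -addr_eq0 addrC; apply: contraNT Bh => gh; apply/eqP.
exact: graded_polar xg (projection_mem h y) gh.
Qed.

Lemma hidempotent_half (q : A) : one != 0 -> t q = 0 -> n q = -1 ->
  hidempotent (2^-1 *: (one + q)).
Proof.
move=> one0 tq nq; split.
  by rewrite hnormZ hnormD hnorm1 // nq hpolarC -/(t q) tq; ring.
by rewrite /htrace hpolarZl hpolarDl -!/(t _) htrace1 // tq addr0 mulVf.
Qed.

(** The map [r] projects to trace 0. The form is nondegenerate on the trace zero part of the neutral
    component, so a nonzero [r x] has a partner [r z], and one of [r x], [r z], [r x + r z] has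
    nonzero norm. *)
Lemma neutral_trace0_norm x : x \in Γ 0 -> x \notin <[one]>%VS ->
  exists y, [/\ y \in Γ 0, t y = 0 & n y != 0].
Proof.
move=> x0 xone.
have one0 : one != 0.
  apply: contraNneq xone => o.
  by rewrite -[x]hmul1x o hmul0l mem0v.
pose r z := z - (t z / 2) *: one.
have r0 z : z \in Γ 0 -> r z \in Γ 0 by move=> z0; rewrite rpredB ?rpredZ ?graded_one.
have tr z : t (r z) = 0.
  by rewrite /r /htrace hpolarDl hpolarNl hpolarZl -!/(t _) htrace1 // divfK ?subrr.
have rx : r x != 0.
  apply: contraNneq xone => /eqP; rewrite subr_eq0 => /eqP->.
  exact: memvZ (memv_line _).
have [z] := graded_nondegenerate (r0 _ x0) rx; rewrite oppr0 => z0 Bz.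
have Brz : B (r x) (r z) != 0.
  by rewrite [r z]/r hpolarDr hpolarNr hpolarZr -/(t (r x)) tr mulr0 oppr0 addr0.
have [nx|nx] := eqVneq (n (r x)) 0; last by exists (r x); rewrite r0.
have [nz|nz] := eqVneq (n (r z)) 0; last by exists (r z); rewrite r0.
exists (r x + r z); split; first by rewrite rpredD ?r0.
  by rewrite /htrace hpolarDl -!/(t _) !tr addr0.
by rewrite hnormD nx nz !add0r.
Qed.

(** Multiplication by an element of degree 0 commutes with the projections. *)
Lemma graded_peirce e g x : e \in Γ 0 -> hpeirce e x -> hpeirce e (p g x).
Proof.
move=> e0 [ex xf]; split.
  have := @projection_mull _ _ hurwitz_bilinear _ _ _ Γp Γgrading g 0 e x e0.
  by rewrite /= ex add0r => <-.
have := @projection_mulr _ _ hurwitz_bilinear _ _ _ Γp Γgrading g 0 e^! x (graded_conj e0).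
by rewrite /= xf addr0 => <-.
Qed.

Lemma graded_triple e : e \in Γ 0 ->
  (exists x y z, [/\ hpeirce e x, hpeirce e y, hpeirce e z & B x (y ** z) != 0]) ->
  exists x y z, [/\ hpeirce e x, hpeirce e y, hpeirce e z & B x (y ** z) = 1] /\
    exists g h k, [/\ x \in Γ g, y \in Γ h & z \in Γ k].
Proof.
move=> e0 [x [y [z [Ux Uy Uz]]]].
rewrite {1}[x]projection_decomp hpolar_suml => /sum_neq0_exists[g].
rewrite {1}[y]projection_decomp hmul_suml hpolar_sumr => /sum_neq0_exists[h].
rewrite {1}[z]projection_decomp hmul_sumr hpolar_sumr => /sum_neq0_exists[k] Bk.
exists ((B (p g x) (p h y ** p k z))^-1 *: p g x), (p h y), (p k z); split.
  split; [exact/hpeirceZ/graded_peirce|exact: graded_peirce|exact: graded_peirce|].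
  by rewrite hpolarZl mulVf.
by exists g, h, k; rewrite rpredZ ?projection_mem.
Qed.

Lemma graded_pair e : e \in Γ 0 ->
  (exists x y, [/\ hpeirce e x, hpeirce e^! y & B x y != 0]) ->
  exists x y, [/\ hpeirce e x, hpeirce e^! y & B x y = 1] /\
    exists g h, x \in Γ g /\ y \in Γ h.
Proof.
move=> e0 [x [y [Ux Vy]]].
rewrite {1}[x]projection_decomp hpolar_suml => /sum_neq0_exists[g].
rewrite {1}[y]projection_decomp hpolar_sumr => /sum_neq0_exists[h] Bh.
exists ((B (p g x) (p h y))^-1 *: p g x), (p h y); split.
  split; [exact/hpeirceZ/graded_peirce|exact/graded_peirce/Vy/graded_conj|].
  by rewrite hpolarZl mulVf.
by exists g, h; rewrite rpredZ ?projection_mem.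
Qed.

(** * Gradings whose neutral component is the line of 1 *)

Section TrivialNeutral.
Hypothesis neutral_line : forall x, x \in Γ 0 -> x \in <[one]>%VS.

(** For [y] of degree [- g] pairing with [x], the degrees are in fact such that [x ** y^!] and
    [y ** x^!] are scalars. If [n x = 0], multiplying by [x^!] and by [x] makes both scalars 0, so
    their sum [B x y *: one] vanishes. *)
Lemma homogeneous_norm g x : x \in Γ g -> x != 0 -> n x != 0.
Proof.
move=> xg x0; apply: contra_neq (x0) => nx.
have [y yg Bxy] := graded_nondegenerate xg x0.
have xy0 : x ** y^! = 0.
  have /vlineP[c E] : x ** y^! \in <[one]>%VS.
    by apply: neutral_line; rewrite -(subrr g); apply: graded_mul (graded_conj yg).
  have := hconj_mull x y^!; rewrite E nx scale0r !hmulE => /eqP.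
  rewrite scaler_eq0 => /orP[/eqP->|/eqP xb]; first by rewrite scale0r.
  by case/eqP: x0; rewrite -[x]hconjK xb hconj0.
have yx0 : y ** x^! = 0.
  have /vlineP[c E] : y ** x^! \in <[one]>%VS.
    by apply: neutral_line; rewrite -(addNr g); apply: graded_mul (graded_conj xg).
  have := hconj_mulr x y; rewrite E nx scale0r !hmulE => /eqP.
  rewrite scaler_eq0 => /orP[/eqP->|/eqP xb]; first by rewrite scale0r.
  by case/eqP: x0.
have := hmulxconj2 x y; rewrite xy0 yx0 addr0 => /esym/eqP.
by rewrite scaler_eq0 (negPf Bxy) => /eqP o; rewrite -[x]hmul1x o hmul0l.
Qed.

(** [B x x = 2 * n x] is nonzero, so [graded_polar] forces the degree. *)
Lemma homogeneous_degree2 g x : x \in Γ g -> x != 0 -> g + g = 0.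
Proof.
move=> xg x0; apply/eqP; apply: contraNT (homogeneous_norm xg x0) => gg.
have := graded_polar xg xg gg; rewrite hpolarxx => /eqP.
by rewrite mulf_eq0 (negPf char_neq2).
Qed.

(** [x^! ** y] has degree [g + g = 0], so it is a scalar; multiplying by the invertible [x] recovers
    [y]. *)
Lemma homogeneous_line g x y : x \in Γ g -> x != 0 -> y \in Γ g -> y \in <[x]>%VS.
Proof.
move=> xg x0 yg.
have /vlineP[c E] : x^! ** y \in <[one]>%VS.
  apply: neutral_line; rewrite -(homogeneous_degree2 xg x0).
  exact: graded_mul (graded_conj xg) yg.
have := hmul_conjl x y; rewrite E !hmulE => E2.
by rewrite -[y](scalerK (homogeneous_norm xg x0)) -E2 !memvZ // memv_line.
Qed.

(** Components are at most lines, so those with degree in [L] span at most [size L] dimensions. *)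
Lemma new_degree (L : seq (ggroup Γ)) : (size L < \dim {:A})%N ->
  exists g x, [/\ g \notin L, x \in Γ g & x != 0].
Proof.
move=> sL; have [/hasP[g _ /andP[gL g0]]|/hasPn H] :=
  boolP (has (fun g => (g \notin L) && (Γ g != 0%VS)) s).
  by exists g, (vpick (Γ g)); rewrite gL memv_pick vpick0.
suff : (\dim {:A} <= size [seq (vpick (Γ g) : A) | g <- L])%N.
  by rewrite size_map leqNgt sL.
apply: dim_leq_span => x; rewrite [x]projection_decomp big_seq rpred_sum // => g gs.
have := H g gs; rewrite negb_and !negbK.
have [gL _|_ /= /eqP g0] := boolP (g \in L); last first.
  by have := projection_mem g x; rewrite g0 memv0 => /eqP->; rewrite mem0v.
have [->|px] := eqVneq (p g x) 0; first exact: mem0v.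
have pick0 : vpick (Γ g) != 0.
  rewrite vpick0; apply: contraNneq px => g0.
  by have := projection_mem g x; rewrite g0 memv0.
have /vlineP[c ->] := homogeneous_line (memv_pick _) pick0 (projection_mem g x).
by rewrite rpredZ // memv_span //; apply: map_f.
Qed.

Lemma homogeneous_orthogonal g h x y : x \in Γ g -> y \in Γ h -> g != h -> B x y = 0.
Proof.
move=> xg yh gh; have [->|x0] := eqVneq x 0; first by rewrite hpolar0l.
apply: (graded_polar xg yh); apply: contra_neq gh => gh0.
by apply: (addrI g); rewrite gh0 (homogeneous_degree2 xg).
Qed.

End TrivialNeutral.

End GradedHurwitz.

Lemma hnorm_rescale (F : closedFieldType) (A : hurwitz F) (x : A) (a : F) :
  hnorm x != 0 -> exists c, hnorm (c *: x) = a.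
Proof.
move=> nx; have [c cE] := sqrt_exists (a / hnorm x).
by exists c; rewrite hnormZ cE divfK.
Qed.

(** This makes [Γ] a coarsening of the image of [Δ]. Only components are compared, since the two
    grading groups need not be related by a map. *)
Definition carries (F : fieldType) (A : hurwitz F) (φ : 'End(A)) (G : Type)
    (Δ : G -> {vspace A}) (Γ : gfamily (hurwitz_invalg A)) : Prop :=
  forall g, exists k, (φ @: Δ g <= (Γ k : {vspace A}))%VS.

(** * Generators of the elementary 2-group gradings *)

Section Classification.
Variables (F : closedFieldType) (A : hurwitz F).
Hypothesis char_neq2 : (2 : F) != 0.
Local Notation B := (@hpolar F A).
Local Notation n := (@hnorm F A).
Local Notation t := (@htrace F A).
Local Notation one := (hone A).

Lemma peirce_split e x : hidempotent e -> B x e = 0 -> B x e^! = 0 ->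
  exists y z, [/\ hpeirce e y, hpeirce e^! z, x = y + z & B y z = n x].
Proof.
move=> He xe xf; have [y [z [Uy Vz E]]] := hpeirce_decomp x He.
exists y, z; have {E} -> : x = y + z by rewrite [LHS]E xe xf !scale0r !add0r.
split=> //; rewrite hnormD (hpeirce_norm He Uy).
by rewrite (hpeirce_norm (hidempotent_conj He) Vz) !add0r.
Qed.

Lemma half_polar q x : B x one = 0 -> B x q = 0 -> B x (2^-1 *: (one + q)) = 0.
Proof. by move=> x1 xq; rewrite hpolarZr hpolarDr x1 xq addr0 mulr0. Qed.

Lemma half_conj q : one != 0 -> t q = 0 ->
  (2^-1 *: (one + q))^! = 2^-1 *: (one - q).
Proof.
move=> one0 tq; rewrite hconjE /htrace hpolarZl hpolarDl -!/(t _) htrace1 // tq.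
by lmod_field.
Qed.

Variable Γ : gfamily (hurwitz_invalg A).
Hypothesis Γgrading : is_grading Γ.

Lemma neutral_idempotent x : x \in Γ 0 -> x \notin <[one]>%VS ->
  exists2 e, e \in Γ 0 & hidempotent e.
Proof.
move=> x0 xone; have [s [p Γp]] := grading_projections Γgrading.
have one0 : one != 0.
  by apply: contraNneq xone => o; rewrite -[x]hmul1x o hmul0l mem0v.
have [y [y0 ty ny]] := neutral_trace0_norm char_neq2 Γgrading Γp x0 xone.
have [c nc] := hnorm_rescale (-1) ny.
exists (2^-1 *: (one + c *: y)).
  by rewrite rpredZ // rpredD ?rpredZ //; apply: (graded_one Γgrading Γp).
by apply: hidempotent_half => //; rewrite /htrace hpolarZl -/(t y) ty mulr0.
Qed.

(** A homogeneous u of norm -1 gives the idempotent e = (1 + u)/2 with e - e^! = u. A homogeneous v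
    of norm 1 and a further degree is orthogonal to 1 and u, so it is a sum x + y of Peirce elements
    with B(x, y) = n(v) = 1, just as u_1 + v_1 is. *)
Lemma pauli_generators : (forall x, x \in Γ 0 -> x \in <[one]>%VS) ->
  (2 < \dim {:A})%N -> exists e x y g h,
  [/\ [/\ hidempotent e, hpeirce e x & hpeirce e^! y], B x y = 1,
      e - e^! \in Γ g, x + y \in Γ h & [/\ uniq [:: 0; g; h], g + g = 0 & h + h = 0]].
Proof.
move=> neutral dimA; have [s [p Γp]] := grading_projections Γgrading.
have [g [u [gL ug u0]]] := new_degree char_neq2 Γgrading Γp neutral
  (L := [:: 0]) (leq_trans (isT : (1 < 3)%N) dimA).
have [h [v [hL vh v0]]] := new_degree char_neq2 Γgrading Γp neutral
  (L := [:: 0; g]) dimA.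
have one0 : one != 0 := hone_neq0 u0.
have one1 := graded_one Γgrading Γp.
have [a na] := hnorm_rescale (-1) (homogeneous_norm Γgrading Γp neutral ug u0).
have [b nb] := hnorm_rescale 1 (homogeneous_norm Γgrading Γp neutral vh v0).
have ag : a *: u \in Γ g by rewrite rpredZ.
have bh : b *: v \in Γ h by rewrite rpredZ.
move: gL hL; rewrite !inE !negb_or => g0 /andP[h0 hg].
have orth := homogeneous_orthogonal char_neq2 Γgrading Γp neutral.
have tq : t (a *: u) = 0 by apply: orth ag one1 g0.
have He := hidempotent_half char_neq2 one0 tq na.
have fE := half_conj one0 tq.
have [||x [y [Ux Vy E xy]]] := peirce_split (x := b *: v) He.
- apply: half_polar; first exact: orth bh one1 h0.
  exact: orth bh ag hg.
- rewrite fE; apply: half_polar; first exact: orth bh one1 h0.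
  by rewrite hpolarNr (orth _ _ _ _ bh ag hg) oppr0.
exists (2^-1 *: (one + a *: u)), x, y, g, h; split=> //.
- by rewrite xy.
- by rewrite fE (_ : _ - _ = a *: u) //; lmod_field.
- by move: bh; rewrite E.
- have gg := homogeneous_degree2 char_neq2 Γgrading Γp neutral ug u0.
  have hh := homogeneous_degree2 char_neq2 Γgrading Γp neutral vh v0.
  split=> //; rewrite /= !inE !negb_or !(eq_sym 0) g0 h0 /=.
  by rewrite eq_sym hg.
Qed.

End Classification.

Section Carry.
Variables (F : fieldType) (A : hurwitz F) (φ : 'End(A)) (U : {vspace A}).

Lemma limg_line_sub x : φ x \in U -> (φ @: <[x]> <= U)%VS.
Proof. by rewrite limg_line -memvE. Qed.

Lemma limg_line2_sub x y : φ x \in U -> φ y \in U -> (φ @: (<[x]> + <[y]>) <= U)%VS.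
Proof. by move=> xU yU; rewrite limgD subv_add !limg_line_sub. Qed.

End Carry.

Lemma automorphism_one (F : fieldType) (A : hurwitz F) (φ : 'End(A)) :
  @is_automorphism F (hurwitz_invalg A) φ -> φ (hone A) = hone A.
Proof.
case=> [[ψ _ ψK] φM _].
by rewrite -[LHS]hmulx1 -{2}(ψK (hone A)) -[LHS]φM /= hmul1x ψK.
Qed.

Lemma automorphism_mul (F : fieldType) (A : hurwitz F) (φ : 'End(A)) x y :
  @is_automorphism F (hurwitz_invalg A) φ -> φ (x ** y) = φ x ** φ y.
Proof. by case=> _ φM _; apply: φM. Qed.

Section HurwitzClassification.
Variables (F : closedFieldType) (A : hurwitz F).
Hypothesis char_neq2 : (2 : F) != 0.
Local Notation B := (@hpolar F A).
Local Notation n := (@hnorm F A).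
Local Notation one := (hone A).
Variable Γ : gfamily (hurwitz_invalg A).
Hypothesis Γgrading : is_grading Γ.

Lemma zpow_graded (x : A) g a : x \in Γ g -> exists k, zpow x a \in Γ k.
Proof.
move=> xg; rewrite /zpow; have [s [p Γp]] := grading_projections Γgrading.
by case: eqP => _; [exists 0; exact: (graded_one Γgrading Γp)|exists g].
Qed.

Lemma zpow_mul_graded (x y : A) g h a b : x \in Γ g -> y \in Γ h ->
  exists k, zpow x a ** zpow y b \in Γ k.
Proof.
move=> /(zpow_graded a)[k xk] /(zpow_graded b)[l yl].
by exists (k + l); apply: (graded_mul Γgrading).
Qed.

Lemma zpow_automorphism (φ : 'End(A)) x a :
  @is_automorphism F (hurwitz_invalg A) φ -> φ (zpow x a) = zpow (φ x) a.
Proof. by move=> Hφ; rewrite /zpow; case: eqP => // _; rewrite automorphism_one. Qed.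

(** In dimension above 4 there is a degree outside 0, g, h, g + h. A vector w of that degree is
    orthogonal to 1, u, v and uv; the first two give its Peirce splitting, the last two the
    vanishing of the cross values. *)
Lemma pauli_third e x y g h : (forall x, x \in Γ 0 -> x \in <[one]>%VS) ->
  (4 < \dim {:A})%N -> hidempotent e -> hpeirce e x -> hpeirce e^! y -> B x y = 1 ->
  e - e^! \in Γ g -> x + y \in Γ h -> exists x' y' k,
  [/\ hpeirce e x', hpeirce e^! y', x' + y' \in Γ k, B x' y' = 1
    & B x y' = 0 /\ B x' y = 0].
Proof.
move=> neutral dimA He Ux Vy xy ug vh; have [s [p Γp]] := grading_projections Γgrading.
have [k [w [kL wk w0]]] := new_degree char_neq2 Γgrading Γp neutral
  (L := [:: 0; g; h; g + h]) dimA.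
have one1 := graded_one Γgrading Γp.
have [a na] := hnorm_rescale 1 (homogeneous_norm Γgrading Γp neutral wk w0).
have ak : a *: w \in Γ k by rewrite rpredZ.
move: kL; rewrite !inE !negb_or => /and4P[k0 kg kh kgh].
have orth := homogeneous_orthogonal char_neq2 Γgrading Γp neutral.
have Hf := hidempotent_conj He.
have wu : B (a *: w) (e - e^!) = 0 by exact: orth ak ug kg.
have w1 : B (a *: w) (e + e^!) = 0.
  rewrite (_ : e + e^! = one); first exact: orth ak one1 k0.
  by rewrite -htrace_scale1 (proj2 He) scale1r.
have halve (c d : F) : c + d = 0 -> c - d = 0 -> c = 0 /\ d = 0.
  move=> cd1 cd2; have c0 : c = 0.
    by apply: (mulfI char_neq2); rewrite mulr0 -[0]addr0 -{1}cd1 -cd2; ring.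
  by move: cd1; rewrite c0 add0r.
have [we wf] : B (a *: w) e = 0 /\ B (a *: w) e^! = 0.
  by apply: halve; rewrite -?hpolarNr -hpolarDr.
have [x' [y' [Ux' Vy' E xy']]] := peirce_split He we wf.
(* Orthogonality to x + y and x - y gives the sum and the difference of the two cross values, and 2
   is invertible. *)
have uvE : (e - e^!) ** (x + y) = x - y.
  rewrite !hmulE (proj1 Ux) (proj1 Vy) (hpeirce_mulCl He Ux).
  by have := hpeirce_mulCl Hf Vy; rewrite hconjK => ->; lmod.
exists x', y', k; split=> //; first by move: ak; rewrite E.
  by rewrite xy'.
have E1 : B (x + y) (x' + y') = 0.
  by rewrite -E hpolarC; exact: orth ak vh kh.
have E2 : B (x - y) (x' + y') = 0.
  rewrite -E hpolarC -uvE; exact: orth ak (graded_mul Γgrading ug vh) kgh.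
move: E1 E2; rewrite !hpolarE (hpeirce_polar0 He Ux Ux') (hpeirce_polar0 Hf Vy Vy').
rewrite (hpolarC y x') !add0r !addr0 oppr0 addr0 => E1 E2.
exact: halve.
Qed.

End HurwitzClassification.

(** * Gradings of C, Q and K as coarsenings of the standard ones *)

Section Classification.
Variable F : closedFieldType.
Hypothesis char_neq2 : (2 : F) != 0.

Lemma neutral_cases (A : hurwitz F) (Γ : gfamily (hurwitz_invalg A)) : is_grading Γ ->
  (exists2 e : A, e \in Γ 0 & hidempotent e) \/
  (forall x : A, x \in Γ 0 -> x \in <[hone A]>%VS).
Proof.
move=> Γgrading.
have [H|H] := classic (exists2 e : A, e \in Γ 0 & hidempotent e); first by left.
right=> x x0; apply: contraT => xone; case: H.
exact: (neutral_idempotent char_neq2 Γgrading x0 xone).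
Qed.

(** If the two Peirce components were orthogonal, nondegeneracy would make both zero and leave only
    the span of [e] and [e^!]. *)
Lemma peirce_pair_exists (A : hurwitz F) (e : A) : hidempotent e -> (2 < \dim {:A})%N ->
  exists x y, [/\ hpeirce e x, hpeirce e^! y & hpolar x y != 0].
Proof.
move=> He dimA; have Hf := hidempotent_conj He; apply: NNPP => H.
move: dimA; apply/negP.
rewrite -leqNgt; apply: (dim_leq_span (s := [:: e; e^!])) => w.
have uv0 u v : hpeirce e u -> hpeirce e^! v -> hpolar u v = 0.
  by move=> Uu Vv; apply/eqP; apply: contraT => B0; case: H; exists u, v.
have [u [v [Uu Vv ->]]] := hpeirce_decomp w He.
have -> : u = 0.
  apply: hpolarP => w'; rewrite hpolar0l hpolarC.
  have [u' [v' [Uu' Vv' ->]]] := hpeirce_decomp w' He; rewrite !hpolarE.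
  rewrite (hpeirce_polar He Uu) (hpeirce_polarC He Uu) (hpeirce_polar0 He Uu' Uu).
  by rewrite (hpolarC v') (uv0 _ _ Uu Vv'); ring.
have -> : v = 0.
  apply: hpolarP => w'; rewrite hpolar0l hpolarC.
  have [u' [v' [Uu' Vv' ->]]] := hpeirce_decomp w' He; rewrite !hpolarE.
  rewrite (hpeirce_polar Hf Vv) (hpeirce_polar0 Hf Vv' Vv) (uv0 _ _ Uu' Vv).
  by have := hpeirce_polarC Hf Vv; rewrite hconjK => ->; ring.
by rewrite !addr0 rpredD // rpredZ // memv_span // !inE eqxx ?orbT.
Qed.

Theorem cayley_gradings (Γ : gfamily (hurwitz_invalg (cayley F))) : is_grading Γ ->
  exists2 φ : 'End(cayley F), @is_automorphism F (hurwitz_invalg (cayley F)) φ &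
    carries φ (cartan_C F) Γ \/ carries φ (cd_C F) Γ.
Proof.
move=> Γgrading; have [s [p Γp]] := grading_projections Γgrading.
have gM := graded_mul Γgrading.
have [[e e0 He]|neutral] := neutral_cases Γgrading.
  have [|x [y [z [[Ux Uy Uz xyz] [g [h [k [xg yh zk]]]]]]]] :=
      graded_triple Γgrading Γp e0.
    (* Were the trilinear form zero, [hpeirce_span] would bound the dimension of C by 4. *)
    apply: NNPP => H.
    have tri x y z : hpeirce e x -> hpeirce e y -> hpeirce e z -> hpolar x (y ** z) = 0.
      by move=> Ux Uy Uz; apply/eqP; apply: contraT => B0; case: H; exists x, y, z.
    have [|u [v [Uu Vv uv]]] := peirce_pair_exists He; first by rewrite dim_cayley.
    have : (4 < \dim {:cayley F})%N by rewrite dim_cayley.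
    rewrite ltnNge => /negP; apply.
    apply: (dim_leq_span (s := [:: e; e^!; (hpolar u v)^-1 *: u; v])).
    apply: hpeirce_span => //; first exact: hpeirceZ.
    by rewrite hpolarZl mulVf.
  have [φ Hφ [φe1 φe2 [φu1 φu2 φu3] [φv1 φv2 φv3]]] :=
    cayley_automorphism_triple He Ux Uy Uz xyz.
  exists φ => //; left=> d; rewrite /cartan_C.
  case: eqP => _; [|case: eqP => _; [|case: eqP => _; [|case: eqP => _;
    [|case: eqP => _; [|case: eqP => _; [|case: eqP => _]]]]]].
  + exists 0; apply: limg_line2_sub; first by rewrite φe1.
    by rewrite φe2; apply: (graded_conj Γgrading).
  + by exists g; apply: limg_line_sub; rewrite φu1.
  + by exists (h + k); apply: limg_line_sub; rewrite φv1 gM.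
  + by exists h; apply: limg_line_sub; rewrite φu2.
  + by exists (k + g); apply: limg_line_sub; rewrite φv2 gM.
  + by exists (g + h); apply: limg_line_sub; rewrite φv3 gM.
  + by exists k; apply: limg_line_sub; rewrite φu3.
  + by exists 0; rewrite limg0 sub0v.
have dimC : (4 < \dim {:cayley F})%N by rewrite dim_cayley.
have [e [x1 [y1 [g [h [[He Ux1 Vy1] xy1 ug vh _]]]]]] :=
  pauli_generators char_neq2 Γgrading neutral (leq_trans (isT : (2 < 5)%N) dimC).
have [x2 [y2 [k [Ux2 Vy2 wk xy2 [xy12 xy21]]]]] :=
  pauli_third char_neq2 Γgrading neutral dimC He Ux1 Vy1 xy1 ug vh.
have Hf := hidempotent_conj He.
(* The relation v_1 v_2 = u_3 forces this third vector. [E1] and [E2] say that the triple then has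
   v_1 = [y1] and v_2 = [y2], so that u_i + v_i goes to the homogeneous vectors [x1 + y1] and
   [x2 + y2]. *)
have Ux3 : hpeirce e (y1 ** y2) by have := hpeirce_mulS Hf Vy1 Vy2; rewrite hconjK.
have E1 : x2 ** (y1 ** y2) = y1.
  have := hconj_mull2 x2 y1 y2; rewrite xy21 scale0r (hpeirce_conj He Ux2).
  rewrite (hpeirce_conj Hf Vy1) (hpeirce_mulUV He Ux2 Vy2) xy2 !hmulE scale1r opprK.
  by case: Vy1 => _; rewrite hconjK => -> /eqP; rewrite addrC subr_eq0 => /eqP.
have E2 : (y1 ** y2) ** x1 = y2.
  have := hmul_conjr2 y2 x1 y1; rewrite hpolarC xy12 scale0r (hpeirce_conj He Ux1).
  rewrite (hpeirce_conj Hf Vy2) (hpeirce_mulVU He Ux1 Vy1) xy1 !hmulE scale1r opprK.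
  by case: Vy2 => -> _ /eqP; rewrite addrC subr_eq0 => /eqP.
have [|φ Hφ [φe1 φe2 [φu1 φu2 φu3] [φv1 φv2 φv3]]] :=
  cayley_automorphism_triple He Ux1 Ux2 Ux3; first by rewrite E1.
exists φ => //; right=> [[[a b] c]]; rewrite /cd_C.
have [kab Kab] := zpow_mul_graded Γgrading a b ug vh.
have [kc Kc] := zpow_graded Γgrading c wk.
exists (kab + kc); apply: limg_line_sub.
rewrite !(automorphism_mul _ _ Hφ) !(zpow_automorphism _ _ Hφ) !linearD !linearN /=.
rewrite φe1 φe2 φu1 φu2 φv1 φv2 E1 E2; exact: gM.
Qed.

Theorem Q_alg_gradings (Γ : gfamily (hurwitz_invalg (Q_alg F))) : is_grading Γ ->
  exists2 φ : 'End(Q_alg F), @is_automorphism F (hurwitz_invalg (Q_alg F)) φ &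
    carries φ (cartan_Q F) Γ \/ carries φ (pauli_Q F) Γ.
Proof.
move=> Γgrading; have [s [p Γp]] := grading_projections Γgrading.
have dimQ : (2 < \dim {:Q_alg F})%N by rewrite dim_Q_alg.
have std := Q_alg_standard F; have f0 := Q_alg_conj_e1 F.
have span w : w \in <<[:: to_Q (e1 F); (to_Q (e1 F))^!; to_Q (u_ F 1); to_Q (v_ F 1)]>>%VS.
  by rewrite f0; apply: Q_alg_span.
have [[e e0 He]|neutral] := neutral_cases Γgrading.
  have [x [y [[Ux Vy xy] [g [h [xg yh]]]]]] :=
    graded_pair Γgrading Γp e0 (peirce_pair_exists He dimQ).
  have H : quaternion_triple e x y by split.
  have [φ Hφ [φe φf φu φv]] := quaternion_automorphism std span H.
  exists φ => //; left=> d; rewrite /cartan_Q.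
  case: eqP => _; [|case: eqP => _; [|case: eqP => _]].
  + exists 0; apply: limg_line2_sub; first by rewrite φe.
    by rewrite -f0 φf; apply: (graded_conj Γgrading).
  + by exists g; apply: limg_line_sub; rewrite φu.
  + by exists h; apply: limg_line_sub; rewrite φv.
  + by exists 0; rewrite limg0 sub0v.
have [e [x [y [g [h [[He Ux Vy] xy ug vh _]]]]]] :=
  pauli_generators char_neq2 Γgrading neutral dimQ.
have H : quaternion_triple e x y by split.
have [φ Hφ [φe φf φu φv]] := quaternion_automorphism std span H.
exists φ => //; right=> [[a b]]; rewrite /pauli_Q.
have [k K] := zpow_mul_graded Γgrading a b ug vh.
exists k; apply: limg_line_sub.
rewrite (automorphism_mul _ _ Hφ) !(zpow_automorphism _ _ Hφ).
rewrite /to_Q !linearD !linearN /= -!/(to_Q _) -f0 φe φf φu φv.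
exact: K.
Qed.

Lemma K_alg_trace0 (x : K_alg F) : htrace x = 0 -> x \in <[to_K (e1 F - e2 F)]>%VS.
Proof.
have oneK : vsval (hone (K_alg F)) = e1 F + e2 F := val_sub_one (one_K F).
have -> : htrace x = hpolar (vsval x) (e1 F + e2 F).
  by rewrite -oneK; exact: polar_sub_norm.
have [k1 [k2 xE]] : exists k1 k2, vsval x = k1 *: e1 F + k2 *: e2 F.
  have : vsval x \in K_space F by exact: subvsP.
  move: (vsval x) => y; rewrite /K_space !span_cons span_nil addv0.
  by case/memv_addP=> z1 /vlineP[k1 ->] [z2 /vlineP[k2 ->] ->]; exists k1, k2.
rewrite xE !hpolarE !hpolar_cb /= !(mulr0, mulr1, addr0, add0r) => /eqP.
rewrite addr_eq0 => /eqP k12; apply/vlineP; exists k1; apply: subvs_inj.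
rewrite linearZ /= vsprojK; last by rewrite rpredB // memv_span // !inE eqxx ?orbT.
by rewrite xE k12; lmod.
Qed.

(** A component of u = e1 - e2 of nonzero degree is orthogonal to 1, hence a multiple of u, as trace
    zero elements form a line. So u is homogeneous in every grading, and the identity serves as the
    automorphism. *)
Theorem K_alg_gradings (Γ : gfamily (hurwitz_invalg (K_alg F))) : is_grading Γ ->
  carries \1%VF (grading_K F) Γ.
Proof.
move=> Γgrading a; have [s [p Γp]] := grading_projections Γgrading.
pose u : K_alg F := to_K (e1 F - e2 F).
have one1 := graded_one Γgrading Γp.
suff [g ug] : exists g, u \in Γ g.
  have [k K] := zpow_graded Γgrading a ug.
  by exists k; apply: limg_line_sub; rewrite lfunE.
have [/hasP[g _ /andP[g0 pg]]|/hasPn H] :=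
    boolP (has (fun g => (g != 0) && (p g u != 0)) s).
  exists g; have xg := projection_mem Γp g u.
  have : htrace (p g u) = 0 by apply: (graded_polar Γgrading Γp xg one1); rewrite addr0.
  move/K_alg_trace0/vlineP => [c E].
  have c0 : c != 0 by apply: contraNneq pg => c0; rewrite E c0 scale0r.
  by rewrite -[u](scalerK c0) -E rpredZ.
exists 0; rewrite [u](projection_decomp Γp) big_seq rpred_sum // => g /H.
rewrite negb_and !negbK => /orP[/eqP->|/eqP->]; first exact: (projection_mem Γp).
exact: mem0v.
Qed.

End Classification.

(** * Tensor products *)

Section TensorLinear.
Variables (F : fieldType) (A B : hurwitz F).
Local Notation T := (tensor A B).
Local Notation oneA := (hone A).
Local Notation oneB := (hone B).
Local Notation bA := (vbasis {:A}).
Local Notation bB := (vbasis {:B}).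

Lemma tens_linearl (y : B) : linear (fun x : A => tens x y : T).
Proof.
by move=> a x x'; apply/matrixP => i j; rewrite !mxE linearP /= mulrDl mulrA.
Qed.

Lemma tens_linearr (x : A) : linear (fun y : B => tens x y : T).
Proof.
by move=> a y y'; apply/matrixP => i j; rewrite !mxE linearP /= mulrDr mulrCA.
Qed.

Lemma tensDl (x x' : A) (y : B) : tens (x + x') y = tens x y + tens x' y.
Proof. by have := tens_linearl y 1 x x'; rewrite !scale1r. Qed.
Lemma tensDr (x : A) (y y' : B) : tens x (y + y') = tens x y + tens x y'.
Proof. by have := tens_linearr x 1 y y'; rewrite !scale1r. Qed.
Lemma tens0l (y : B) : tens (0 : A) y = 0.
Proof. by apply/matrixP => i j; rewrite !mxE linear0 mul0r. Qed.
Lemma tens0r (x : A) : tens x (0 : B) = 0.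
Proof. by apply/matrixP => i j; rewrite !mxE linear0 mulr0. Qed.
Lemma tensZl a (x : A) (y : B) : tens (a *: x) y = a *: tens x y.
Proof. by have := tens_linearl y a x 0; rewrite tens0l !addr0. Qed.
Lemma tensZr a (x : A) (y : B) : tens x (a *: y) = a *: tens x y.
Proof. by have := tens_linearr x a y 0; rewrite tens0r !addr0. Qed.
Lemma tensNl (x : A) (y : B) : tens (- x) y = - tens x y.
Proof. by rewrite -scaleN1r tensZl scaleN1r. Qed.
Lemma tensNr (x : A) (y : B) : tens x (- y) = - tens x y.
Proof. by rewrite -scaleN1r tensZr scaleN1r. Qed.
Lemma tens_suml I (r : seq I) (f : I -> A) (y : B) :
  tens (\sum_(i <- r) f i) y = \sum_(i <- r) tens (f i) y.
Proof. exact: (big_morph (fun x => tens x y) (fun x x' => tensDl x x' y) (tens0l y)). Qed.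
Lemma tens_sumr I (r : seq I) (x : A) (f : I -> B) :
  tens x (\sum_(i <- r) f i) = \sum_(i <- r) tens x (f i).
Proof. exact: (big_morph (tens x) (tensDr x) (tens0r x)). Qed.

Lemma coord_vbasis_delta (V : vectType F) (i j : 'I_(\dim {:V})) :
  coord (vbasis {:V}) i (vbasis {:V})`_j = (i == j)%:R.
Proof. by rewrite (coord_free _ _ (basis_free (vbasisP _))) eq_sym. Qed.

Lemma tens_sum (M : T) : M = \sum_i \sum_j M i j *: tens bA`_i bB`_j.
Proof.
apply/matrixP => i j; rewrite summxE (bigD1 i) //= summxE (bigD1 j) //= !mxE.
rewrite !coord_vbasis_delta !eqxx !mulr1 big1 => [|j' jj']; last first.
  by rewrite !mxE !coord_vbasis_delta [j == _]eq_sym (negPf jj') !mulr0.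
rewrite addr0 big1 ?addr0 // => i' ii'; rewrite summxE big1 // => j' _.
by rewrite !mxE !coord_vbasis_delta [i == _]eq_sym (negPf ii') mul0r mulr0.
Qed.

Lemma tens_ind (P : T -> Prop) : P 0 -> (forall M N, P M -> P N -> P (M + N)) ->
  (forall x y, P (tens x y)) -> forall M, P M.
Proof.
move=> P0 PD Pt M; rewrite [M]tens_sum; elim/big_ind: _ => // i _.
by elim/big_ind: _ => // j _; rewrite -tensZl.
Qed.

Lemma tensor_universal (W : vectType F) (β : A -> B -> W) :
  (forall y, linear (β^~ y)) -> (forall x, linear (β x)) ->
  {f : 'Hom(T, W) | forall x y, f (tens x y) = β x y}.
Proof.
move=> βl βr.
pose h (M : T) := \sum_i \sum_j M i j *: β bA`_i bB`_j.
have [f fE] : {f : 'Hom(T, W) | f =1 h}.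
  apply: linfun_exists => a M N; rewrite /h scaler_sumr -big_split /=.
  apply: eq_bigr => i _; rewrite scaler_sumr -big_split /=.
  by apply: eq_bigr => j _; rewrite !mxE scalerDl scalerA.
exists f => x y; rewrite fE /h.
have [L LE] := linfun_exists (βl y).
rewrite -[β x y]LE {2}(coord_vbasis (memvf x)) linear_sum; apply: eq_bigr => i _.
rewrite linearZ /= LE; have [R RE] := linfun_exists (βr bA`_i).
rewrite -RE {2}(coord_vbasis (memvf y)) linear_sum /= scaler_sumr.
by apply: eq_bigr => j _; rewrite linearZ /= RE scalerA mxE.
Qed.

Lemma tensor_space_sub (U : {vspace A}) (V : {vspace B}) (W : {vspace T}) :
  (forall x y, x \in U -> y \in V -> tens x y \in W) -> (tensor_space U V <= W)%VS.
Proof.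
move=> H; apply/span_subvP => _ /allpairsP[[x y] /= [xU yV ->]].
by apply: H; apply: vbasis_mem.
Qed.

Lemma tensor_maps (f : 'End(A)) (g : 'End(B)) :
  {h : 'End(T) | forall x y, h (tens x y) = tens (f x) (g y)}.
Proof.
apply: (tensor_universal (W := T) (β := fun x y => tens (f x) (g y))) => [y|x] a z z'.
  by rewrite linearP /= tensDl tensZl.
by rewrite linearP /= tensDr tensZr.
Qed.

Lemma tensor_mul_bilinear : bilinear_mul T.
Proof.
split=> [N a M M'|M a N N']; rewrite /= /tensor_mul.
  do 2!(rewrite scaler_sumr -big_split; apply: eq_bigr => ? _ /=).
  do 2!(rewrite scaler_sumr -big_split; apply: eq_bigr => ? _ /=).
  by rewrite !mxE mulrDl scalerDl scalerA mulrA.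
do 2!(rewrite scaler_sumr -big_split; apply: eq_bigr => ? _ /=).
do 2!(rewrite scaler_sumr -big_split; apply: eq_bigr => ? _ /=).
by rewrite !mxE mulrDr scalerDl scalerA mulrCA.
Qed.

Lemma tensor_conj_linear : linear (@tensor_conj F A B : T -> T).
Proof.
move=> a M N; rewrite /tensor_conj.
do 2!(rewrite scaler_sumr -big_split; apply: eq_bigr => ? _ /=).
by rewrite !mxE scalerDl scalerA.
Qed.

Definition tmul (M N : T) : T := tensor_mul M N.

Lemma tmulDl M M' N : tmul (M + M') N = tmul M N + tmul M' N.
Proof. by have := (proj1 tensor_mul_bilinear) N 1 M M'; rewrite !scale1r. Qed.
Lemma tmulDr M N N' : tmul M (N + N') = tmul M N + tmul M N'.
Proof. by have := (proj2 tensor_mul_bilinear) M 1 N N'; rewrite !scale1r. Qed.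
Lemma tmul0l N : tmul 0 N = 0.
Proof. by apply: (addrI (tmul 0 N)); rewrite -tmulDl !addr0. Qed.
Lemma tmul0r N : tmul N 0 = 0.
Proof. by apply: (addrI (tmul N 0)); rewrite -tmulDr !addr0. Qed.
Lemma tmul_tens x y x' y' : tmul (tens x y) (tens x' y') = tens (x ** x') (y ** y').
Proof. exact: tensor_mul_tens. Qed.
Lemma tensor_unit : left_id (tens oneA oneB : T) tmul /\ right_id (tens oneA oneB : T) tmul.
Proof.
by split; apply: tens_ind => [|M N EM EN|x y]; rewrite ?tmul0r ?tmul0l ?tmulDl ?tmulDr
  ?EM ?EN // tmul_tens ?hmul1x ?hmulx1.
Qed.

Definition tassoc (M N P : T) : T := tmul (tmul M N) P - tmul M (tmul N P).

Lemma tassoc_tens (x x' x'' : A) (y y' y'' : B) :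
  (y ** y') ** y'' = y ** (y' ** y'') ->
  tassoc (tens x y) (tens x' y') (tens x'' y'') =
  tens ((x ** x') ** x'' - x ** (x' ** x'')) ((y ** y') ** y'').
Proof.
by move=> E; rewrite /tassoc !tmul_tens tensDl tensNl -E.
Qed.

Lemma tassocDl M M' N P : tassoc (M + M') N P = tassoc M N P + tassoc M' N P.
Proof. by rewrite /tassoc !tmulDl opprD addrACA. Qed.
Lemma tassocDm M N N' P : tassoc M (N + N') P = tassoc M N P + tassoc M N' P.
Proof. by rewrite /tassoc !(tmulDl, tmulDr) opprD addrACA. Qed.
Lemma tassocDr M N P P' : tassoc M N (P + P') = tassoc M N P + tassoc M N P'.
Proof. by rewrite /tassoc !(tmulDl, tmulDr) opprD addrACA. Qed.
Lemma tassoc0l N P : tassoc 0 N P = 0.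
Proof. by rewrite /tassoc !tmul0l subrr. Qed.
Lemma tassoc0m M P : tassoc M 0 P = 0.
Proof. by rewrite /tassoc !(tmul0l, tmul0r) subrr. Qed.
Lemma tassoc0r M N : tassoc M N 0 = 0.
Proof. by rewrite /tassoc !tmul0r subrr. Qed.
Lemma tassoc_suml I (r : seq I) (f : I -> T) N P :
  tassoc (\sum_(i <- r) f i) N P = \sum_(i <- r) tassoc (f i) N P.
Proof.
exact: (big_morph (fun M => tassoc M N P) (fun M M' => tassocDl M M' N P) (tassoc0l N P)).
Qed.
Lemma tassoc_summ I (r : seq I) (f : I -> T) M P :
  tassoc M (\sum_(i <- r) f i) P = \sum_(i <- r) tassoc M (f i) P.
Proof.
exact: (big_morph (fun N => tassoc M N P) (fun N N' => tassocDm M N N' P) (tassoc0m M P)).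
Qed.
Lemma tassoc_sumr I (r : seq I) (f : I -> T) M N :
  tassoc M N (\sum_(i <- r) f i) = \sum_(i <- r) tassoc M N (f i).
Proof. exact: (big_morph (tassoc M N) (tassocDr M N) (tassoc0r M N)). Qed.

(** The coefficient in [A] of [M] along the [j]-th basis vector of [B]; see [slice_sum]. *)
Definition slice (j : 'I_(\dim {:B})) (M : T) : A := \sum_i M i j *: bA`_i.

Lemma slice_linear j : linear (slice j).
Proof.
move=> a M N; rewrite /slice scaler_sumr -big_split; apply: eq_bigr => i _ /=.
by rewrite !mxE scalerDl scalerA.
Qed.

Lemma sliceD j M N : slice j (M + N) = slice j M + slice j N.
Proof. by have := slice_linear j 1 M N; rewrite !scale1r. Qed.
Lemma slice0 j : slice j 0 = 0.
Proof. by apply: (addrI (slice j 0)); rewrite -sliceD !addr0. Qed.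

Lemma slice_tens j x y : slice j (tens x y) = coord bB j y *: x.
Proof.
rewrite [in RHS](coord_vbasis (memvf x)) scaler_sumr; apply: eq_bigr => i _.
by rewrite mxE scalerA mulrC.
Qed.

Lemma slice_sum (M : T) : M = \sum_j tens (slice j M) bB`_j.
Proof.
rewrite [LHS]tens_sum exchange_big; apply: eq_bigr => j _ /=.
by rewrite tens_suml; apply: eq_bigr => i _; rewrite tensZl.
Qed.

Lemma slice_tmul j (M : T) x : slice j (tmul M (tens x oneB)) = slice j M ** x.
Proof.
move: M; apply: tens_ind => [|M N EM EN|z y].
- by rewrite tmul0l slice0 hmul0l.
- by rewrite tmulDl !sliceD hmulDl EM EN.
- by rewrite tmul_tens !slice_tens hmulx1 hmulZl.
Qed.

Lemma tens_eq0 x y : (tens x y == 0 :> T) = (x == 0) || (y == 0).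
Proof.
apply/idP/orP=> [/eqP E|[] /eqP->]; rewrite ?tens0l ?tens0r //.
have [_|y0] := eqVneq y 0; first by right.
left; have [j yj] : exists j, coord bB j y != 0.
  have [/existsP[j yj]|/existsPn H] := boolP [exists j, coord bB j y != 0]; first by exists j.
  case/eqP: y0; rewrite (coord_vbasis (memvf y)) big1 // => j _.
  by have := H j; rewrite negbK => /eqP->; rewrite scale0r.
have /eqP := slice_tens j x y; rewrite E slice0 eq_sym scaler_eq0 (negPf yj).
by [].
Qed.

Lemma tens_subl (x x' : A) (y : B) : tens (x - x') y = tens x y - tens x' y.
Proof. by rewrite tensDl tensNl. Qed.
Lemma tens_subr (x : A) (y y' : B) : tens x (y - y') = tens x y - tens x y'.
Proof. by rewrite tensDr tensNr. Qed.

Lemma tens_onel_inj : oneB != 0 -> injective (fun x : A => tens x oneB : T).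
Proof.
move=> o x x' /eqP; rewrite -subr_eq0 -tens_subl tens_eq0 (negPf o) orbF subr_eq0.
by move/eqP.
Qed.

Lemma tens_oner_inj : oneA != 0 -> injective (fun y : B => tens oneA y : T).
Proof.
move=> o y y' /eqP; rewrite -subr_eq0 -tens_subr tens_eq0 (negPf o) /= subr_eq0.
by move/eqP.
Qed.

End TensorLinear.

(** * The tensor factors are graded subspaces *)

Section Restriction.
Variables (F : fieldType) (A' A : invalg F) (ι : 'Hom(A', A)).
Hypothesis ι_inj : injective ι.
Hypothesis ιM : forall x y, ι (iamul x y) = iamul (ι x) (ι y).
Hypothesis ιC : forall x, ι (iaconj x) = iaconj (ι x).
Variables (Γ : gfamily A) (s : seq (ggroup Γ)) (p : ggroup Γ -> 'End(A)).
Hypothesis Γgrading : is_grading Γ.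
Hypothesis Γp : homogeneous_projections (V := A) Γ s p.

Definition restriction : gfamily A' := @GFamily F A' (ggroup Γ) (fun g => (ι @^-1: Γ g)%VS).

Hypothesis pι : forall g x, exists y, p g (ι x) = ι y.

(** [pι] says that the image of [ι] is a graded subspace, so the projections can be transported
    along [ι]. *)
Lemma restriction_grading : is_grading restriction.
Proof.
have [s_uniq pΓ pid psum] := Γp; have [_ _ mulΓ conjΓ] := Γgrading.
have ι_ker : lker ι == 0%VS by apply/lker0P.
pose q g : 'End(A') := (ι^-1 \o p g \o ι)%VF.
have qE g x : ι (q g x) = p g (ι x).
  rewrite !lfunE /= lfunE /=; have [y ->] := pι g x.
  by rewrite (lker0_lfunK ι_ker).
have H : homogeneous_projections (V := A') restriction s q.
  split=> // [g x|g h x|x].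
  - by rewrite -memv_preim qE.
  - rewrite -memv_preim => xh; apply: ι_inj; rewrite qE (pid _ _ _ xh).
    by case: eqP => //; rewrite linear0.
  - apply: ι_inj; rewrite linear_sum /= [LHS]psum.
    by apply: eq_bigr => g _; rewrite qE.
apply: (projections_grading H) => [g h x y|g x]; rewrite -!memv_preim.
  by rewrite ιM; apply: mulΓ.
by rewrite ιC; apply: conjΓ.
Qed.

End Restriction.

Definition hassoc (F : fieldType) (A : hurwitz F) (x y z : A) : A :=
  (x ** y) ** z - x ** (y ** z).

(** Moving the associator across the form shows that left nuclear elements are orthogonal to all
    associators. *)
Lemma hpolar_hassoc (F : fieldType) (A : hurwitz F) (x a b c : A) :
  hpolar (hassoc x a b) c = hpolar x (hassoc c b^! a^!).
Proof.
rewrite /hassoc hpolarDl hpolarDr hpolarNl hpolarNr; congr (_ - _).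
  by rewrite !hpolar_mulrr.
by rewrite hpolar_mulrr hconjM.
Qed.

Lemma htrace_hassoc (F : fieldType) (A : hurwitz F) (a b c : A) : htrace (hassoc a b c) = 0.
Proof.
by rewrite /htrace hpolar_hassoc /hassoc !hmul1x subrr hpolar0r.
Qed.

(** Trace zero elements are sums of associators, in the form of an induction principle. Scalars are
    absorbed by an argument of the associator. *)
Definition trace0_hassoc (F : fieldType) (A : hurwitz F) : Prop :=
  forall P : A -> Prop, P 0 -> (forall x y, P x -> P y -> P (x + y)) ->
  (forall x y z, P (hassoc x y z)) -> forall x, htrace x = 0 -> P x.

Section TensorFactors.
Variables (F : fieldType) (A B : hurwitz F).
Hypothesis char_neq2 : (2 : F) != 0.
Hypothesis oneA0 : hone A != 0.
Hypothesis oneB0 : hone B != 0.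
Hypothesis A_hassoc : trace0_hassoc A.
Hypothesis B_assoc : forall x y z : B, (x ** y) ** z = x ** (y ** z).
Local Notation T := (tensor A B).
Local Notation oneA := (hone A).
Local Notation oneB := (hone B).
Local Notation bB := (vbasis {:B}).

Lemma trace0_split (x : A) : exists y c, htrace y = 0 /\ x = y + c *: oneA.
Proof.
exists (x - (htrace x / 2) *: oneA), (htrace x / 2); rewrite subrK; split=> //.
by rewrite /htrace hpolarDl hpolarNl hpolarZl -!/(htrace _) htrace1 // divfK ?subrr.
Qed.

(** Such an [x] is orthogonal to all associators, hence to all trace zero elements; its own trace
    zero part is also orthogonal to 1 and so lies in the radical of the form. *)
Lemma left_nucleus (x : A) : (forall a b, hassoc x a b = 0) -> x \in <[oneA]>%VS.
Proof.
move=> nx; have perp z : htrace z = 0 -> hpolar x z = 0.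
  move: z; apply: (@A_hassoc (fun z => hpolar x z = 0)) => [|z1 z2 E1 E2|a b c].
    by rewrite hpolar0r.
    by rewrite hpolarDr E1 E2 addr0.
  by have := hpolar_hassoc x c^! b^! a; rewrite !hconjK nx hpolar0l.
have [y [c [ty xE]]] := trace0_split x.
suff y0 : y = 0 by rewrite xE y0 add0r memvZ // memv_line.
apply: hpolarP => w; rewrite hpolar0l; have [z [d [tz ->]]] := trace0_split w.
rewrite hpolarDr hpolarZr -/(htrace y) ty mulr0 addr0.
have := perp z tz; rewrite xE hpolarDl hpolarZl (hpolarC oneA) -/(htrace z) tz.
by rewrite mulr0 addr0.
Qed.

Lemma slice_trace_tassoc j (M N P : T) : htrace (slice j (tassoc M N P)) = 0.
Proof.
have tD z z' : htrace (z + z') = htrace z + htrace z' :> F by rewrite /htrace hpolarDl.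
have t0 : htrace (0 : A) = 0 by rewrite /htrace hpolar0l.
move: M; apply: tens_ind => [|M M' E E'|x y].
- by rewrite tassoc0l slice0.
- by rewrite tassocDl sliceD tD E E' addr0.
move: N; apply: tens_ind => [|N N' E E'|x' y'].
- by rewrite tassoc0m slice0.
- by rewrite tassocDm sliceD tD E E' addr0.
move: P; apply: tens_ind => [|P P' E E'|x'' y''].
- by rewrite tassoc0r slice0.
- by rewrite tassocDr sliceD tD E E' addr0.
by rewrite tassoc_tens // slice_tens /htrace hpolarZl -/(htrace _) htrace_hassoc mulr0.
Qed.

Variables (Γ : gfamily T) (s : seq (ggroup Γ)) (p : ggroup Γ -> 'End(T)).
Hypothesis Γgrading : is_grading Γ.
Hypothesis Γp : homogeneous_projections (V := T) Γ s p.

Let pM_l g h (M N : T) : M \in Γ h -> p (h + g) (tmul M N) = tmul M (p g N).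
Proof. exact: (projection_mull (@tensor_mul_bilinear F A B) Γp Γgrading). Qed.

Let pM_r g h (M N : T) : M \in Γ h -> p (g + h) (tmul N M) = tmul (p g N) M.
Proof. exact: (projection_mulr (@tensor_mul_bilinear F A B) Γp Γgrading). Qed.

Let pmem g (M : T) : p g M \in Γ g. Proof. by case: Γp. Qed.
Let psum (M : T) : M = \sum_(g <- s) p g M. Proof. by case: Γp. Qed.
Let Γmul g h (M N : T) : M \in Γ g -> N \in Γ h -> tmul M N \in Γ (g + h).
Proof. by case: Γgrading => _ _ H _; apply: H. Qed.

Let p_tassoc_l g h k (M N P : T) : N \in Γ h -> P \in Γ k ->
  p (g + h + k) (tassoc M N P) = tassoc (p g M) N P.
Proof.
move=> Nh Pk; rewrite /tassoc linearB /= pM_r // pM_r //.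
by rewrite -addrA pM_r //; apply: Γmul.
Qed.

Let p_tassoc_r g h k (M N P : T) : M \in Γ h -> N \in Γ k ->
  p (h + k + g) (tassoc M N P) = tassoc M N (p g P).
Proof.
move=> Mh Nk; rewrite /tassoc linearB /= pM_l ?Γmul //.
by rewrite -addrA pM_l // pM_l.
Qed.

Lemma projection_oner g (y : B) : exists z, p g (tens oneA y) = tens oneA z.
Proof.
set M := p g _.
(* A component of a left nuclear element is left nuclear: its associator with homogeneous [N], [P]
   is a component of 0. *)
have nM (N P : T) : tassoc M N P = 0.
  rewrite [N]psum tassoc_summ big1 // => h _; rewrite [P]psum tassoc_sumr big1 // => k _.
  rewrite /M -(p_tassoc_l _ _ (pmem h N) (pmem k P)).
  suff -> : tassoc (tens oneA y) (p h N) (p k P) = 0 by rewrite linear0.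
  move: (p h N) (p k P) => {}N {}P.
  move: N; apply: tens_ind => [|N N' E E'|x' y'].
  - by rewrite tassoc0m.
  - by rewrite tassocDm E E' addr0.
  move: P; apply: tens_ind => [|P P' E E'|x'' y''].
  - by rewrite tassoc0r.
  - by rewrite tassocDr E E' addr0.
  by rewrite tassoc_tens // !hmul1x subrr tens0l.
(* Testing against a ⊗ 1 and b ⊗ 1 puts each slice of [M] in the left nucleus of [A]. *)
have sl j : exists c, slice j M = c *: oneA.
  apply/vlineP; apply: left_nucleus => a b; rewrite /hassoc.
  have := congr1 (slice j) (nM (tens a oneB) (tens b oneB)).
  rewrite slice0 /tassoc -scaleN1r.
  have sZ c N : slice j (c *: N) = c *: slice j N.
    by have := slice_linear j c N 0; rewrite slice0 !addr0.
  by rewrite sliceD sZ tmul_tens hmulx1 !slice_tmul scaleN1r.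
suff [z E] : exists z, \sum_j tens (slice j M) bB`_j = tens oneA z.
  by exists z; rewrite -E; apply: slice_sum.
elim/big_ind: _ => [|_ _ [z1 ->] [z2 ->]|j _]; first by exists 0; rewrite tens0r.
  by exists (z1 + z2); rewrite tensDr.
by have [c ->] := sl j; exists (c *: bB`_j); rewrite tensZl tensZr.
Qed.

(** The slices are skew, so [M - tensor_conj M] is the sum of slice_j ⊗ (b_j + b_j^!), where b_j +
    b_j^! is the scalar t(b_j). On a skew [M] the left side is 2 M. *)
Lemma tens_trace0 (M : T) : (forall j, htrace (slice j M) = 0) ->
  tensor_conj M = - M -> exists y, M = tens y oneB.
Proof.
move=> tM cM; pose y := \sum_(j < \dim {:B}) htrace (bB`_j : B) *: slice j M.
have E : M - tensor_conj M = tens y oneB.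
  have [φ φE] := linfun_exists (@tensor_conj_linear F A B).
  rewrite [in LHS](slice_sum M) -φE linear_sum -sumrB tens_suml.
  apply: eq_bigr => j _; rewrite /= φE tensor_conj_tens -!hbarE hconj_trace0 //.
  rewrite tensNl opprK -tensDr -htrace_scale1.
  by rewrite tensZr tensZl.
exists (2^-1 *: y); by rewrite tensZl -E cM opprK; lmod_field.
Qed.

Lemma projection_onel g (x : A) : exists z, p g (tens x oneB) = tens z oneB.
Proof.
have addP (x1 x2 : A) : (exists z, p g (tens x1 oneB) = tens z oneB) ->
    (exists z, p g (tens x2 oneB) = tens z oneB) ->
    exists z, p g (tens (x1 + x2) oneB) = tens z oneB.
  by move=> [z1 E1] [z2 E2]; exists (z1 + z2); rewrite !tensDl linearD /= E1 E2.
have [y [c [ty ->]]] := trace0_split x.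
(* The multiple of 1 comes first: 1 ⊗ 1 is homogeneous of degree 0. *)
apply: addP; last first.
  have [_ _ pid _] := Γp; have [ul ur] := tensor_unit A B.
  have := unit_neutral (@tensor_mul_bilinear F A B) Γp Γgrading ul ur => one0.
  rewrite tensZl linearZ /= (pid _ _ _ one0); case: eqP => _.
    by exists (c *: oneA); rewrite tensZl.
  by exists 0; rewrite scaler0 tens0l.
suff [tr cj] : (forall j, htrace (slice j (p g (tens y oneB))) = 0) /\
    tensor_conj (p g (tens y oneB)) = - p g (tens y oneB).
  exact: tens_trace0.
split=> [j|]; last first.
  have := projection_conj Γp Γgrading g (tens y oneB) (@tensor_conj_linear F A B).
  rewrite /= => <-; rewrite tensor_conj_tens -!hbarE hconj1 (hconj_trace0 ty).
  by rewrite tensNl linearN.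
have sl0 : slice j (0 : T) = 0 := slice0 _ _.
move: y ty; apply: (@A_hassoc (fun y => htrace (slice j (p g (tens y oneB))) = 0)).
- by rewrite tens0l linear0 sl0 /htrace hpolar0l.
- by move=> y z Ey Ez; rewrite tensDl linearD /= sliceD /htrace hpolarDl -!/(htrace _) Ey Ez addr0.
move=> a b c'; have -> : tens (hassoc a b c') oneB =
    tassoc (tens a oneB : T) (tens b oneB) (tens c' oneB).
  by rewrite tassoc_tens ?hmul1x.
have sumE I (r : seq I) (f : I -> T) : (forall i, htrace (slice j (f i)) = 0) ->
    htrace (slice j (\sum_(i <- r) f i)) = 0.
  move=> f0; elim/big_ind: _ => [|M N EM EN|//]; first by rewrite sl0 /htrace hpolar0l.
  by rewrite sliceD /htrace hpolarDl -!/(htrace _) EM EN addr0.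
(* Once the first two entries are split into homogeneous parts, a projection of the associator is a
   sum of associators with projected third entry, whose slices have trace 0. *)
rewrite [tens a oneB]psum tassoc_suml linear_sum; apply: (sumE) => h.
rewrite [tens b oneB]psum tassoc_summ linear_sum; apply: (sumE) => k.
have {1}-> : g = h + k + (g - (h + k)) by rewrite addrC subrK.
by rewrite /= p_tassoc_r //; apply: slice_trace_tassoc.
Qed.

Lemma tens_onel_hom : {ι : 'Hom(A, T) | forall x, ι x = tens x oneB}.
Proof. exact: linfun_exists (tens_linearl _). Qed.

Lemma tens_oner_hom : {ι : 'Hom(B, T) | forall y, ι y = tens oneA y}.
Proof. exact: linfun_exists (tens_linearr _). Qed.

End TensorFactors.

Definition hgfamily (F : fieldType) (A : hurwitz F) (G : zmodType) (Γ : G -> {vspace A}) :=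
  @GFamily F (hurwitz_invalg A) G Γ.
Definition hgrading (F : fieldType) (A : hurwitz F) (G : zmodType)
  (Γ : G -> {vspace A}) : Prop := is_grading (hgfamily Γ).

Lemma tensor_factors (F : fieldType) (A B : hurwitz F) (Γ : gfamily (tensor A B)) :
  (2 : F) != 0 -> hone A != 0 -> hone B != 0 -> trace0_hassoc A ->
  (forall x y z : B, (x ** y) ** z = x ** (y ** z)) -> is_grading Γ ->
  exists (ΓA : ggroup Γ -> {vspace A}) (ΓB : ggroup Γ -> {vspace B}),
  [/\ hgrading ΓA, hgrading ΓB,
      forall g x, (x \in ΓA g) = (tens x (hone B) \in Γ g)
    & forall g y, (y \in ΓB g) = (tens (hone A) y \in Γ g)].
Proof.
move=> char2 oneA oneB assocA assocB Γgrading.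
have [s [p Γp]] := grading_projections Γgrading.
have [ιA ιAE] := tens_onel_hom A B; have [ιB ιBE] := tens_oner_hom A B.
exists (fun g => ιA @^-1: Γ g)%VS, (fun g => ιB @^-1: Γ g)%VS; split.
- apply: (restriction_grading (A' := hurwitz_invalg A) (ι := ιA) _ _ _ Γgrading Γp).
  + by move=> x y; rewrite !ιAE; apply: tens_onel_inj.
  + by move=> x y; rewrite !ιAE /= tensor_mul_tens hmulx1.
  + by move=> x; rewrite !ιAE /= tensor_conj_tens -!hbarE hconj1.
  + move=> g x; have [y E] := projection_onel char2 oneA assocA assocB Γgrading Γp g x.
    by exists y; rewrite !ιAE.
- apply: (restriction_grading (A' := hurwitz_invalg B) (ι := ιB) _ _ _ Γgrading Γp).
  + by move=> x y; rewrite !ιBE; apply: tens_oner_inj.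
  + by move=> x y; rewrite !ιBE /= tensor_mul_tens hmulx1.
  + by move=> x; rewrite !ιBE /= tensor_conj_tens -!hbarE hconj1.
  + move=> g x; have [y E] := projection_oner char2 oneA assocA assocB Γgrading Γp g x.
    by exists y; rewrite !ιBE.
- by move=> g x; rewrite -memv_preim ιAE.
- by move=> g x; rewrite -memv_preim ιBE.
Qed.

(** * Tensor products of gradings and of automorphisms *)

Section TensorGrading.
Variables (F : fieldType) (A B : hurwitz F).
Local Notation T := (tensor A B).
Variables (G H : zmodType) (ΓA : G -> {vspace A}) (ΓB : H -> {vspace B}).

Lemma tensor_projections s p r q :
  homogeneous_projections ΓA s p -> homogeneous_projections ΓB r q ->
  exists P : G * H -> 'End(T),
    homogeneous_projections (V := T) (tensor_gfamily ΓA ΓB)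
      [seq (g, h) | g <- s, h <- r] P /\
    forall gh x y, P gh (tens x y) = tens (p gh.1 x) (q gh.2 y).
Proof.
move=> [s_uniq pΓ pid psum] [r_uniq qΓ qid qsum].
have sumE x y : tens x y =
    \sum_(gh <- [seq (g, h) | g <- s, h <- r]) tens (p gh.1 x) (q gh.2 y) :> T.
  rewrite big_allpairs {1}[x]psum tens_suml; apply: eq_bigr => g _.
  by rewrite {1}[y]qsum tens_sumr.
suff [P PE] : exists P : G * H -> 'End(T),
    forall gh x y, P gh (tens x y) = tens (p gh.1 x) (q gh.2 y).
  exists P; split=> //; split=> [|[g h] M|[g h] [g' h'] M|M].
  - by apply: allpairs_uniq => // [[a b] [c d]].
  - move: M; apply: tens_ind => [|M N Mg Ng|x y].
    + by rewrite linear0 mem0v.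
    + by rewrite linearD rpredD.
    + by rewrite PE; apply: tens_mem.
  - case: eqP => [[-> ->]|ne] Mgh.
      apply/eqP; rewrite -subr_eq0 -[M in X in _ - X]id_lfunE -opp_lfunE -add_lfunE.
      move: Mgh; rewrite -memv_ker; apply: subvP; apply: tensor_space_sub => x y xg yh.
      rewrite memv_ker add_lfunE opp_lfunE id_lfunE PE (pid _ _ _ xg) (qid _ _ _ yh).
      by rewrite !eqxx subrr.
    apply/eqP; move: Mgh; rewrite -memv_ker; apply: subvP; apply: tensor_space_sub.
    move=> x y xg yh; rewrite memv_ker PE (pid _ _ _ xg) (qid _ _ _ yh) /=.
    have [gg|_] := eqVneq g g'; last by rewrite tens0l.
    have [hh|_] := eqVneq h h'; last by rewrite tens0r.
    by case: ne; rewrite gg hh.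
  - move: M; apply: tens_ind => [|M N EM EN|x y].
    + by rewrite big1 // => gh _; rewrite linear0.
    + rewrite {1}EM {1}EN -big_split; apply: eq_bigr => gh _.
      by rewrite linearD.
    + by rewrite {1}sumE; apply: eq_bigr => gh _; rewrite PE.
exists (fun gh => sval (tensor_maps (p gh.1) (q gh.2))) => gh x y.
exact: (svalP (tensor_maps (p gh.1) (q gh.2))).
Qed.

Lemma tensor_grading : hgrading ΓA -> hgrading ΓB -> is_grading (tensor_gfamily ΓA ΓB).
Proof.
move=> gA gB; have [s [p Hp]] := grading_projections gA.
have [r [q Hq]] := grading_projections gB.
have [P [HP PE]] := tensor_projections Hp Hq.
apply: (projections_grading HP) => [[g h] [g' h'] M N Mg Ng|[g h] M Mg] /=.
  have [R RE] := linfun_exists (proj1 (@tensor_mul_bilinear F A B) N).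
  rewrite (_ : tensor_mul M N = R M); last by rewrite RE.
  rewrite memv_preim; move: Mg; apply: subvP; apply: tensor_space_sub => x y xg yh.
  rewrite -memv_preim RE.
  have [L LE] := linfun_exists (proj2 (@tensor_mul_bilinear F A B) (tens x y)).
  rewrite (_ : iamul (tens x y : T) N = L N); last by rewrite LE.
  rewrite memv_preim; move: Ng; apply: subvP; apply: tensor_space_sub => x' y' xg' yh'.
  rewrite -memv_preim LE /= tensor_mul_tens; apply: tens_mem => /=.
    by case: gA => _ _ mulΓ _; apply: (mulΓ g g').
  by case: gB => _ _ mulΓ _; apply: (mulΓ h h').
have [L LE] := linfun_exists (@tensor_conj_linear F A B).
rewrite (_ : tensor_conj M = L M); last by rewrite LE.
rewrite memv_preim; move: Mg; apply: subvP; apply: tensor_space_sub => x y xg yh.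
rewrite -memv_preim LE /= tensor_conj_tens; apply: tens_mem => /=.
  by case: gA => _ _ _ conjΓ; apply: (conjΓ g).
by case: gB => _ _ _ conjΓ; apply: (conjΓ h).
Qed.

Lemma tensor_space_eq0 (U : {vspace A}) (V : {vspace B}) :
  (tensor_space U V == 0%VS) = (U == 0%VS) || (V == 0%VS).
Proof.
apply/eqP/orP => [E|UV0]; last first.
  apply/eqP; rewrite -subv0; apply: tensor_space_sub => x y xU yV; rewrite memv0 tens_eq0.
  by case: UV0 => /eqP E0; move: xU yV; rewrite E0 memv0 => a b; rewrite ?a ?b ?orbT.
have [U0|U0] := boolP (U == 0%VS); [by left|right].
rewrite -vpick0 in U0 *; rewrite -subv0; apply/subvP => y yV; rewrite memv0.
have := tens_mem (memv_pick U) yV; rewrite E memv0 tens_eq0.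
by rewrite (negPf U0).
Qed.

Lemma tensor_automorphism (φ : 'End(A)) (ψ : 'End(B)) :
  @is_automorphism F (hurwitz_invalg A) φ -> @is_automorphism F (hurwitz_invalg B) ψ ->
  exists2 Φ : 'End(T), is_automorphism Φ & forall x y, Φ (tens x y) = tens (φ x) (ψ y).
Proof.
move=> [[φ' φK φ'K] φM φC] [[ψ' ψK ψ'K] ψM ψC].
have [Φ ΦE] := tensor_maps φ ψ.
have φker : lker φ == 0%VS by apply/lker0P/(can_inj φK).
have ψker : lker ψ == 0%VS by apply/lker0P/(can_inj ψK).
have [Ψ ΨE] := tensor_maps (φ^-1)%VF (ψ^-1)%VF.
exists Φ => //; split.
- exists Ψ; apply: tens_ind => [|M N EM EN|x y].
  + by rewrite !linear0.
  + by rewrite !linearD /= EM EN.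
  + by rewrite ΦE ΨE (lker0_lfunK φker) (lker0_lfunK ψker).
  + by rewrite !linear0.
  + by rewrite !linearD /= EM EN.
  + by rewrite ΨE ΦE (lker0_lfunVK φker) (lker0_lfunVK ψker).
- move=> M N; rewrite /= -!/(tmul _ _).
  move: M; apply: tens_ind => [|M M' E E'|x y].
  + by rewrite tmul0l linear0 tmul0l.
  + by rewrite linearD !tmulDl linearD /= E E'.
  move: N; apply: tens_ind => [|N N' E E'|x' y'].
  + by rewrite tmul0r linear0 tmul0r.
  + by rewrite linearD !tmulDr linearD /= E E'.
  by rewrite !ΦE !tmul_tens ΦE -[φ (x ** x')]/(φ (iamul (x : hurwitz_invalg A) x'))
    -[ψ (y ** y')]/(ψ (iamul (y : hurwitz_invalg B) y')) φM ψM.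
- have [L LE] := linfun_exists (@tensor_conj_linear F A B).
  move=> M; rewrite /= -!LE.
  move: M; apply: tens_ind => [|M N EM EN|x y].
  + by rewrite !linear0.
  + by rewrite !linearD /= EM EN.
  + rewrite !LE ΦE !tensor_conj_tens ΦE; congr (tens _ _); [exact: φC|exact: ψC].
Qed.

End TensorGrading.

Lemma image_grading (F : fieldType) (A : invalg F) (φ : 'End(A)) (Γ : gfamily A) :
  is_automorphism φ -> is_grading Γ -> is_grading (GFamily (fun g => φ @: Γ g)%VS).
Proof.
move=> [[φ' φK φ'K] φM φC] Γgrading; have [s [p Γp]] := grading_projections Γgrading.
have [s_uniq pΓ pid psum] := Γp; have [_ _ mulΓ conjΓ] := Γgrading.
have φker : lker φ == 0%VS by apply/lker0P/(can_inj φK).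
have H : homogeneous_projections (V := A) (fun g => φ @: Γ g)%VS s
    (fun g => φ \o p g \o φ^-1)%VF.
  split=> // [g x|g h x /memv_imgP[y yh ->]|x].
  - by rewrite !comp_lfunE memv_img.
  - rewrite !comp_lfunE (lker0_lfunK φker) (pid _ _ _ yh).
    by case: eqP => // _; rewrite linear0.
  - rewrite -[LHS](lker0_lfunVK φker) [X in φ X]psum linear_sum.
    by apply: eq_bigr => g _; rewrite !comp_lfunE.
apply: (projections_grading (Γ := @GFamily F A (ggroup Γ) (fun g => φ @: Γ g)%VS) H)
  => [g h x y|g x].
  case/memv_imgP=> x' xg ->; case/memv_imgP=> y' yh ->.
  by rewrite -φM memv_img //; apply: mulΓ.
by case/memv_imgP=> x' xg ->; rewrite -φC memv_img //; apply: conjΓ.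
Qed.

(** * Fine gradings of a tensor product *)

Definition is_support (F : fieldType) (V : vectType F) (G : zmodType)
    (Γ : G -> {vspace V}) (s : seq G) : Prop :=
  uniq s /\ forall g, (g \in s) = (Γ g != 0%VS).

Lemma equivalent_support_size (F : fieldType) (A : invalg F) (Γ Δ : gfamily A) s r :
  is_support (V := A) Γ s -> is_support (V := A) Δ r -> equivalent Γ Δ -> size s = size r.
Proof.
move=> [s_uniq sE] [r_uniq rE] [φ [α [_ αΔ αinj αsurj _]]].
rewrite -(size_map α s); apply: perm_size; apply: uniq_perm => // [|h].
  rewrite map_inj_in_uniq // => g g' gs g's; apply: αinj; rewrite inE -?sE //.
apply/mapP/idP => [[g gs ->]|hr].
  by have := αΔ g; rewrite !inE -sE -rE; apply.
by have [|g gΓ <-] := αsurj h; [rewrite inE -rE|exists g; rewrite // sE].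
Qed.

(* Fineness without supports: in this form it passes from the factors to their
   tensor product, where the refinement restricts to each factor. *)
Definition unsplittable (F : fieldType) (A : hurwitz F) (G : zmodType)
    (Γ : G -> {vspace A}) : Prop :=
  forall Δ : gfamily (hurwitz_invalg A), is_grading Δ ->
  (forall h, exists g, ((Δ h : {vspace A}) <= Γ g)%VS) ->
  forall g, exists k, (Γ g <= (Δ k : {vspace A}))%VS.

Section RestrictRefinement.
Variables (F : fieldType) (A B : hurwitz F) (G H : zmodType).
Local Notation T := (tensor A B).
Variables (ΓA : G -> {vspace A}) (ΓB : H -> {vspace B}).
Hypothesis gA : hgrading ΓA.
Hypothesis gB : hgrading ΓB.
Variable Δ : gfamily T.
Hypothesis ref : refines Δ (tensor_gfamily ΓA ΓB).

Let supp_intro k (M : T) : M \in Δ k -> M != 0 -> k \in gsupport (Γ := Δ).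
Proof.
by move=> Mk; apply: contraNN => /eqP k0; rewrite -memv0 -k0.
Qed.

(** Since 1 has degree 0 in [B], a nonzero x ⊗ 1 can lie in the component of degree [(g, h)] only if
    [h = 0], and then [x] lies in [ΓA g]. *)
Lemma refines_left (ΔA : ggroup Δ -> {vspace A}) : hone B != 0 ->
  (forall k x, (x \in ΔA k) = (tens x (hone B) \in Δ k)) ->
  forall k, exists g, (ΔA k <= ΓA g)%VS.
Proof.
move=> oneB ΔAE k; have [s [p Hp]] := grading_projections gA.
have [r [q Hq]] := grading_projections gB.
have [P [HP PE]] := tensor_projections Hp Hq.
have one0 : hone B \in ΓB 0 by exact: (graded_one gB Hq).
have [_ pΓ pid psum] := Hp; have [_ _ qid _] := Hq; have [_ _ Pid _] := HP.
have [k0|k0] := eqVneq (ΔA k) 0%VS; first by exists 0; rewrite k0 sub0v.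
have xk := memv_pick (ΔA k); set x := vpick (ΔA k) in xk.
have x0 : x != 0 by rewrite vpick0.
have [|[g h] _ sub] := @ref k.
  by apply: (supp_intro (M := tens x (hone B))); rewrite -?ΔAE // tens_eq0 (negPf x0).
(* Both sides are the projection of y ⊗ 1 to degree [(g', 0)]. *)
have key y g' : y \in ΔA k ->
    tens (p g' y) (hone B) = if (g', 0) == (g, h) then tens y (hone B) else 0 :> T.
  rewrite ΔAE => /(subvP sub) yk.
  by rewrite -(Pid (g', 0) (g, h) _ yk) PE /= (qid _ _ _ one0) eqxx.
have h0 : h = 0.
  apply/eqP; apply: contraNT x0 => h0; rewrite [x]psum big1 // => g' _.
  have /eqP := key x g' xk; rewrite xpair_eqE (eq_sym 0) (negPf h0) andbF tens_eq0.
  by rewrite (negPf oneB) orbF => /eqP.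
exists g; apply/subvP => y yk; have := key y g yk; rewrite h0 eqxx => /eqP.
rewrite -subr_eq0 -tens_subl tens_eq0 (negPf oneB) orbF subr_eq0 => /eqP <-.
exact: pΓ.
Qed.

Lemma refines_right (ΔB : ggroup Δ -> {vspace B}) : hone A != 0 ->
  (forall k y, (y \in ΔB k) = (tens (hone A) y \in Δ k)) ->
  forall k, exists h, (ΔB k <= ΓB h)%VS.
Proof.
move=> oneA ΔBE k; have [s [p Hp]] := grading_projections gA.
have [r [q Hq]] := grading_projections gB.
have [P [HP PE]] := tensor_projections Hp Hq.
have one0 : hone A \in ΓA 0 by exact: (graded_one gA Hp).
have [_ _ pid _] := Hp; have [_ qΓ qid qsum] := Hq; have [_ _ Pid _] := HP.
have [k0|k0] := eqVneq (ΔB k) 0%VS; first by exists 0; rewrite k0 sub0v.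
have xk := memv_pick (ΔB k); set x := vpick (ΔB k) in xk.
have x0 : x != 0 by rewrite vpick0.
have [|[g h] _ sub] := @ref k.
  by apply: (supp_intro (M := tens (hone A) x)); rewrite -?ΔBE // tens_eq0 (negPf x0) orbF.
have key y h' : y \in ΔB k ->
    tens (hone A) (q h' y) = if (0, h') == (g, h) then tens (hone A) y else 0 :> T.
  rewrite ΔBE => /(subvP sub) yk.
  by rewrite -(Pid (0, h') (g, h) _ yk) PE /= (pid _ _ _ one0) eqxx.
have g0 : g = 0.
  apply/eqP; apply: contraNT x0 => g0; rewrite [x]qsum big1 // => h' _.
  have /eqP := key x h' xk; rewrite xpair_eqE (eq_sym 0) (negPf g0) tens_eq0.
  by rewrite (negPf oneA) => /eqP.
exists h; apply/subvP => y yk; have := key y h yk; rewrite g0 eqxx => /eqP.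
rewrite -subr_eq0 -tens_subr tens_eq0 (negPf oneA) subr_eq0 => /eqP <-.
exact: qΓ.
Qed.

End RestrictRefinement.

Lemma limg_sub_preim (F : fieldType) (V W : vectType F) (f : 'Hom(V, W))
    (U : {vspace V}) (U' : {vspace W}) :
  (forall x, x \in U -> f x \in U') -> (f @: U <= U')%VS.
Proof. by move=> UU'; apply/subvP => _ /memv_imgP[x xU ->]; apply: UU'. Qed.

Section FineTensor.
Variables (F : fieldType) (A B : hurwitz F) (I J : Type).
Hypothesis char_neq2 : (2 : F) != 0.
Hypothesis oneA : hone A != 0.
Hypothesis oneB : hone B != 0.
Hypothesis A_hassoc : trace0_hassoc A.
Hypothesis B_assoc : forall x y z : B, (x ** y) ** z = x ** (y ** z).
Variables (GA : I -> zmodType) (LA : forall i, GA i -> {vspace A}) (sA : forall i, seq (GA i)).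
Variables (GB : J -> zmodType) (LB : forall j, GB j -> {vspace B}) (sB : forall j, seq (GB j)).
Hypothesis gA : forall i, hgrading (LA (i := i)).
Hypothesis gB : forall j, hgrading (LB (j := j)).
Hypothesis uA : forall i, unsplittable (LA (i := i)).
Hypothesis uB : forall j, unsplittable (LB (j := j)).
Hypothesis suppA : forall i, is_support (LA (i := i)) (sA i).
Hypothesis suppB : forall j, is_support (LB (j := j)) (sB j).
Hypothesis classA : forall Γ : gfamily (hurwitz_invalg A), is_grading Γ ->
  exists i (φ : 'End(A)), @is_automorphism F (hurwitz_invalg A) φ /\ carries φ (LA (i := i)) Γ.
Hypothesis classB : forall Γ : gfamily (hurwitz_invalg B), is_grading Γ ->
  exists j (ψ : 'End(B)), @is_automorphism F (hurwitz_invalg B) ψ /\ carries ψ (LB (j := j)) Γ.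
Local Notation T := (tensor A B).

Definition product_grading i j : gfamily T := tensor_gfamily (LA (i := i)) (LB (j := j)).

(** x ⊗ y is the product of x ⊗ 1 and 1 ⊗ y. *)
Let factor_mul (Γ : gfamily T) (ΓA : ggroup Γ -> {vspace A}) (ΓB : ggroup Γ -> {vspace B}) :
  is_grading Γ ->
  (forall g x, (x \in ΓA g) = (tens x (hone B) \in Γ g)) ->
  (forall g y, (y \in ΓB g) = (tens (hone A) y \in Γ g)) ->
  forall g h x y, x \in ΓA g -> y \in ΓB h -> tens x y \in Γ (g + h).
Proof.
move=> [_ _ mulΓ _] EA EB g h x y; rewrite EA EB => xg yh.
by have := mulΓ _ _ _ _ xg yh; rewrite /= tensor_mul_tens hmulx1 hmul1x.
Qed.

Lemma product_grading_fine i j : fine (product_grading i j).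
Proof.
split=> [|Δ Δgrading [ref [h [g [h_supp hg /eqP ne]]]]]; first exact: tensor_grading.
have [ΔA [ΔB [gΔA gΔB EA EB]]] :=
  tensor_factors char_neq2 oneA oneB A_hassoc B_assoc Δgrading.
have refA := refines_left (gA i) (gB j) ref oneB EA.
have refB := refines_right (gA i) (gB j) ref oneA EB.
(* The whole component [g] then lies in [Δ (k + l)]; it contains [Δ h], so [h = k + l] and the
   inclusion cannot be strict. *)
have [k kA] := uA gΔA refA g.1; have [l lB] := uB gΔB refB g.2.
have sub : (product_grading i j g <= Δ (k + l)%R)%VS.
  apply: tensor_space_sub => x y /(subvP kA) xk /(subvP lB) yl.
  exact: (factor_mul Δgrading EA EB xk yl).
have [s [p Hp]] := grading_projections Δgrading.
apply: ne; apply/eqP; rewrite eqEsubv hg /=.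
suff -> : h = k + l by [].
apply: (projections_disjoint Hp (x := vpick (Δ h))); rewrite ?vpick0 ?memv_pick //.
by apply: (subvP sub); apply: (subvP hg); apply: memv_pick.
Qed.

Lemma product_support i j :
  is_support (V := T) (product_grading i j) [seq (g, h) | g <- sA i, h <- sB j].
Proof.
have [sA_uniq sAE] := suppA i; have [sB_uniq sBE] := suppB j.
split=> [|[g h]]; first by apply: allpairs_uniq => // [[a b] [c d]].
rewrite /= tensor_space_eq0 negb_or -sAE -sBE.
apply/allpairsP/andP => [[[a b] /= [ag bh [-> ->]]]|[gs hs]] //.
by exists (g, h).
Qed.

Lemma fine_product_grading (Γ : gfamily T) : fine Γ ->
  exists i j, equivalent Γ (product_grading i j).
Proof.
move=> [Γgrading Γfine]; have [s [p Γp]] := grading_projections Γgrading.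
have [ΓA [ΓB [gΓA gΓB EA EB]]] :=
  tensor_factors char_neq2 oneA oneB A_hassoc B_assoc Γgrading.
have [i [φ [Hφ carA]]] := classA gΓA; have [j [ψ [Hψ carB]]] := classB gΓB.
exists i, j; have [Φ HΦ ΦE] := tensor_automorphism Hφ Hψ.
have [[Φ' ΦK Φ'K] ΦM ΦC] := HΦ; have Φinj := can_inj ΦK.
have Φker : lker Φ == 0%VS by apply/lker0P.
pose L := product_grading i j.
pose Δ := @GFamily F T (ggroup L) (fun g => Φ @: L g)%VS.
have Lgrading : is_grading L by apply: tensor_grading.
have Δgrading : is_grading Δ by apply: image_grading.
have [r [q Δq]] := grading_projections Δgrading.
have Δ0 h : (Δ h != 0%VS) = (L h != 0%VS).
  congr (~~ _); apply/eqP/eqP => /= [E|->]; last by rewrite limg0.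
  by apply/eqP; rewrite -subv0 -(limg_ker0 _ _ Φker) limg0 E.
have sub h : exists k, (Δ h <= Γ k)%VS.
  have [k kA] := carA h.1; have [l lB] := carB h.2.
  exists (k + l); apply: limg_sub_preim => M; rewrite memv_preim.
  apply: subvP; apply: tensor_space_sub => x y xg yh; rewrite -memv_preim ΦE.
  apply: (factor_mul Γgrading EA EB); first by apply: (subvP kA); apply: memv_img.
  by apply: (subvP lB); apply: memv_img.
have ref : refines Δ Γ.
  move=> h h_supp; have [k hk] := sub h; exists k => //.
  by apply: contraNN h_supp => /eqP k0; rewrite -subv0 -k0.
(* Here the fineness of [Γ] enters: a strict inclusion would make [Δ] a proper refinement. *)
have same h k : L h != 0%VS -> (Δ h <= Γ k)%VS -> Δ h = Γ k.
  move=> h0 hk; apply/eqP; apply: contraT => ne.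
  by case: (Γfine _ Δgrading); split=> //; exists h, k; split=> //; rewrite inE Δ0.
have [sL_uniq sLE] := product_support i j; set sL := [seq _ | _ <- _, _ <- _] in sL_uniq sLE.
(* Some [Δ]-component of a nonzero vector of [Γ k] still projects nontrivially to [Γ k]; as its
   [Δ h] lies in a single component of [Γ], that one is [Γ k]. *)
have hit k : Γ k != 0%VS -> has (fun h => Δ h == Γ k) sL.
  rewrite -vpick0 => x0; have xk := memv_pick (Γ k); set x := vpick (Γ k) in x0 xk.
  have [_ pΓ pid _] := Γp; have [_ qΔ _ qsum] := Δq.
  have : p k x != 0 by rewrite (pid _ _ _ xk) eqxx.
  rewrite {1}[x]qsum linear_sum => sum0.
  have [h Bh] : exists h, p k (q h x) != 0.
    have [/hasP[h _ fh]|/hasPn all0] := boolP (has (fun h => p k (q h x) != 0) r).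
      by exists h.
    by case/eqP: sum0; rewrite big_seq big1 // => h /all0; rewrite negbK => /eqP.
  have qh : q h x \in Δ h by [].
  have h0 : L h != 0%VS.
    rewrite -Δ0; apply: contraNneq Bh => E; move: qh; rewrite E memv0 => /eqP->.
    by rewrite linear0.
  have [k' hk'] := sub h; have kk' : k = k'.
    apply/eqP; apply: contraNT Bh => kk'.
    by rewrite (pid _ _ _ (subvP hk' _ qh)) (negPf kk').
  by apply/hasP; exists h; rewrite ?sLE // (same h k) // kk'.
(* The default 0 is reached only where [Γ k] is zero, and [equivalent] constrains [α] on the support
   alone. *)
pose α k := nth 0 sL (find (fun h => Δ h == Γ k) sL).
have αE k : Γ k != 0%VS -> Δ (α k) = Γ k.
  by move=> /hit k_hit; have /eqP := nth_find 0 k_hit.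
exists (Φ^-1)%VF, α; split.
- split; first by exists Φ; [exact: lker0_lfunVK|exact: lker0_lfunK].
  + by move=> M N; apply: Φinj; rewrite ΦM !(lker0_lfunVK Φker).
  + by move=> M; apply: Φinj; rewrite ΦC !(lker0_lfunVK Φker).
- by move=> k k0; rewrite inE -Δ0 αE.
- move=> k k' k0 k'0 E; have EΓ : Γ k = Γ k' by rewrite -αE // E αE.
  apply: (projections_disjoint Γp (x := vpick (Γ k))); rewrite ?vpick0 ?memv_pick //.
  by rewrite EΓ memv_pick.
- move=> h h0; have [k hk] := sub h; have E := same h k h0 hk.
  have k0 : Γ k != 0%VS by rewrite -E Δ0.
  exists k => //; apply: (projections_disjoint Δq (x := vpick (Γ k))).
  + by rewrite αE // memv_pick.
  + by rewrite E memv_pick.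
  + by rewrite vpick0.
- move=> k k0; rewrite -{1}(αE k k0) /= -limg_comp lker0_compVf // lim1g.
  by [].
Qed.

End FineTensor.

(** * The gradings of the factors *)

Section BasisGrading.
Variables (F : fieldType) (A : hurwitz F) (I : finType) (b d : I -> A).
Local Notation B := (@hpolar F A).
Hypothesis dual : forall i j, B (b i) (d j) = (i == j)%:R.
Hypothesis dimA : #|I| = \dim {:A}.

(** Pairing with [d] recovers coefficients, so the [b i] are independent, and their number is the
    dimension. *)
Lemma dual_span x : x = \sum_i B x (d i) *: b i.
Proof.
pose V : vectType F := {ffun I -> F^o}.
have [g gE] : {g : 'Hom(V, A) | g =1 fun c : V => \sum_i (c i : F) *: b i}.
  apply: linfun_exists => a c c'; rewrite scaler_sumr -big_split /=.
  by apply: eq_bigr => i _; rewrite !ffunE scalerDl scalerA.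
have gB (c : V) i : B (g c) (d i) = c i.
  rewrite gE hpolar_suml (bigD1 i) //= hpolarZl dual eqxx mulr1 big1 ?addr0 // => j ji.
  by rewrite hpolarZl dual (negPf ji) mulr0.
have g_inj : lker g == 0%VS.
  by apply/lker0P => c c' cc'; apply/ffunP => i; rewrite -!gB cc'.
have : x \in limg g.
  suff -> : limg g = fullv by exact: memvf.
  apply/eqP; rewrite eqEdim subvf /= limg_dim_eq ?(eqP g_inj) ?capv0 //.
  by rewrite -dimA dimvf /dim /= muln1.
case/memv_imgP=> c _ ->; rewrite [LHS]gE; apply: eq_bigr => i _.
by rewrite gB.
Qed.

Variables (G : zmodType) (deg : I -> G) (Γ : G -> {vspace A}).
Hypothesis bΓ : forall i, b i \in Γ (deg i).
Hypothesis Γd : forall g x i, x \in Γ g -> deg i != g -> B x (d i) = 0.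
Hypothesis bM : forall i j, b i ** b j \in Γ (deg i + deg j).
Hypothesis bC : forall i, (b i)^! \in Γ (deg i).

(** [deg] may repeat values, as the Cartan gradings require: both idempotents have degree 0. *)
Lemma basis_hgrading : hgrading Γ.
Proof.
have [p pE] : {p : G -> 'End(A) | forall g x, p g x = \sum_(i | deg i == g) B x (d i) *: b i}.
  have pL g : linear (fun x : A => \sum_(i | deg i == g) B x (d i) *: b i).
    move=> a x y; rewrite scaler_sumr -big_split; apply: eq_bigr => i _ /=.
    by rewrite hpolarDl hpolarZl scalerDl scalerA.
  by exists (fun g => sval (linfun_exists (pL g))) => g x; rewrite (svalP (linfun_exists _)).
have Γsum g x : x \in Γ g -> x = \sum_(i | deg i == g) B x (d i) *: b i.
  move=> xg; rewrite {1}(dual_span x) (bigID (fun i => deg i == g)) /=.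
  by rewrite [X in _ + X]big1 ?addr0 // => i ig; rewrite (Γd xg ig) scale0r.
pose s := undup [seq deg i | i <- enum I].
have H : homogeneous_projections (V := A) Γ s p.
  split=> [|g x|g h x xh|x]; first exact: undup_uniq.
  - rewrite pE; apply: rpred_sum => i /eqP <-; exact: rpredZ.
  - rewrite pE; case: eqP => [->|gh]; first by rewrite -Γsum.
    rewrite big1 // => i /eqP ig; rewrite (Γd xh) ?scale0r // ig; exact/eqP.
  - rewrite {1}(dual_span x).
    under [RHS]eq_bigr do rewrite pE big_mkcond.
    rewrite exchange_big; apply: eq_bigr => i _ /=; rewrite -big_mkcond -big_filter.
    rewrite (eq_filter (a2 := pred1 (deg i))) => [|g]; last by rewrite /= eq_sym.
    by rewrite filter_pred1_uniq ?undup_uniq ?big_seq1 // mem_undup map_f ?mem_enum.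
apply: (projections_grading (Γ := hgfamily Γ) H) => [g h x y xg yh|g x xg] /=.
  rewrite (Γsum g x xg) (Γsum h y yh) hmul_suml; apply: rpred_sum => i /eqP <-.
  rewrite hmul_sumr; apply: rpred_sum => j /eqP <-.
  by rewrite hmulZl hmulZr !rpredZ.
have [L LE] := linfun_exists (@hconj_linear F A).
rewrite -hbarE -LE (Γsum g x xg) linear_sum; apply: rpred_sum => i /eqP <-.
by rewrite linearZ /= LE rpredZ.
Qed.

End BasisGrading.

(** The case of lines: an orthogonal basis of nonisotropic vectors is its own dual up to the factors
    [c i]. *)
Lemma orthogonal_hgrading (F : fieldType) (A : hurwitz F) (I : finType) (b : I -> A)
    (c : I -> F) (G : zmodType) (deg : I -> G) (Γ : G -> {vspace A}) :
  (forall i, c i != 0) -> (forall i j, hpolar (b i) (b j) = if i == j then c i else 0) ->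
  #|I| = \dim {:A} -> (forall g, exists2 i, g = deg i & Γ g = <[b i]>%VS) ->
  injective deg -> (forall i j, b i ** b j \in Γ (deg i + deg j)) ->
  (forall i, (b i)^! \in <[b i]>%VS) -> hgrading Γ.
Proof.
move=> c0 orth dimA lines deg_inj bM bC.
have lineE i : Γ (deg i) = <[b i]>%VS by have [j /deg_inj <-] := lines (deg i).
apply: (@basis_hgrading F A I b (fun i => (c i)^-1 *: b i) _ dimA G deg) => //.
- move=> i j; rewrite hpolarZr orth; case: eqP => [->|_]; first by rewrite mulVf.
  by rewrite mulr0.
- by move=> i; rewrite lineE memv_line.
- move=> g x i; have [j -> ->] := lines g => /vlineP[k ->]; rewrite (inj_eq deg_inj) => ij.
  by rewrite hpolarZl hpolarZr orth eq_sym (negPf ij) !mulr0.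
- by move=> i; rewrite lineE.
Qed.

(** Some [Δ]-component of [x] projects nontrivially to [Γ g]. It lies in one component of [Γ],
    necessarily this line, so it is a nonzero multiple of [x]. *)
Lemma line_in_refinement (F : fieldType) (A : hurwitz F) (G : zmodType)
    (Γ : G -> {vspace A}) (Δ : gfamily (hurwitz_invalg A)) g x :
  hgrading Γ -> is_grading Δ -> (forall h, exists g, ((Δ h : {vspace A}) <= Γ g)%VS) ->
  Γ g = <[x]>%VS -> exists k, (Γ g <= (Δ k : {vspace A}))%VS.
Proof.
move=> gΓ gΔ ref; have [->|x0] := eqVneq x 0 => gx.
  by exists 0; rewrite gx; apply/subvP => _ /vlineP[a ->]; rewrite scaler0 mem0v.
have [s [p Hp]] := grading_projections gΔ; have [r [q Hq]] := grading_projections gΓ.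
have [_ pΔ _ psum] := Hp; have [_ qΓ qid _] := Hq.
have xg : x \in Γ g by rewrite gx memv_line.
have : q g x != 0 by rewrite (qid _ _ _ xg) eqxx.
rewrite {1}[x]psum linear_sum => sum0.
have [k qk] : exists k, q g (p k x) != 0.
  have [/hasP[k _ fk]|/hasPn all0] := boolP (has (fun k => q g (p k x) != 0) s).
    by exists k.
  by case/eqP: sum0; rewrite big_seq big1 // => k /all0; rewrite negbK => /eqP.
have [g' kg'] := ref k; have pk : p k x \in Γ g' by apply: (subvP kg').
have gg' : g = g'.
  by apply/eqP; apply: contraNT qk => gg'; rewrite (qid _ _ _ pk) (negPf gg').
have pk0 : p k x != 0 by apply: contraNneq qk => ->; rewrite linear0.
exists k; rewrite gx -memvE.
move: pk; rewrite -gg' gx => /vlineP[a E].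
have a0 : a != 0 by apply: contraNneq pk0 => a0; rewrite E a0 scale0r.
by rewrite -[x](scalerK a0) -E rpredZ.
Qed.

Lemma lines_unsplittable (F : fieldType) (A : hurwitz F) (G : zmodType)
    (Γ : G -> {vspace A}) : hgrading Γ -> (forall g, exists x, Γ g = <[x]>%VS) ->
  unsplittable Γ.
Proof.
move=> gΓ lines Δ gΔ ref g; have [x gx] := lines g.
exact: line_in_refinement gΓ gΔ ref gx.
Qed.

(** * Associators in Q, K and C *)

Section Associativity.
Variable F : fieldType.

Lemma hassoc_span (A : hurwitz F) (X : seq A) : (forall x, x \in <<X>>%VS) ->
  (forall x y z, x \in X -> y \in X -> z \in X -> hassoc x y z = 0) ->
  forall x y z : A, hassoc x y z = 0.
Proof.
move=> span HX.
have main (f : A -> A) : linear f -> (forall x, x \in X -> f x = 0) -> forall x, f x = 0.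
  move=> /linfun_exists[L LE] fX x; rewrite -LE; apply/eqP; rewrite -memv_ker.
  apply: (subvP _ _ (span x)); apply/span_subvP => z zX.
  by rewrite memv_ker LE fX.
have l1 y z : linear (fun x : A => hassoc x y z).
  by move=> a x x'; rewrite /hassoc !hmulE; lmod.
have l2 x z : linear (fun y : A => hassoc x y z).
  by move=> a y y'; rewrite /hassoc !hmulE; lmod.
have l3 x y : linear (fun z : A => hassoc x y z).
  by move=> a z z'; rewrite /hassoc !hmulE; lmod.
move=> x y z; move: x; apply: (main) => // x xX; move: y; apply: (main) => // y yX.
by move: z; apply: (main) => // z zX; apply: HX.
Qed.

Lemma quaternion_hassoc (A : hurwitz F) (e u v : A) : quaternion_triple e u v ->
  (forall w, w \in <<[:: e; e^!; u; v]>>%VS) -> forall x y z : A, hassoc x y z = 0.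
Proof.
move=> H span; apply: (hassoc_span span) => x y z.
have fam w : w \in [:: e; e^!; u; v] -> exists i, w = quaternion_family e u v i.
  rewrite !inE => /or4P[] /eqP->.
  - by exists (true, true).
  - by exists (true, false).
  - by exists (false, true).
  - by exists (false, false).
move=> /fam[i ->] /fam[j ->] /fam[k ->]; rewrite /hassoc.
have := fun i j => hmul_quaternion i j H.
move: (quaternion_family e u v) => q qM; rewrite !qM.
by case: i j k => [[] []] [[] []] [[] []] /=;
  rewrite ?(hmulNl, hmulNr, hmul0l, hmul0r) ?qM /= ?(subrr, oppr0, opprK, addNr, addr0).
Qed.

Lemma Q_alg_assoc (x y z : Q_alg F) : (x ** y) ** z = x ** (y ** z).
Proof.
apply/eqP; rewrite -subr_eq0 -/(hassoc x y z); apply/eqP.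
apply: (quaternion_hassoc (Q_alg_standard F)) => w.
by rewrite Q_alg_conj_e1; apply: Q_alg_span.
Qed.

Lemma K_alg_assoc (x y z : K_alg F) : (x ** y) ** z = x ** (y ** z).
Proof.
(* Associativity is inherited from Q through this inclusion. *)
have KQ : (K_space F <= Q_space F)%VS.
  apply/span_subvP => w; rewrite !inE => /orP[] /eqP->; exact: Q_space_cb.
have KE (a b : K_alg F) : vsval (a ** b) = vsval a ** vsval b.
  exact: val_sub_mul (@K_mul F) a b.
have inQ (a : K_alg F) : vsval (to_Q (vsval a)) = vsval a.
  by apply: val_to_Q; apply: (subvP KQ); apply: subvsP.
apply: subvs_inj; rewrite !KE -(inQ x) -(inQ y) -(inQ z).
by rewrite -!hmulQ Q_alg_assoc.
Qed.

Lemma hmul_cb (a b : cidx) :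
  (cb F a : cayley F) ** (cb F b : cayley F) = signed_term (cb F) (cidx_mul a b).
Proof. by rewrite -cb_mulE; exact: cayley_mul_cb. Qed.

(** The trace zero part is spanned by the u_j, the v_j and e1 - e2, which are the associators of
    (e2, v_{j+1}, v_{j+2}), (e1, u_{j+1}, u_{j+2}) and (u_1, u_2, u_3). *)
Lemma cayley_trace0_hassoc : trace0_hassoc (cayley F).
Proof.
move=> P P0 PD Pa x tx.
have Z3add (j : 'Z_3) : j + 1 + 2 = j by move: j; apply: Z3_ind; apply: val_inj.
have Pu a j : P (a *: (cb F (iU j) : cayley F)).
  have := Pa (a *: (cb F iE2 : cayley F)) (cb F (iV (j + 1))) (cb F (iV (j + 1 + 1))).
  rewrite /hassoc !hmulZl !hmul_cb /= eqxx /=.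
  by rewrite cayley_mul_cb /= scaler0 subr0 Z3add.
have Pv a j : P (a *: (cb F (iV j) : cayley F)).
  have := Pa (a *: (cb F iE1 : cayley F)) (cb F (iU (j + 1))) (cb F (iU (j + 1 + 1))).
  rewrite /hassoc !hmulZl; rewrite !hmul_cb /= eqxx /=.
  by rewrite cayley_mul_cb /= scaler0 subr0 Z3add.
have Pe a : P (a *: (cb F iE1 - cb F iE2 : cayley F)).
  have := Pa (a *: (cb F (iU 1) : cayley F)) (cb F (iU 2)) (cb F (iU 3)).
  have -> : hassoc (a *: (cb F (iU 1) : cayley F)) (cb F (iU 2)) (cb F (iU 3)) =
      a *: (cb F iE1 - cb F iE2 : cayley F).
    rewrite /hassoc !hmulZl !hmul_cb /=.
    by lmod.
  by [].
have x12 : (x iE2 : F) = - (x iE1 : F).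
  have t12 : (x iE1 : F) + x iE2 = 0.
    rewrite -tx /htrace (_ : hone _ = cb F iE1 + cb F iE2 :> cayley F) // hpolarDr addrC.
    by congr (_ + _); symmetry; [apply: (cayley_polar_cb x iE2)|apply: (cayley_polar_cb x iE1)].
  by apply/eqP; rewrite -addr_eq0 addrC t12.
rewrite [x]cb_sum big_cidx x12.
have -> : (x iE1 *: cb F iE1 + - x iE1 *: cb F iE2 : cayley F) =
    x iE1 *: (cb F iE1 - cb F iE2 : cayley F) by lmod.
by do !first [exact: Pe | exact: Pu | exact: Pv | apply: (PD)].
Qed.

Lemma cb_neq0 c : cb F c != 0.
Proof. by apply/eqP => /ffunP/(_ c)/eqP; rewrite !ffunE eqxx oner_eq0. Qed.

Lemma cayley_one_neq0 : hone (cayley F) != 0.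
Proof.
apply/eqP => /ffunP/(_ iE1)/eqP; rewrite !ffunE /= addr0.
by rewrite oner_eq0.
Qed.

Lemma Q_alg_one_neq0 : hone (Q_alg F) != 0.
Proof. by apply: contraNneq cayley_one_neq0 => E; rewrite -honeQ E linear0. Qed.

Lemma K_alg_one_neq0 : hone (K_alg F) != 0.
Proof.
have oneK : vsval (hone (K_alg F)) = hone (cayley F) := val_sub_one (one_K F).
by apply: contraNneq cayley_one_neq0 => E; rewrite -oneK E linear0.
Qed.

End Associativity.

Lemma line_neq0 (F : fieldType) (V : vectType F) (x : V) : (<[x]>%VS != 0%VS) = (x != 0).
Proof. by rewrite -dimv_eq0 dim_vline eqb0 negbK. Qed.

(** * The Cartan grading of the Cayley algebra *)

Section CartanCayley.
Variable F : fieldType.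
Local Notation C := (cayley F).

Lemma hconj_cb c : (cb F c : C)^! =
  match c with iE1 => cb F iE2 | iE2 => cb F iE1 | _ => - cb F c end.
Proof.
have e1E : (cb F iE1 : C)^! = cb F iE2 by exact: cayley_conj_e1.
have He := cayley_idempotent_e1 F; case: c => [||i|i] //.
- by rewrite -e1E hconjK.
- exact: (hpeirce_conj He (cayley_peirce_u F i)).
- exact: (hpeirce_conj (hidempotent_conj He) (cayley_peirce_v F i)).
Qed.

(** Dual labels have opposite degrees, and the degrees of the three [iU i] add up to 0, as u_1 u_2 =
    v_3 demands. *)
Definition cidx_degree (c : cidx) : int * int :=
  match c with
  | iE1 | iE2 => (0, 0)
  | iU i => if i == 1 then (1, 0) else if i == 2 then (0, 1) else (-1, -1)
  | iV i => if i == 1 then (-1, 0) else if i == 2 then (0, -1) else (1, 1)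
  end.

Lemma cartan_C_cb c : (cb F c : C) \in cartan_C F (cidx_degree c).
Proof.
case: c => [||i|i].
- by rewrite /cartan_C /= (subvP (addvSl _ _)) // memv_line.
- by rewrite /cartan_C /= (subvP (addvSr _ _)) // memv_line.
- by move: i; apply: Z3_ind; rewrite /cartan_C /= memv_line.
- by move: i; apply: Z3_ind; rewrite /cartan_C /= memv_line.
Qed.

Lemma cartan_C_coord g (x : C) c : x \in cartan_C F g -> cidx_degree c != g ->
  hpolar x (cb F (cidx_dual c) : C) = 0.
Proof.
have line d : cidx_degree d = g -> x \in <[cb F d : C]>%VS -> cidx_degree c != g ->
    hpolar x (cb F (cidx_dual c) : C) = 0.
  move=> dg /vlineP[k ->] cg; rewrite hpolarZl hpolar_cb cidx_dualK.
  by case: eqP => [dc|_]; rewrite ?mulr0 // -dg dc eqxx in cg *.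
rewrite /cartan_C; case: eqP => [->|_].
  case/memv_addP=> _ /vlineP[k ->] [_ /vlineP[l ->] ->] c0.
  rewrite !hpolarE !hpolar_cb cidx_dualK.
  by case: c {line} c0 => [||i|i] // _; rewrite /= !mulr0 addr0.
case: eqP => [E|_]; first by apply: (line (iU 1)).
case: eqP => [E|_]; first by apply: (line (iV 1)).
case: eqP => [E|_]; first by apply: (line (iU 2)).
case: eqP => [E|_]; first by apply: (line (iV 2)).
case: eqP => [E|_]; first by apply: (line (iV 3)).
case: eqP => [E|_]; first by apply: (line (iU 3)).
by rewrite memv0 => /eqP-> _; rewrite hpolar0l.
Qed.

Lemma cidx_mul_degree i j s c : cidx_mul i j = Some (s, c) ->
  cidx_degree c = cidx_degree i + cidx_degree j.
Proof.
case: i j => [||i|i] [||j|j] //=; try by case=> _ <-; rewrite ?add0r ?addr0.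
all: move: i j; do 2!apply: Z3_ind => //=; by case=> _ <-.
Qed.

Lemma cartan_C_grading : hgrading (cartan_C F).
Proof.
apply: (@basis_hgrading F C cidx (fun c => cb F c) (fun c => cb F (cidx_dual c)) _ _ _ cidx_degree).
- by move=> i j; rewrite hpolar_cb cidx_dualK.
- by rewrite dim_cayley -sum1_card big_cidx.
- exact: cartan_C_cb.
- exact: cartan_C_coord.
- move=> i j; rewrite hmul_cb; case E: (cidx_mul i j) => [[s c]|]; last exact: mem0v.
  rewrite -(cidx_mul_degree E); case: s {E} => /=; rewrite ?memvN; exact: cartan_C_cb.
- case=> [||i|i]; rewrite hconj_cb ?memvN; [exact: (cartan_C_cb iE2)|exact: (cartan_C_cb iE1)
    |exact: cartan_C_cb|exact: cartan_C_cb].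
Qed.

Lemma cartan_C_unsplittable : unsplittable (cartan_C F).
Proof.
move=> Δ gΔ ref.
have line g x : cartan_C F g = <[x]>%VS -> exists k, (cartan_C F g <= (Δ k : {vspace C}))%VS.
  exact: line_in_refinement cartan_C_grading gΔ ref.
have [k uk] := line (1, 0) (u_ F 1) erefl; have [l vl] := line (-1, 0) (v_ F 1) erefl.
have uΔ : u_ F 1 \in Δ k by apply: (subvP uk); apply: memv_line.
have vΔ : v_ F 1 \in Δ l by apply: (subvP vl); apply: memv_line.
have uvE : u_ F 1 ** v_ F 1 = - e1 F by exact: (cayley_mul_cb F (iU 1) (iV 1)).
have vuE : v_ F 1 ** u_ F 1 = - e2 F by exact: (cayley_mul_cb F (iV 1) (iU 1)).
move=> g; rewrite {1}/cartan_C; case: eqP => _.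
  (* The degrees [k + l] and [l + k] agree because the grading group is abelian. *)
  have e1Δ : e1 F \in Δ (k + l) by rewrite -memvN -uvE; apply: (graded_mul gΔ uΔ vΔ).
  have e2Δ : e2 F \in Δ (l + k) by rewrite -memvN -vuE; apply: (graded_mul gΔ vΔ uΔ).
  by exists (k + l); rewrite subv_add -!memvE e1Δ addrC.
have lineE x : cartan_C F g = <[x]>%VS -> exists k, (<[x]> <= (Δ k : {vspace C}))%VS.
  by move=> E; rewrite -E; apply: line E.
have [_|_] := eqVneq g (1, 0); first by exists k.
have [_|_] := eqVneq g (-1, 0); first by exists l.
have [E|_] := eqVneq g (0, 1); first by apply: lineE; rewrite E.
have [E|_] := eqVneq g (0, -1); first by apply: lineE; rewrite E.
have [E|_] := eqVneq g (1, 1); first by apply: lineE; rewrite E.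
have [E|_] := eqVneq g (-1, -1); first by apply: lineE; rewrite E.
by exists 0; apply: sub0v.
Qed.

Definition cartan_C_support : seq (int * int) :=
  [:: (0, 0); (1, 0); (-1, 0); (0, 1); (0, -1); (1, 1); (-1, -1)].

Lemma cartan_C_supportP : is_support (cartan_C F) cartan_C_support.
Proof.
split=> // g; rewrite !inE /cartan_C.
case: eqP => _ /=; first symmetry.
  apply/negP => /eqP E; have := memv_line (e1 F); move/(subvP (addvSl _ <[e2 F]>%VS)).
  by rewrite E memv0 (negPf (cb_neq0 F iE1)).
do 6!(case: eqP => _ /=; first by rewrite line_neq0 cb_neq0).
by rewrite eqxx.
Qed.

End CartanCayley.

Lemma Z2_ind (P : 'Z_2 -> Prop) : P 0 -> P 1 -> forall i, P i.
Proof.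
move=> P0 P1 [[|[|//]] i2].
- by rewrite (_ : Ordinal i2 = 0) //; apply: val_inj.
- by rewrite (_ : Ordinal i2 = 1) //; apply: val_inj.
Qed.

Lemma zpow_mul (F : fieldType) (A : hurwitz F) (u v w : A) a b c :
  zpow u a ** zpow v b ** zpow w c =
  if c == 0 then
    if b == 0 then if a == 0 then hone A else u else if a == 0 then v else u ** v
  else if b == 0 then if a == 0 then w else u ** w
  else if a == 0 then v ** w else u ** v ** w.
Proof. by move: a b c; do 3!apply: Z2_ind; rewrite /zpow /= ?hmul1x ?hmulx1. Qed.

(* The homogeneous vectors of the (Z/2)^3-grading are c + s c*, with c and its
   dual c* ranging over the four hyperbolic pairs of the canonical basis and s = 1, -1. *)
Definition cd_index (b c : 'Z_2) : cidx :=
  if b == 0 then if c == 0 then iE1 else iU 2 else if c == 0 then iU 1 else iV 3.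

Section CanonicalBasis.
Variables (F : fieldType) (A : hurwitz F) (q : cidx -> A).

Definition cd_sign (a : 'Z_2) : F := if a == 0 then 1 else -1.

Definition cd_combination (g : 'Z_2 * 'Z_2 * 'Z_2) : A :=
  let: (a, b, c) := g in
  q (cd_index b c) + cd_sign a *: q (cidx_dual (cd_index b c)).

Hypothesis qM : forall c d, q c ** q d = signed_term q (cidx_mul c d).

Lemma cd_combinationE a b c : hone A = q iE1 + q iE2 ->
  zpow (q iE1 - q iE2) a ** zpow (q (iU 1) + q (iV 1)) b ** zpow (q (iU 2) + q (iV 2)) c =
  cd_combination (a, b, c).
Proof.
move=> oneE; rewrite zpow_mul /cd_combination /cd_index /cd_sign.
have uv : (q iE1 - q iE2) ** (q (iU 1) + q (iV 1)) = q (iU 1) - q (iV 1).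
  by rewrite !(hmulDl, hmulDr, hmulNl, hmulNr) !qM /=; lmod.
have uw : (q iE1 - q iE2) ** (q (iU 2) + q (iV 2)) = q (iU 2) - q (iV 2).
  by rewrite !(hmulDl, hmulDr, hmulNl, hmulNr) !qM /=; lmod.
have vw : (q (iU 1) + q (iV 1)) ** (q (iU 2) + q (iV 2)) = q (iV 3) + q (iU 3).
  by rewrite !(hmulDl, hmulDr, hmulNl, hmulNr) !qM /=; lmod.
have uvw : (q (iU 1) - q (iV 1)) ** (q (iU 2) + q (iV 2)) = q (iV 3) - q (iU 3).
  by rewrite !(hmulDl, hmulDr, hmulNl, hmulNr) !qM /=; lmod.
rewrite uv uw vw uvw oneE.
by move: a b c; do 3!apply: Z2_ind; rewrite /= ?scale1r ?scaleN1r.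
Qed.

Lemma hmul_cd_combination g h :
  exists s, cd_combination g ** cd_combination h = s *: cd_combination (g + h).
Proof.
have z2 : 1 + 1 = 0 :> 'Z_2 by apply: val_inj.
have [t13 t21 t32] : [/\ 1 + 2 = 3 :> 'Z_3, 2 + 2 = 1 :> 'Z_3 & 3 + 2 = 2 :> 'Z_3].
  by split; apply: val_inj.
case: g h => [[a b] c] [[a' b'] c'].
rewrite (_ : (a, b, c) + (a', b', c') = (a + a', b + b', c + c')) // /cd_combination.
rewrite !(hmulDl, hmulDr, hmulZl, hmulZr) !qM /cd_sign.
move: a b c a' b' c'; do 6!apply: Z2_ind; rewrite ?z2 ?addr0 ?add0r /cd_index /=;
  rewrite ?(scale1r, scaleN1r) ?(t13, t21, t32) /=.
all: first [by exists 1; lmod | by exists (-1); lmod].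
Qed.

Lemma hconj_cd_combination g :
  (forall c, (q c)^! = match c with iE1 => q iE2 | iE2 => q iE1 | _ => - q c end) ->
  exists s, (cd_combination g)^! = s *: cd_combination g.
Proof.
move=> qC; case: g => [[a b] c].
rewrite /cd_combination hconjD hconjZ !qC /cd_index /cd_sign.
move: a b c; do 3!apply: Z2_ind => /=.
all: first [by exists 1; lmod | by exists (-1); lmod].
Qed.

End CanonicalBasis.

(** * An orthogonal homogeneous basis for the (Z/2)^r-gradings *)

Section CayleyDickson.
Variable F : fieldType.
Hypothesis char_neq2 : (2 : F) != 0.
Local Notation C := (cayley F).

Definition cd_vector : 'Z_2 * 'Z_2 * 'Z_2 -> C := cd_combination (cb F : cidx -> C).

Lemma cd_vectorE a b c :
  zpow (e1 F - e2 F) a ** zpow (u_ F 1 + v_ F 1) b ** zpow (u_ F 2 + v_ F 2) c =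
  cd_vector (a, b, c).
Proof. exact: (cd_combinationE (@hmul_cb F)). Qed.

Lemma cd_CE g : cd_C F g = <[cd_vector g]>%VS.
Proof. by case: g => [[a b] c]; rewrite -cd_vectorE. Qed.

Lemma hpolar_cd g h :
  hpolar (cd_vector g) (cd_vector h) = if g == h then 2 * cd_sign F g.1.1 else 0.
Proof.
case: g h => [[a b] c] [[a' b'] c'].
rewrite /cd_vector /cd_combination !hpolarE !hpolar_cb !cidx_dualK.
by move: a b c a' b' c'; do 6!apply: Z2_ind => /=; rewrite /cd_sign /=; ring.
Qed.

Lemma hmul_cd g h : exists s, cd_vector g ** cd_vector h = s *: cd_vector (g + h).
Proof. exact: (hmul_cd_combination (@hmul_cb F)). Qed.

Lemma hconj_cd g : exists s, (cd_vector g)^! = s *: cd_vector g.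
Proof. exact: (hconj_cd_combination _ (@hconj_cb F)). Qed.

Lemma cd_sign_neq0 a : 2 * cd_sign F a != 0.
Proof. by rewrite /cd_sign; case: ifP => _; rewrite ?mulrN1 ?oppr_eq0 ?mulr1. Qed.

Lemma cd_vector_neq0 g : cd_vector g != 0.
Proof.
apply/eqP => E; have := hpolar_cd g g; rewrite E hpolar0l eqxx => /esym/eqP.
by rewrite (negPf (cd_sign_neq0 _)).
Qed.

(** Covers [cd_C], [pauli_Q] and [grading_K] at once: products, involution and form are computed in
    C through [ι], and [f] embeds the grading group in (Z/2)^3. *)
Lemma cd_subalgebra_grading (A : hurwitz F) (ι : 'Hom(A, C)) (I : finType) (G : zmodType)
    (Γ : G -> {vspace A}) (b : I -> A) (deg : I -> G) (f : G -> 'Z_2 * 'Z_2 * 'Z_2) :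
  injective ι -> (forall x y, ι (x ** y) = ι x ** ι y) -> (forall x, ι x^! = (ι x)^!) ->
  (forall x y, hpolar (ι x) (ι y) = hpolar x y) ->
  injective f -> {morph f : g h / g + h} -> injective deg ->
  (forall i, ι (b i) = cd_vector (f (deg i))) ->
  (forall g, exists2 i, g = deg i & Γ g = <[b i]>%VS) -> #|I| = \dim {:A} ->
  hgrading Γ.
Proof.
move=> ι_inj ιM ιC ιB f_inj fD deg_inj bE lines dimA.
apply: (orthogonal_hgrading (b := b) (c := fun i => 2 * cd_sign F (f (deg i)).1.1)
  (deg := deg)) => //.
- by move=> i; apply: cd_sign_neq0.
- move=> i j; rewrite -ιB !bE hpolar_cd (inj_eq f_inj) (inj_eq deg_inj).
  by [].
- move=> i j; have [k kE Γk] := lines (deg i + deg j).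
  have [s E] := hmul_cd (f (deg i)) (f (deg j)).
  rewrite Γk; apply/vlineP; exists s; apply: ι_inj.
  by rewrite ιM !bE E -fD kE linearZ /= bE.
- move=> i; have [s E] := hconj_cd (f (deg i)); apply/vlineP; exists s; apply: ι_inj.
  by rewrite ιC bE E linearZ /= bE.
Qed.

End CayleyDickson.

(** * The six factor lemmas: gradings, unsplittability and supports for the remaining families *)

Section ConcreteGradings.
Variable F : fieldType.
Hypothesis char_neq2 : (2 : F) != 0.
Local Notation C := (cayley F).
Local Notation Q := (Q_alg F).
Local Notation K := (K_alg F).

Lemma cd_C_grading : hgrading (cd_C F).
Proof.
apply: (cd_subalgebra_grading char_neq2 (ι := \1%VF) (b := @cd_vector F) (deg := id) (f := id)).
- by move=> x y; rewrite !lfunE.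
- by move=> x y; rewrite !lfunE.
- by move=> x; rewrite !lfunE.
- by move=> x y; rewrite !lfunE.
- by [].
- by [].
- by [].
- by move=> g; rewrite lfunE.
- by move=> g; exists g; rewrite ?cd_CE.
- by rewrite !card_prod !card_ord dim_cayley.
Qed.

Lemma cd_C_unsplittable : unsplittable (cd_C F).
Proof.
by apply: lines_unsplittable => [|g]; [exact: cd_C_grading|exists (cd_vector F g); exact: cd_CE].
Qed.

Lemma cd_C_support : is_support (cd_C F) (enum {: 'Z_2 * 'Z_2 * 'Z_2}).
Proof.
split=> [|g]; first exact: enum_uniq.
by rewrite mem_enum cd_CE line_neq0 cd_vector_neq0.
Qed.

Definition pauli_vector (g : 'Z_2 * 'Z_2) : Q :=
  zpow (to_Q (e1 F - e2 F)) g.1 ** zpow (to_Q (u_ F 1 + v_ F 1)) g.2.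

Lemma val_zpowQ (x : C) a : x \in Q_space F -> vsval (zpow (to_Q x) a) = zpow x a.
Proof. by move=> xQ; rewrite /zpow; case: ifP => _; rewrite ?honeQ ?val_to_Q. Qed.

Lemma val_pauli_vector g : vsval (pauli_vector g) = cd_vector F (g.1, g.2, 0).
Proof.
have mem c : c \in [:: iE1; iE2; iU 1; iV 1] -> (cb F c : C) \in Q_space F.
  exact: Q_space_cb.
rewrite /pauli_vector hmulQ !val_zpowQ; first by rewrite -cd_vectorE // hmulx1.
  by rewrite rpredD ?(mem (iU 1)) ?(mem (iV 1)) // !inE eqxx ?orbT.
by rewrite rpredB ?(mem iE1) ?(mem iE2).
Qed.

Lemma pauli_Q_grading : hgrading (pauli_Q F).
Proof.
have [ι ιE] : {ι : 'Hom(Q, C) | forall x, ι x = vsval x}.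
  by apply: linfun_exists => a x y; rewrite linearP.
apply: (cd_subalgebra_grading char_neq2 (ι := ι) (b := pauli_vector) (deg := id)
  (f := fun g => (g.1, g.2, 0))).
- by move=> x y; rewrite !ιE; apply: subvs_inj.
- by move=> x y; rewrite !ιE hmulQ.
- by move=> x; rewrite !ιE hbarQ.
- by move=> x y; rewrite !ιE hpolarQ.
- by move=> [a b] [a' b'] /= [-> ->].
- by move=> g h; congr (_, _); apply: val_inj.
- by [].
- by move=> g; rewrite ιE val_pauli_vector.
- by move=> [a b]; exists (a, b).
- by rewrite !card_prod !card_ord dim_Q_alg.
Qed.

Lemma pauli_Q_unsplittable : unsplittable (pauli_Q F).
Proof.
apply: lines_unsplittable => [|[a b]]; first exact: pauli_Q_grading.
by exists (pauli_vector (a, b)).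
Qed.

Lemma pauli_Q_support : is_support (pauli_Q F) (enum {: 'Z_2 * 'Z_2}).
Proof.
split=> [|[a b]]; first exact: enum_uniq.
rewrite mem_enum /pauli_Q line_neq0 -/(pauli_vector (a, b)).
symmetry; apply/eqP => E; have := val_pauli_vector (a, b); rewrite E linear0 => /esym/eqP.
by rewrite (negPf (cd_vector_neq0 char_neq2 _)).
Qed.

Definition K_vector (a : 'Z_2) : K := zpow (to_K (e1 F - e2 F)) a.

Lemma val_K_vector a : vsval (K_vector a) = cd_vector F (a, 0, 0).
Proof.
rewrite -cd_vectorE // zpow_mul !eqxx /K_vector /zpow; case: ifP => _.
  exact: val_sub_one (one_K F).
by rewrite vsprojK // rpredB // memv_span // !inE eqxx ?orbT.
Qed.

Lemma hpolarK (x y : K) : hpolar x y = hpolar (vsval x) (vsval y).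
Proof. exact: polar_sub_norm. Qed.

Lemma hmulK (x y : K) : vsval (x ** y) = vsval x ** vsval y.
Proof. exact: val_sub_mul (@K_mul F) x y. Qed.

Lemma honeK : vsval (hone K) = hone C.
Proof. exact: val_sub_one (one_K F). Qed.

Lemma hbarK (x : K) : vsval x^! = (vsval x)^!.
Proof. by rewrite !hconjE linearB linearZ /= honeK /htrace hpolarK honeK. Qed.

Lemma grading_K_grading : hgrading (grading_K F).
Proof.
have [ι ιE] : {ι : 'Hom(K, C) | forall x, ι x = vsval x}.
  by apply: linfun_exists => a x y; rewrite linearP.
apply: (cd_subalgebra_grading char_neq2 (ι := ι) (b := K_vector) (deg := id)
  (f := fun a => (a, 0, 0))).
- by move=> x y; rewrite !ιE; apply: subvs_inj.
- by move=> x y; rewrite !ιE hmulK.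
- by move=> x; rewrite !ιE hbarK.
- by move=> x y; rewrite !ιE hpolarK.
- by move=> a b [].
- by move=> a b; congr (_, _, _); apply: val_inj.
- by [].
- by move=> a; rewrite ιE val_K_vector.
- by move=> a; exists a.
- by rewrite card_ord dim_K_alg.
Qed.

Lemma grading_K_unsplittable : unsplittable (grading_K F).
Proof.
by apply: lines_unsplittable => [|a]; [exact: grading_K_grading|exists (K_vector a)].
Qed.

Lemma grading_K_support : is_support (grading_K F) (enum 'Z_2).
Proof.
split=> [|a]; first exact: enum_uniq.
rewrite mem_enum /grading_K line_neq0 -/(K_vector a).
symmetry; apply/eqP => E; have := val_K_vector a; rewrite E linear0 => /esym/eqP.
by rewrite (negPf (cd_vector_neq0 char_neq2 _)).
Qed.

Definition quaternion_degree (i : bool * bool) : int :=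
  if i.1 then 0 else if i.2 then 1 else -1.

Lemma cartan_Q_grading : hgrading (cartan_Q F).
Proof.
have H := Q_alg_standard F; have [He Uu Vv uv] := H.
have f0 := Q_alg_conj_e1 F.
pose q := quaternion_family (to_Q (e1 F)) (to_Q (u_ F 1)) (to_Q (v_ F 1)).
have qB i j : hpolar (q i) (q j) = (i == quaternion_dual j)%:R by exact: hpolar_quaternion.
have dualK i : quaternion_dual (quaternion_dual i) = i.
  by case: i => a b; rewrite /quaternion_dual /= negbK.
have qΓ i : q i \in cartan_Q F (quaternion_degree i).
  case: i => [[] []]; rewrite /cartan_Q /=.
  - by rewrite (subvP (addvSl _ _)) // memv_line.
  - by rewrite /q /= f0 (subvP (addvSr _ _)) // memv_line.
  - exact: memv_line.
  - exact: memv_line.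
apply: (@basis_hgrading F Q _ q (fun i => q (quaternion_dual i)) _ _ _ quaternion_degree).
- by move=> i j; rewrite qB dualK.
- by rewrite card_prod !card_bool dim_Q_alg.
- exact: qΓ.
- move=> g x i; rewrite /cartan_Q; case: eqP => [->|_].
    case/memv_addP=> _ /vlineP[k ->] [_ /vlineP[l ->] ->] i0.
    rewrite -f0 -[to_Q (e1 F)]/(q (true, true)) -[X in _ *: X^!]/(q (true, true)).
    rewrite -[(q (true, true))^!]/(q (true, false)) !hpolarE !qB dualK.
    by case: i i0 => [[] []] //= _; rewrite !mulr0 addr0.
  case: eqP => [->|_].
    case/vlineP=> k -> i0; rewrite -[to_Q _]/(q (false, true)) hpolarZl qB dualK.
    by case: i i0 => [[] []] //= _; rewrite mulr0.
  case: eqP => [->|_].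
    case/vlineP=> k -> i0; rewrite -[to_Q _]/(q (false, false)) hpolarZl qB dualK.
    by case: i i0 => [[] []] //= _; rewrite mulr0.
  by rewrite memv0 => /eqP-> _; rewrite hpolar0l.
- move=> i j; rewrite /q hmul_quaternion // -/q.
  case E: (quaternion_table i j) => [[s k]|]; last exact: mem0v.
  rewrite (_ : _ + _ = quaternion_degree k).
    by case: s {E} => /=; rewrite ?memvN; apply: qΓ.
  by case: i j E => [[] []] [[] []] //= [_ <-].
- case=> [[] []]; rewrite /q /=.
  + exact: (qΓ (true, false)).
  + by rewrite hconjK; exact: (qΓ (true, true)).
  + by rewrite (hpeirce_conj He Uu) memvN; exact: (qΓ (false, true)).
  + by rewrite (hpeirce_conj (hidempotent_conj He) Vv) memvN; exact: (qΓ (false, false)).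
Qed.

Lemma cartan_Q_unsplittable : unsplittable (cartan_Q F).
Proof.
move=> Δ gΔ ref; have [He Uu Vv uv] := Q_alg_standard F; have f0 := Q_alg_conj_e1 F.
have line g x : cartan_Q F g = <[x]>%VS -> exists k, (cartan_Q F g <= (Δ k : {vspace Q}))%VS.
  exact: line_in_refinement cartan_Q_grading gΔ ref.
have [k uk] := line 1 (to_Q (u_ F 1)) erefl; have [l vl] := line (-1) (to_Q (v_ F 1)) erefl.
have uΔ : to_Q (u_ F 1) \in Δ k by apply: (subvP uk); apply: memv_line.
have vΔ : to_Q (v_ F 1) \in Δ l by apply: (subvP vl); apply: memv_line.
have uvE : to_Q (u_ F 1) ** to_Q (v_ F 1) = - to_Q (e1 F).
  by rewrite (hpeirce_mulUV He Uu Vv) uv scale1r.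
have vuE : to_Q (v_ F 1) ** to_Q (u_ F 1) = - to_Q (e2 F).
  by rewrite (hpeirce_mulVU He Uu Vv) uv scale1r f0.
move=> g; rewrite {1}/cartan_Q; case: eqP => _.
  have e1Δ : to_Q (e1 F) \in Δ (k + l).
    by rewrite -memvN -uvE; apply: (graded_mul gΔ uΔ vΔ).
  have e2Δ : to_Q (e2 F) \in Δ (l + k).
    by rewrite -memvN -vuE; apply: (graded_mul gΔ vΔ uΔ).
  by exists (k + l); rewrite subv_add -!memvE e1Δ addrC.
have [_|_] := eqVneq g 1; first by exists k.
have [_|_] := eqVneq g (-1); first by exists l.
by exists 0; apply: sub0v.
Qed.

Lemma cartan_Q_support : is_support (cartan_Q F) [:: 0; 1; -1].
Proof.
have inj (c : cidx) : c \in [:: iE1; iE2; iU 1; iV 1] -> to_Q (cb F c) != 0.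
  move=> cQ; apply: contraNneq (cb_neq0 F c) => E.
  by rewrite -[cb F c](val_to_Q (Q_space_cb F cQ)) E linear0.
split=> // g; rewrite !inE /cartan_Q.
case: eqP => _ /=; first symmetry.
  apply/negP => /eqP E; have := memv_line (to_Q (e1 F)).
  move/(subvP (addvSl _ <[to_Q (e2 F)]>%VS)).
  by rewrite E memv0 (negPf (inj iE1 _)).
case: eqP => _ /=; first by rewrite line_neq0 (inj (iU 1)).
case: eqP => _ /=; first by rewrite line_neq0 (inj (iV 1)) // !inE eqxx ?orbT.
by rewrite eqxx.
Qed.

End ConcreteGradings.

(** * Indexing of the factor gradings, and the theorem *)

Section Families.
Variable F : fieldType.

Definition cayley_group (i : bool) : zmodType :=
  if i then ('Z_2 * 'Z_2 * 'Z_2)%type : zmodType else (int * int)%type : zmodType.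

Definition cayley_family (i : bool) : cayley_group i -> {vspace cayley F} :=
  match i with true => cd_C F | false => cartan_C F end.

Definition cayley_support (i : bool) : seq (cayley_group i) :=
  match i with
  | true => enum {: 'Z_2 * 'Z_2 * 'Z_2} | false => cartan_C_support
  end.

Definition Q_group (j : bool) : zmodType :=
  if j then ('Z_2 * 'Z_2)%type : zmodType else int : zmodType.

Definition Q_family (j : bool) : Q_group j -> {vspace Q_alg F} :=
  match j with true => pauli_Q F | false => cartan_Q F end.

Definition Q_support (j : bool) : seq (Q_group j) :=
  match j with true => enum {: 'Z_2 * 'Z_2} | false => [:: 0; 1; -1] end.

End Families.

Theorem mainTheorem3 (F : closedFieldType) (charF : 2%N \notin [pchar F]%R) :
  fine_gradings_are (CK_gradings F) /\ fine_gradings_are (CQ_gradings F).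
Proof.
have char_neq2 : (2 : F) != 0 by apply: contra charF => /eqP E; rewrite inE /= E eqxx.
have oneC := cayley_one_neq0 F; have assocC := @cayley_trace0_hassoc F.
have gC i : hgrading (@cayley_family F i).
  by case: i; [exact: cd_C_grading|exact: cartan_C_grading].
have uC i : unsplittable (@cayley_family F i).
  by case: i; [exact: cd_C_unsplittable|exact: cartan_C_unsplittable].
have sC i : is_support (@cayley_family F i) (cayley_support i).
  by case: i; [exact: cd_C_support|exact: cartan_C_supportP].
have classC (Γ : gfamily (hurwitz_invalg (cayley F))) : is_grading Γ ->
    exists i (φ : 'End(cayley F)), @is_automorphism F (hurwitz_invalg (cayley F)) φ /\
      carries φ (@cayley_family F i) Γ.
  move=> /(cayley_gradings char_neq2)[φ Hφ [car|car]].
    by exists false, φ.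
  by exists true, φ.
have gQ j : hgrading (@Q_family F j).
  by case: j; [exact: pauli_Q_grading|exact: cartan_Q_grading].
have uQ j : unsplittable (@Q_family F j).
  by case: j; [exact: pauli_Q_unsplittable|exact: cartan_Q_unsplittable].
have sQ j : is_support (@Q_family F j) (Q_support j).
  by case: j; [exact: pauli_Q_support|exact: cartan_Q_support].
have classQ (Γ : gfamily (hurwitz_invalg (Q_alg F))) : is_grading Γ ->
    exists j (ψ : 'End(Q_alg F)), @is_automorphism F (hurwitz_invalg (Q_alg F)) ψ /\
      carries ψ (@Q_family F j) Γ.
  move=> /(Q_alg_gradings char_neq2)[ψ Hψ [car|car]].
    by exists false, ψ.
  by exists true, ψ.
(* K contributes a single grading, so its index type is [unit]. *)
have gK (j : unit) := grading_K_grading char_neq2.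
have uK (j : unit) := grading_K_unsplittable char_neq2.
have sK (j : unit) := grading_K_support char_neq2.
have classK (Γ : gfamily (hurwitz_invalg (K_alg F))) : is_grading Γ ->
    exists (j : unit) (ψ : 'End(K_alg F)), @is_automorphism F (hurwitz_invalg (K_alg F)) ψ /\
      carries ψ (grading_K F) Γ.
  move=> /K_alg_gradings car; exists tt, \1%VF; split=> //.
  split; first by exists id => x; rewrite lfunE.
    by move=> x y; rewrite !lfunE.
  by move=> x; rewrite !lfunE.
have size3 : size (enum {: 'Z_2 * 'Z_2 * 'Z_2}) = 8%N.
  by rewrite -cardE !card_prod !card_ord.
have size2 : size (enum {: 'Z_2 * 'Z_2}) = 4%N by rewrite -cardE !card_prod !card_ord.
have size1 : size (enum 'Z_2) = 2%N by rewrite -cardE card_ord.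
split.
- have fineK := product_grading_fine char_neq2 oneC (K_alg_one_neq0 F) assocC (@K_alg_assoc F)
    gC gK uC uK.
  have suppK := product_support sC sK.
  split.
  + by case=> [[|[|//]] ?]; [exact: (fineK true tt)|exact: (fineK false tt)].
  + move=> Γ /(fine_product_grading char_neq2 oneC (K_alg_one_neq0 F) assocC (@K_alg_assoc F)
      gC gK sC sK classC classK)[[] [[] E]].
      by exists (@Ordinal 2 0 isT).
    by exists (@Ordinal 2 1 isT).
  (* The supports have 8 * 2 = 16 and 7 * 2 = 14 elements. *)
  + case=> [[|[|//]] ?] [[|[|//]] ?] E; apply: val_inj => //=.
    * have := equivalent_support_size (suppK true tt) (suppK false tt) E.
      by rewrite !size_allpairs /= size3 size1.
    * have := equivalent_support_size (suppK false tt) (suppK true tt) E.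
      by rewrite !size_allpairs /= size3 size1.
have fineQ := product_grading_fine char_neq2 oneC (Q_alg_one_neq0 F) assocC (@Q_alg_assoc F)
  gC gQ uC uQ.
have suppQ := product_support sC sQ.
split.
- by case=> [[|[|[|[|//]]]] ?]; [exact: (fineQ true true)|exact: (fineQ true false)
    |exact: (fineQ false true)|exact: (fineQ false false)].
- move=> Γ /(fine_product_grading char_neq2 oneC (Q_alg_one_neq0 F) assocC (@Q_alg_assoc F)
    gC gQ sC sQ classC classQ)[[] [[] E]].
  + by exists (@Ordinal 4 0 isT).
  + by exists (@Ordinal 4 1 isT).
  + by exists (@Ordinal 4 2 isT).
  + by exists (@Ordinal 4 3 isT).
(* Decodes the position in [CQ_gradings] into the two factor gradings; the supports have 32, 24, 28
   and 21 elements in this order. *)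
- pose ix (i : 'I_4) : bool * bool := ((i < 2)%N, ~~ odd i).
  have sizeE i j : equivalent (CQ_gradings F i) (CQ_gradings F j) ->
      (size (cayley_support (ix i).1) * size (Q_support (ix i).2) =
       size (cayley_support (ix j).1) * size (Q_support (ix j).2))%N.
    have LE k : CQ_gradings F k =
        product_grading (@cayley_family F) (@Q_family F) (ix k).1 (ix k).2.
      by case: k => [[|[|[|[|//]]]] ?].
    by rewrite !LE => /(equivalent_support_size (suppQ _ _) (suppQ _ _)); rewrite !size_allpairs.
  case=> [[|[|[|[|//]]]] ?] [[|[|[|[|//]]]] ?] /sizeE; rewrite /ix /= ?size3 ?size2 // => _;
    exact: val_inj.
Qed.
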